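(* Assume condition (A) holds for some $\ell\in\mathbb R$ and let $U$ be a Gaussian noise with spectral measure $\mu$. Then for any $p\in[1,\infty)$, $\kappa>\frac{3d}{p}$ and $\beta<\frac\ell2-\frac{4d}p$, $U$ (viewed as a random distribution on $\mathbb R^{2d}$ via $\mathcal R_jU(z):=U(\tau_z\check\phi_j)$) satisfies $\mathbf E\big(\|U\|^p_{\mathbf C^\beta_a(\rho_\kappa)}\big)<\infty$, i.e. $U\in L^p(\Omega;\mathbf C^\beta_a(\rho_\kappa;\mathbb R))$.
   Context: Fix $d\ge2$; $z=(x,v)\in\mathbb R^{2d}$, $|z|_a:=|x|^{1/3}+|v|$, $B^a_r:=\{|z|_a\le r\}$, $\rho_\kappa(z):=((1+|x|^2)^{1/3}+1+|v|^2)^{-\kappa/2}$, $2^{sa}\xi:=(2^{3s}\xi_1,2^s\xi_2)$. Let $\chi_0$ be symmetric smooth, $=1$ on $B^a_1$, $=0$ outside $B^a_{4/3}$; $\phi_0:=\chi_0$, $\phi_j(\xi):=\chi_0(2^{-ja}\xi)-\chi_0(2^{-(j-1)a}\xi)$ ($j\ge1$); $\check\phi_j:=\mathcal F^{-1}\phi_j$, $\mathcal R_jf:=\check\phi_j*f$; for $\beta\notin\mathbb N_0$, $\|f\|_{\mathbf C^\beta_a(\rho_\kappa)}:=\sup_{j\ge0}2^{j\beta}\|\rho_\kappa\mathcal R_jf\|_{L^\infty}$. Condition (A): $\mu$ is a signed Radon measure on $\mathbb R^{2d}=\{\zeta=(\xi,\eta)\}$, symmetric in the sense $\mu(d\xi,d\eta)=\mu(-d\xi,d\eta)=\mu(d\xi,-d\eta)$,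 with $\int(1+|\zeta|_a)^\ell|\mu|(d\zeta)<\infty$ ($|\mu|$ the total variation), and such that $\langle f,g\rangle_{\mathbb H}:=\int\hat f(\zeta)\overline{\hat g(\zeta)}\mu(d\zeta)$ is positive semidefinite on Schwartz functions; $\mathbb H$ is the completion of real Schwartz functions under it. A Gaussian noise with spectral measure $\mu$ is a continuous linear map $U:\mathbb H\to L^2(\Omega,\mathbf P)$ such that each $U(f)$ is a centered real Gaussian variable and $\mathbf E(U(f)U(g))=\langle f,g\rangle_{\mathbb H}$. For $\varphi\in\mathbb H$, $\tau_z\varphi:=\varphi(\cdot-z)$, and $z\mapsto U(\tau_z\varphi)$ is taken in its smooth version. *)

(* Defs.v *)
From HB Require Import structures.
From mathcomp Require Import all_boot all_order all_algebra.
From mathcomp Require Import all_classical all_reals all_analysis.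
Set Implicit Arguments. Unset Strict Implicit. Unset Printing Implicit Defensive.
Import Order.TTheory GRing.Theory Num.Theory.
Import numFieldNormedType.Exports.
Local Open Scope classical_set_scope.
Local Open Scope ring_scope.

Section Defs.
Variable R : realType.

Definition enorm (d : nat) (x : 'rV[R]_d) : R := Num.sqrt (\sum_i x ord0 i ^+ 2).
Definition edot (d : nat) (x y : 'rV[R]_d) : R := \sum_i x ord0 i * y ord0 i.
Definition row_of_tuple (d : nat) (t : d.-tuple R) : 'rV[R]_d := \row_i tnth t i.

Definition pdot (d : nat) (z w : 'rV[R]_d * 'rV[R]_d) : R :=
  edot z.1 w.1 + edot z.2 w.2.

Definition anorm (d : nat) (z : 'rV[R]_d * 'rV[R]_d) : R :=
  (enorm z.1) `^ (3^-1) + enorm z.2.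
Definition tup2 (d : nat) (zt : d.-tuple R * d.-tuple R) : 'rV[R]_d * 'rV[R]_d :=
  (row_of_tuple zt.1, row_of_tuple zt.2).

Definition rho (d : nat) (kappa : R) (z : 'rV[R]_d * 'rV[R]_d) : R :=
  ((1 + enorm z.1 ^+ 2) `^ (3^-1) + 1 + enorm z.2 ^+ 2) `^ (- (kappa / 2)).

(* anisotropic dilation  2^{sa} xi = (2^{3s} xi_1, 2^s xi_2), here with t = 2^s *)
Definition adil (d : nat) (t : R) (xi : 'rV[R]_d * 'rV[R]_d) : 'rV[R]_d * 'rV[R]_d :=
  (t ^+ 3 *: xi.1, t *: xi.2).

Fixpoint iter_deriv (d : nat) (vs : seq ('rV[R]_d * 'rV[R]_d))
    (f : 'rV[R]_d * 'rV[R]_d -> R) : 'rV[R]_d * 'rV[R]_d -> R :=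
  match vs with
  | [::] => f
  | v :: vs' => fun z => derive (iter_deriv vs' f) z v
  end.

Definition smooth (d : nat) (f : 'rV[R]_d * 'rV[R]_d -> R) : Prop :=
  forall vs z, differentiable (iter_deriv vs f) z.

Definition schwartz (d : nat) (f : 'rV[R]_d * 'rV[R]_d -> R) : Prop :=
  smooth f /\
  forall (vs : seq ('rV[R]_d * 'rV[R]_d)) (k : nat), exists C : R,
    forall z, (1 + `|z|) ^+ k * `|iter_deriv vs f z| <= C.

(* Lebesgue integral on R^n as an iterated integral (coordinates 0..n-1); *)
(* by Fubini it agrees with the Lebesgue integral for integrable f.     *)
Fixpoint iint (n : nat) (f : (nat -> R) -> R) : R :=
  match n with
  | 0 => f (fun _ => 0)
  | m.+1 => Rintegral lebesgue_measure setT
      (fun t : R => iint m (fun y => f (fun k => if k is k'.+1 then y k' else t)))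
  end.

Definition int2d (d : nat) (f : 'rV[R]_d * 'rV[R]_d -> R) : R :=
  iint (d + d) (fun y => f (\row_(i < d) y i, \row_(i < d) y (d + i)%N)).

(* Fourier transform  f^(zeta) = \int f(z) e^{-i z.zeta} dz
   = fourC f zeta - i fourS f zeta *)
Definition fourC (d : nat) (f : 'rV[R]_d * 'rV[R]_d -> R) zeta : R :=
  int2d (fun z => f z * cos (pdot z zeta)).
Definition fourS (d : nat) (f : 'rV[R]_d * 'rV[R]_d -> R) zeta : R :=
  int2d (fun z => f z * sin (pdot z zeta)).

(* real part of the inverse Fourier transform
   F^{-1} g (z) = (2 pi)^{-2d} \int g(zeta) e^{i z.zeta} dzeta *)
Definition ifourRe (d : nat) (g : 'rV[R]_d * 'rV[R]_d -> R) z : R :=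
  ((2 * pi) ^+ (d + d))^-1 * int2d (fun zeta => g zeta * cos (pdot z zeta)).

Definition lp_phi (d : nat) (chi0 : 'rV[R]_d * 'rV[R]_d -> R) (j : nat) xi : R :=
  if j is j'.+1 then chi0 (adil ((2 ^-1) ^+ j) xi) - chi0 (adil ((2 ^-1) ^+ j') xi)
  else chi0 xi.
Definition lp_check (d : nat) (chi0 : 'rV[R]_d * 'rV[R]_d -> R) (j : nat) :=
  ifourRe (lp_phi chi0 j).

Definition transl (d : nat) (z : 'rV[R]_d * 'rV[R]_d) (f : 'rV[R]_d * 'rV[R]_d -> R) :=
  fun w => f (w - z).

(* The signed Radon measure mu on R^{2d} = {(xi,eta)} is given by its   *)
(* Jordan decomposition mu = mup - mum (mutually singular).            *)
Definition refl1 (d : nat) (zt : d.-tuple R * d.-tuple R) : d.-tuple R * d.-tuple R :=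
  (map_tuple (fun x => - x) zt.1, zt.2).
Definition refl2 (d : nat) (zt : d.-tuple R * d.-tuple R) : d.-tuple R * d.-tuple R :=
  (zt.1, map_tuple (fun x => - x) zt.2).

Definition mu_integral (d : nat)
    (mup mum : {measure set (d.-tuple R * d.-tuple R)%type -> \bar R})
    (F : 'rV[R]_d * 'rV[R]_d -> R) : R :=
  fine (\int[mup]_zt (F (tup2 zt))%:E)%E - fine (\int[mum]_zt (F (tup2 zt))%:E)%E.

(* <f,g>_H = Re \int f^ conj(g^) dmu  (the imaginary part vanishes by symmetry) *)
Definition hinner (d : nat) (mup mum : {measure set (d.-tuple R * d.-tuple R)%type -> \bar R})
    (f g : 'rV[R]_d * 'rV[R]_d -> R) : R :=
  mu_integral mup mum (fun zeta => fourC f zeta * fourC g zeta + fourS f zeta * fourS g zeta).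

Definition condA (d : nat) (ell : R)
    (mup mum : {measure set (d.-tuple R * d.-tuple R)%type -> \bar R}) : Prop :=
  (exists A, measurable A /\ mup (~` A) = 0%E /\ mum A = 0%E) /\
  (forall B, measurable B -> (mup B < +oo)%E -> (mum B < +oo)%E ->
     (mup (@refl1 d @^-1` B) - mum (@refl1 d @^-1` B) = mup B - mum B)%E /\
     (mup (@refl2 d @^-1` B) - mum (@refl2 d @^-1` B) = mup B - mum B)%E) /\
  (\int[mup]_zt ((1 + anorm (tup2 zt)) `^ ell)%:E < +oo)%E /\
  (\int[mum]_zt ((1 + anorm (tup2 zt)) `^ ell)%:E < +oo)%E /\
  (forall f, schwartz f -> 0 <= hinner mup mum f f).

Definition centered_gaussian dT (T : measurableType dT) (P : probability T R)
    (X : T -> R) (s2 : R) : Prop :=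
  measurable_fun setT X /\
  forall B : set R, measurable B ->
    P (X @^-1` B) = if s2 == 0 then \d_(0 : R) B else normal_prob 0 (Num.sqrt s2) B.

Definition gaussian_noise (d : nat) dT (T : measurableType dT) (P : probability T R)
    (mup mum : {measure set (d.-tuple R * d.-tuple R)%type -> \bar R})
    (U : ('rV[R]_d * 'rV[R]_d -> R) -> T -> R) : Prop :=
  (forall f g (a b : R), schwartz f -> schwartz g ->
     {ae P, forall w, U (fun z => a * f z + b * g z) w = a * U f w + b * U g w}) /\
  (forall f, schwartz f -> centered_gaussian P (U f) (hinner mup mum f f)) /\
  (forall f g, schwartz f -> schwartz g ->
     (expectation P (fun w => U f w * U g w) = (hinner mup mum f g)%:E)).

(* ||.||_{C^beta_a(rho_kappa)} of the random distribution with blocks Y j z = R_j U (z) *)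
Definition besov_norm (d : nat) (beta kappa : R)
    (Yj : nat -> 'rV[R]_d * 'rV[R]_d -> R) : \bar R :=
  ereal_sup [set (2 `^ (j%:R * beta) * (rho kappa z * `|Yj j z|))%:E | j in [set: nat] & z in [set: 'rV[R]_d * 'rV[R]_d]].

End Defs.

(* Main.v *)
(* Everything rests on Gaussianity: the moment of order q of a block increment is controlled
   by its variance, so q may be taken much larger than p, and then all polynomial losses in
   the chaining below are absorbed, for every kappa > 0 and beta < ell/2.

   Variances.  hinner(g, g) is at most the integral of the squared modulus of the Fourier
   transform of g against the positive part of mu.  Fourier inversion is not needed: it is
   enough that the transform of the block f_j = lp_check chi0 j is bounded uniformly in j
   (by scaling) and vanishes off the shell |zeta|_a ~ 2^j, where (1 + |zeta|_a)^ell ~ 2^(j ell).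
   At zeta0 this transform is the integral of a transform F(g) with g a translate of lp_phi by
   +zeta0 or -zeta0; if g vanishes near 0 it is a combination sum_k zeta_k h_k, so F(g) is a
   sum of derivatives of Schwartz functions and its integral is 0.

   Sup norm.  Chaining over the grids of mesh 8^-j 4^-n: the factor 8^-j makes the Lipschitz
   constant of the j-th block of the order of its standard deviation, and the weight decays
   like a power of the grid index, which makes the sum over all increments converge. *)
Require Import Defs.
From HB Require Import structures.
From mathcomp Require Import all_boot all_order all_algebra.
From mathcomp Require Import all_classical all_reals all_analysis.
From mathcomp Require Import measurable_realfun.
From mathcomp Require Import ring lra zify.
Set Implicit Arguments. Unset Strict Implicit. Unset Printing Implicit Defensive.
Import Order.TTheory GRing.Theory Num.Theory.
Import numFieldNormedType.Exports.
Import HBNNSimple.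
Local Open Scope classical_set_scope.
Local Open Scope ring_scope.

(** * One-dimensional integrals dominated by 1/(1+t^2) *)

(** [int2d] is an iterated one-dimensional integral, so its calculus is built by hand. The class
    [tame] (decay like a product of 1/(1+t^2) and a weighted Lipschitz bound in each coordinate) is
    stable under slicing; it gives linearity, an explicit bound and affine changes of variables.
    Translation invariance then kills integrals of derivatives, and every integration by parts rests
    on that. Neither the spectral density nor the Besov norm is shown to be measurable; integrals
    are only compared with measurable majorants, the last one being [chain_total]. [U] is linear
    only almost surely, for each fixed combination. The increments are therefore identified with
    those of [Y] on countable grids, and continuity of [Y] reaches the other points. The exponent is
    q = 2m. With M = 2d + 2 (2d for counting grid points, 2 for summability), passing from 1 + s r
    to s (1 + r) on the grid of mesh s = 8^-j 4^-n loses s^-M. The conditions 3 M + 1 <= q (ell/2 -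
    beta) and M < m pay for it, and M <= q kappa/3 supplies the decay in the index radius r. *)

Section OneDim.
Variable R : realType.
Implicit Types (t c a C : R) (J : R -> R).
Local Notation mu := (@lebesgue_measure R).
Local Notation w := (fun t : R => (1 + t ^+ 2)^-1).

Lemma weight_gt0 t : 0 < w t.
Proof. by rewrite invr_gt0 ltr_pwDl// sqr_ge0. Qed.

Lemma weight_le1 t : w t <= 1.
Proof. by rewrite invf_le1 ?lerDl ?sqr_ge0// ltr_pwDl// sqr_ge0. Qed.

Lemma continuous_weight : continuous w.
Proof. exact: continuous_oneDsqrV. Qed.

Lemma integrable_weight : mu.-integrable setT (EFin \o w).
Proof.
apply/integrableP; split.
  by apply/measurable_EFinP; apply: continuous_measurable_fun; exact: continuous_weight.
under eq_integral do rewrite /= ger0_norm ?(ltW (weight_gt0 _))//.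
rewrite ge0_symfun_integralT; last 3 first.
- by move=> x; rewrite ltW ?weight_gt0.
- exact: continuous_weight.
- by move=> x /=; rewrite sqrrN.
rewrite -set_itvcy integral0y_oneDsqr.
by rewrite -EFinM ltry.
Qed.

(** Continuity gives measurability and the bound gives integrability; the explicit constant is what
    the induction over coordinates propagates. *)
Definition dominated J C := continuous J /\ forall t, `|J t| <= C * w t.

Lemma dominated_integrable J C : dominated J C -> mu.-integrable setT (EFin \o J).
Proof.
move=> [cJ bJ]; apply: (@le_integrable _ (measurableTypeR R) R mu setT measurableT (EFin \o J) (EFin \o (fun t : R => C * w t))).
- by apply/measurable_EFinP; exact: continuous_measurable_fun.
- move=> x _ /=; rewrite lee_fin (le_trans (bJ x))//; exact: ler_norm.
- by rewrite (_ : _ \o _ = (fun x => C%:E * (w x)%:E)%E)//; apply: integrableZl => //; exact: integrable_weight.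
Qed.

Definition weight_mass := Rintegral mu setT w.

Lemma weight_mass_ge0 : 0 <= weight_mass.
Proof. by apply: Rintegral_ge0 => x _; rewrite ltW ?weight_gt0. Qed.

Lemma dominated_bound J C : dominated J C ->
  `|Rintegral mu setT J| <= C * weight_mass.
Proof.
move=> dJ; have iJ := dominated_integrable dJ.
apply: (le_trans (le_normr_Rintegral _ iJ)) => //.
rewrite /weight_mass -RintegralZl//; last exact: integrable_weight.
apply: le_Rintegral => //.
- by move/integrable_norm: iJ.
- rewrite (_ : _ \o _ = (fun x => C%:E * (w x)%:E)%E)//; apply: integrableZl => //; exact: integrable_weight.
- by move=> x _; exact: (dJ.2 x).
Qed.

Lemma ge0_Rintegral_affine (G : R -> R) c a : 0 < c -> continuous G ->
  (forall x, 0 <= G x) ->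
  Rintegral mu setT G = c * Rintegral mu setT (fun t => G (c * t + a)).
Proof.
move=> c0 cG G0.
pose F t := c * t + a.
have dF (x : R) : is_derive x 1 F c.
  rewrite /F; apply: is_derive_eq.
  by rewrite addr0 /GRing.scale /= mulr1.
have F1 : (F^`())%classic = cst c.
  by apply/funext => x; rewrite derive1E; apply: derive_val.
rewrite /Rintegral (@increasing_ge0_integration_by_substitutionT _ F G)//.
- rewrite (_ : (fun x => (((G \o F) * (F^`())%classic) x)%:E) = (fun x => c%:E * (G (F x))%:E)%E); last first.
    by apply/funext => x; rewrite F1 /= -EFinM mulrC.
  rewrite ge0_integralZl//.
  + have : (0 <= \int[mu]_x (G (c * x + a))%:E)%E by apply: integral_ge0 => x _; rewrite lee_fin.
    (* The integral may be infinite here: [fine] sends infinity to 0, and both sides are then 0. *)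
    rewrite /F; case: (integral _ _ _) => [r| |]//= _.
    by rewrite gt0_muley ?lte_fin// mulr0.
  + apply/measurable_EFinP; apply: continuous_measurable_fun.
    move=> x; apply: continuous_comp; last exact: cG.
    by apply: cvgD; [apply: cvgM; [exact: cvg_cst|exact: cvg_id]|exact: cvg_cst].
  + by move=> x _; rewrite lee_fin.
  + by rewrite lee_fin ltW.
- by move=> x y xy; rewrite /F ltrD2r ltr_pM2l.
- by rewrite F1; exact: cst_continuous.
- by rewrite F1; exact: is_cvg_cst.
- by rewrite F1; exact: is_cvg_cst.
- rewrite /F; apply/cvgrNyPle => A; near=> x.
  rewrite -lerBrDr mulrC -ler_pdivlMr//; near: x; exact: nbhs_ninfty_le.
- rewrite /F; apply/cvgryPge => A; near=> x.
  rewrite -lerBlDr mulrC -ler_pdivrMr//; near: x; exact: nbhs_pinfty_ge.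
Unshelve. all: end_near. Qed.

(** Put s = c t + a, so that t^2 = (s - a)^2 / c^2, and use (s - a)^2 <= 2 (1 + s^2) (1 + a^2). *)
Lemma weight_affine c a t : 0 < c ->
  w (c * t + a) <= (1 + 2 * (1 + a ^+ 2) / c ^+ 2) * w t.
Proof.
move=> c0; have h s : 0 < 1 + s ^+ 2 :> R by rewrite ltr_pwDl// sqr_ge0.
rewrite -(ler_pM2l (h (c * t + a))) divff ?gt_eqF// mulrA ler_pdivlMr// mul1r.
set s := c * t + a.
have -> : t = (s - a) / c by rewrite /s addrK mulrC mulKf// gt_eqF.
rewrite expr_div_n.
have k0 : 0 < (c ^+ 2)^-1 by rewrite invr_gt0 exprn_gt0.
have s0 := sqr_ge0 s; have a0 := sqr_ge0 a; have b0 := sqr_ge0 (s + a).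
have -> : (1 + s ^+ 2) * (1 + 2 * (1 + a ^+ 2) / c ^+ 2) =
   1 + s ^+ 2 + (2 * (1 + s ^+ 2) * (1 + a ^+ 2)) / c ^+ 2 by ring.
rewrite lerD//; first by rewrite lerDl.
rewrite ler_pM2r//; nra.
Qed.

Lemma dominated_affine J C c a : 0 < c -> dominated J C ->
  dominated (fun t => J (c * t + a)) (C * (1 + 2 * (1 + a ^+ 2) / c ^+ 2)).
Proof.
move=> c0 [cJ bJ]; split.
  move=> x; apply: continuous_comp; last exact: cJ.
  by apply: cvgD; [apply: cvgM; [exact: cvg_cst|exact: cvg_id]|exact: cvg_cst].
have C0 : 0 <= C.
  by have := le_trans (normr_ge0 _) (bJ 0); rewrite pmulr_lge0// weight_gt0.
by move=> t; rewrite (le_trans (bJ _))// -mulrA ler_wpM2l// weight_affine.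
Qed.

Lemma dominated_weight : dominated w 1.
Proof.
split; first exact: continuous_weight.
by move=> t; rewrite mul1r ger0_norm// ltW ?weight_gt0.
Qed.

Lemma dominatedD J1 J2 C1 C2 : dominated J1 C1 -> dominated J2 C2 ->
  dominated (fun t => J1 t + J2 t) (C1 + C2).
Proof.
move=> [c1 b1] [c2 b2]; split.
  by move=> t; apply: cvgD; [exact: c1|exact: c2].
by move=> t; rewrite (le_trans (ler_normD _ _))// mulrDl lerD.
Qed.

Lemma dominatedZ J C k : dominated J C -> dominated (fun t => k * J t) (`|k| * C).
Proof.
move=> [c1 b1]; split; first by move=> t; apply: cvgM; [exact: cvg_cst|exact: c1].
by move=> t; rewrite normrM -mulrA ler_wpM2l.
Qed.

(** The substitution rule for nonnegative integrands is applied to J + C w and to C w, and the two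
    identities are subtracted. *)
Lemma Rintegral_affine J C c a : 0 < c -> dominated J C ->
  Rintegral mu setT J = c * Rintegral mu setT (fun t => J (c * t + a)).
Proof.
move=> c0 dJ; pose G t := J t + C * w t.
have dC : dominated (fun t => C * w t) (`|C| * 1) by apply: dominatedZ; exact: dominated_weight.
have C0 : 0 <= C.
  by have := le_trans (normr_ge0 _) (dJ.2 0); rewrite pmulr_lge0// weight_gt0.
have G0 x : 0 <= G x.
  by rewrite -lerBlDr sub0r (le_trans _ (lerNnormlW (dJ.2 x))) //.
have cG : continuous G := (dominatedD dJ dC).1.
have CW0 x : 0 <= C * w x by rewrite mulr_ge0// ltW ?weight_gt0.
have EG : Rintegral mu setT G =
    Rintegral mu setT J + Rintegral mu setT (fun t => C * w t).
  rewrite /G RintegralD//; [exact: dominated_integrable dJ|exact: dominated_integrable dC].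
have EA : Rintegral mu setT (fun t => G (c * t + a)) =
    Rintegral mu setT (fun t => J (c * t + a)) +
    Rintegral mu setT (fun t => C * w (c * t + a)).
  rewrite /G RintegralD//.
    exact: (dominated_integrable (dominated_affine a c0 dJ)).
  exact: (dominated_integrable (dominated_affine a c0 dC)).
have := ge0_Rintegral_affine a c0 cG G0.
rewrite EG EA mulrDr (ge0_Rintegral_affine a c0 dC.1 CW0).
by move/addIr.
Qed.

End OneDim.

(** * Iterated integrals *)

Section Iterated.
Variable R : realType.
Implicit Types (n : nat) (t C : R) (y : nat -> R) (F G : (nat -> R) -> R).
Local Notation mu := (@lebesgue_measure R).
Local Notation w := (fun t : R => (1 + t ^+ 2)^-1).
Local Notation B := (weight_mass R).

Definition consn t y : nat -> R := fun k => if k is k'.+1 then y k' else t.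
Definition decay n C F := forall y, `|F y| <= C * \prod_(k < n) w (y k).
(** The product skips [i], the only coordinate where [y] and [y'] may differ. For the outermost
    coordinate this is exactly decay of a difference of two slices. *)
Definition wlip n C F := forall (i : 'I_n) y y', (forall m, m != i :> nat -> y m = y' m) ->
  `|F y - F y'| <= C * `|y i - y' i| * \prod_(k < n | k != i) w (y k).
Definition depends n F := forall y y', (forall m, (m < n)%N -> y m = y' m) -> F y = F y'.
(** The invariant for iterated integration: [decay] makes a slice integral integrable in the outer
    variable, [wlip] makes it Lipschitz, hence continuous. [depends] matters because an affine
    substitution also moves the default 0 that [iint] gives to coordinates beyond [n]. *)
Definition tame n F := depends n F /\ exists C, decay n C F /\ wlip n C F.

Lemma lipschitz_continuous (J : R -> R) (K : R) :
  (forall x y : R, `|J x - J y| <= K * `|x - y|) -> continuous J.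
Proof.
move=> L x; apply/cvgrPdist_le => e e0.
have K0 : 0 < `|K| + 1 by rewrite ltr_pwDr.
near=> y; rewrite (le_trans (L _ _))//.
rewrite (@le_trans _ _ ((`|K| + 1) * `|x - y|))//.
  by rewrite ler_wpM2r// (le_trans (ler_norm _))// lerDl.
rewrite -ler_pdivlMl//; near: y.
by apply: cvgr_dist_le; [exact: cvg_id|rewrite mulr_gt0// invr_gt0].
Unshelve. all: end_near. Qed.

Lemma prod_weight_ge0 n (P : pred 'I_n) y : 0 <= \prod_(k < n | P k) w (y k).
Proof. by apply: prodr_ge0 => k _; rewrite ltW ?weight_gt0. Qed.


Lemma decay_ge0 n C F : decay n C F -> 0 <= C.
Proof.
move=> /(_ (fun=> 0)); rewrite big1; last by move=> *; rewrite expr0n addr0 invr1.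
by rewrite mulr1; apply: le_trans.
Qed.

Lemma prod_weight_consn n t y :
  \prod_(k < n.+1) w (consn t y k) = w t * \prod_(k < n) w (y k).
Proof. by rewrite big_ord_recl. Qed.

Lemma decay_consn n C F t : decay n.+1 C F -> decay n (C * w t) (fun y => F (consn t y)).
Proof. by move=> dF y; rewrite (le_trans (dF _))// prod_weight_consn mulrA. Qed.

Lemma decay_consnB n C F t t' : wlip n.+1 C F ->
  decay n (C * `|t - t'|) (fun y => F (consn t y) - F (consn t' y)).
Proof.
move=> lF y; apply: (le_trans (lF ord0 (consn t y) (consn t' y) _)); first by case.
by rewrite /= big_mkcond big_ord_recl /= mul1r.
Qed.

Lemma tame_consn n F t : tame n.+1 F -> tame n (fun y => F (consn t y)).
Proof.
move=> [eF [C [dF lF]]]; have C0 := decay_ge0 dF; split.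
  by move=> y y' yy'; apply: eF => -[|m]//=; exact: yy'.
exists C; split.
  move=> y; rewrite (le_trans (decay_consn t dF y))// ler_wpM2r ?prod_weight_ge0//.
  by rewrite -[leRHS]mulr1 ler_wpM2l// weight_le1.
move=> i y y' yy'; apply: (le_trans (lF (lift ord0 i) (consn t y) (consn t y') _)).
  by case=> //= m; rewrite eqSS => /yy'.
rewrite /= ler_wpM2l ?mulr_ge0//.
rewrite big_mkcond big_ord_recl /=.
rewrite [leRHS](_ : _ = 1 * \prod_(k < n | k != i) w (y k)); last by rewrite mul1r.
rewrite ler_pM//.
- by rewrite ltW ?weight_gt0.
- apply: prodr_ge0 => k _; case: ifP => // _; by rewrite ltW ?weight_gt0.
- exact: weight_le1.
- by rewrite [leRHS]big_mkcond/=; rewrite le_eqVlt; apply/orP; left; apply/eqP; apply: eq_bigr => k _; rewrite (inj_eq lift_inj).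
Qed.

Lemma tame_lin n F G (a b : R) : tame n F -> tame n G -> tame n (fun y => a * F y + b * G y).
Proof.
move=> [eF [C [dF lF]]] [eG [D [dG lG]]]; split.
  by move=> y y' yy'; rewrite (eF _ _ yy') (eG _ _ yy').
exists (`|a| * C + `|b| * D); split.
  move=> y; rewrite (le_trans (ler_normD _ _))// mulrDl !normrM -!mulrA.
  by rewrite lerD// ler_wpM2l.
move=> i y y' yy'.
have -> : a * F y + b * G y - (a * F y' + b * G y') =
  a * (F y - F y') + b * (G y - G y') by ring.
rewrite (le_trans (ler_normD _ _))// mulrDl mulrDl !normrM -!mulrA.
by rewrite lerD// ler_wpM2l// mulrA; [exact: lF|exact: lG].
Qed.

(** The two claims need a joint induction: linearity in dimension [n.+1] requires slice integrals to
    be continuous, and that follows by writing their difference as one integral (linearity in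
    dimension [n]) and bounding it. *)
Lemma iint_bound_lin n :
  (forall F C, tame n F -> decay n C F -> `|iint n F| <= C * B ^+ n) /\
  (forall F G a b, tame n F -> tame n G ->
     iint n (fun y => a * F y + b * G y) = a * iint n F + b * iint n G).
Proof.
elim: n => [|n [IHb IHl]].
  split=> //= F C _ /(_ (fun=> 0)); by rewrite big_ord0.
have dom F C : tame n.+1 F -> decay n.+1 C F ->
    dominated (fun t => iint n (fun y => F (consn t y))) (C * B ^+ n).
  move=> tF dF; split; last first.
    move=> t; rewrite mulrAC; apply: IHb; first exact: tame_consn.
    exact: decay_consn.
  have [_ [K [_ lF]]] := tF.
  apply: (@lipschitz_continuous _ (K * B ^+ n)) => t t'.
  have := IHl _ _ 1 (-1) (tame_consn t tF) (tame_consn t' tF).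
  rewrite mul1r mulN1r => <-.
  rewrite mulrAC; apply: IHb; first by apply: tame_lin; exact: tame_consn.
  move=> y; rewrite mul1r mulN1r; exact: (decay_consnB t t' lF).
split=> [F C tF dF|F G a b tF tG].
  rewrite exprSr mulrA; exact: (dominated_bound (dom _ _ tF dF)).
have [_ [C [dF _]]] := tF; have [_ [D [dG _]]] := tG.
have iF := dominated_integrable (dominatedZ a (dom _ _ tF dF)).
have iG := dominated_integrable (dominatedZ b (dom _ _ tG dG)).
rewrite /= -RintegralZl//; last exact: (dominated_integrable (dom _ _ tF dF)).
rewrite -RintegralZl//; last exact: (dominated_integrable (dom _ _ tG dG)).
rewrite -RintegralD//.
apply: eq_Rintegral => t _ /=.
exact: (IHl _ _ a b (tame_consn t tF) (tame_consn t tG)).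
Qed.

Lemma iint_bound n F C : tame n F -> decay n C F -> `|iint n F| <= C * B ^+ n.
Proof. by move: F C; have [] := iint_bound_lin n. Qed.

Lemma iint_lin n F G a b : tame n F -> tame n G ->
  iint n (fun y => a * F y + b * G y) = a * iint n F + b * iint n G.
Proof. by move: F G a b; have [] := iint_bound_lin n. Qed.

Lemma iint_dominated n F C : tame n.+1 F -> decay n.+1 C F ->
  dominated (fun t => iint n (fun y => F (consn t y))) (C * B ^+ n).
Proof.
move=> tF dF; split; last first.
  move=> t; rewrite mulrAC; apply: iint_bound; first exact: tame_consn.
  exact: decay_consn.
have [_ [K [_ lF]]] := tF.
apply: (@lipschitz_continuous _ (K * B ^+ n)) => t t'.
have := iint_lin 1 (-1) (tame_consn t tF) (tame_consn t' tF).
rewrite mul1r mulN1r => <-.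
rewrite mulrAC; apply: iint_bound; first by apply: tame_lin; exact: tame_consn.
move=> y; rewrite mul1r mulN1r; exact: (decay_consnB t t' lF).
Qed.

Lemma iint_affine n F (c a : nat -> R) : (forall k, 0 < c k) -> tame n F ->
  iint n F = (\prod_(k < n) c k) * iint n (fun y => F (fun k => c k * y k + a k)).
Proof.
elim: n F c a => [|n IH] F c a c0 tF.
  rewrite big_ord0 mul1r /=; by apply: tF.1.
have [_ [C [dF _]]] := tF.
rewrite /= (Rintegral_affine (a 0) (c0 0) (iint_dominated tF dF)).
rewrite big_ord_recl -mulrA; congr (_ * _).
set K := \prod_(_ < _) _.
pose H t := iint n (fun y => F (fun k => c k * consn t y k + a k)).
have E t : iint n (fun y => F (consn (c 0 * t + a 0) y)) = K * H t.
  rewrite (IH _ (fun k => c k.+1) (fun k => a k.+1)) => [|k|]; last exact: tame_consn.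
    congr (_ * iint _ _); apply/funext => y; congr F.
    by apply/funext => -[|k].
  exact: c0.
have K0 : 0 < K by apply: prodr_gt0 => i _; exact: c0.
(* Extracting [K] from the integral requires [H] to be integrable; it is recognised as a multiple of
   an affine reparametrisation of a dominated function. *)
have dH := dominatedZ K^-1 (dominated_affine (a 0) (c0 0) (iint_dominated tF dF)).
have EH : H = fun t => K^-1 * iint n (fun y => F (consn (c 0 * t + a 0) y)).
  by apply/funext => t; rewrite E mulKf// gt_eqF.
transitivity (K * Rintegral mu setT H); last by [].
rewrite -RintegralZl//; last by have := dominated_integrable dH; rewrite -EH.
by apply: eq_Rintegral => t _; rewrite E.
Qed.

End Iterated.

(** * Coordinates and differentiation on phase space *)

Section Phase.
Variables (R : realType) (d : nat).
Local Notation V := ('rV[R]_d * 'rV[R]_d)%type.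
Implicit Types (z u v : V) (y : nat -> R).

Lemma edotDl (a b c : 'rV[R]_d) : edot (a + b) c = edot a c + edot b c.
Proof. by rewrite /edot -big_split; apply: eq_bigr => i _; rewrite mxE mulrDl. Qed.

Lemma pdotDl u v z : pdot (u + v) z = pdot u z + pdot v z.
Proof. by rewrite /pdot /= !edotDl addrACA. Qed.

Lemma pdotZl (a : R) v z : pdot (a *: v) z = a * pdot v z.
Proof.
rewrite /pdot /edot mulrDr !mulr_sumr /=; congr (_ + _); apply: eq_bigr => i _;
by rewrite mxE mulrA.
Qed.

Lemma pdotC u v : pdot u v = pdot v u.
Proof. by rewrite /pdot /edot; congr (_ + _); apply: eq_bigr => i _; rewrite mulrC. Qed.

Lemma pdotDr z u v : pdot z (u + v) = pdot z u + pdot z v.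
Proof. by rewrite pdotC pdotDl !(pdotC z). Qed.

Lemma pdotZr (a : R) v z : pdot z (a *: v) = a * pdot z v.
Proof. by rewrite pdotC pdotZl (pdotC z). Qed.

Lemma pdotNl u z : pdot (- u) z = - pdot u z.
Proof. by rewrite -scaleN1r pdotZl mulN1r. Qed.

Lemma pdotBl u v z : pdot (u - v) z = pdot u z - pdot v z.
Proof. by rewrite pdotDl pdotNl. Qed.

Lemma pdotBr z u v : pdot z (u - v) = pdot z u - pdot z v.
Proof. by rewrite !(pdotC z) pdotBl. Qed.

Lemma pdot0r z : pdot z 0 = 0.
Proof. by rewrite -(scale0r z) pdotZr mul0r. Qed.

Definition vec y : V := (\row_(i < d) y i, \row_(i < d) y (d + i)%N).

Lemma eq_vec y y' : (forall k, (k < d + d)%N -> y k = y' k) -> vec y = vec y'.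
Proof.
move=> e; congr (_, _); apply/rowP => i; rewrite !mxE e//.
  by rewrite (leq_trans (ltn_ord i))// leq_addr.
by rewrite ltn_add2l.
Qed.

Lemma vecD y y' : vec (fun k => y k + y' k) = vec y + vec y'.
Proof. by congr (_, _); apply/rowP => i; rewrite !mxE. Qed.

Lemma vecZ (a : R) y : vec (fun k => a * y k) = a *: vec y.
Proof. by congr (_, _); apply/rowP => i; rewrite !mxE. Qed.

Lemma pdot_vec y y' : pdot (vec y) (vec y') = \sum_(k < d + d) y k * y' k.
Proof.
rewrite big_split_ord /pdot /edot /=; congr (_ + _); apply: eq_bigr => i _;
by rewrite !mxE.
Qed.

Lemma vecP z : exists y, z = vec y.
Proof.
exists (fun k => oapp (fun i => z.1 ord0 i) (oapp (fun i => z.2 ord0 i) 0 (insub (k - d)%N)) (insub k)).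
case: z => z1 z2; congr (_, _); apply/rowP => i; rewrite !mxE /=.
  by rewrite valK.
by rewrite addKn valK insubF//= ltnNge leq_addr.
Qed.

Definition basis (k : nat) : V := vec (fun m => (m == k)%:R).
Definition crd z (k : nat) : R := pdot z (basis k).

Lemma crd_vec y k : (k < d + d)%N -> crd (vec y) k = y k.
Proof.
move=> kd; rewrite /crd pdot_vec (bigD1 (Ordinal kd))//= eqxx mulr1 big1 ?addr0//.
by move=> i; rewrite -val_eqE /= => /negbTE ->; rewrite mulr0.
Qed.

Lemma vec_crd z : vec (crd z) = z.
Proof. by have [y ->] := vecP z; apply: eq_vec => k kd; rewrite crd_vec. Qed.

Lemma pdot_crd z v : pdot z v = \sum_(k < d + d) crd z k * crd v k.
Proof. by rewrite -{1}(vec_crd z) -{1}(vec_crd v) pdot_vec. Qed.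

Lemma crd_le z k : (k < d + d)%N -> `|crd z k| <= `|z|.
Proof.
have [y ->] := vecP z => kd; rewrite crd_vec//.
have rowle (x : 'rV[R]_d) i : `|x ord0 i| <= `|x|.
  by rewrite [leRHS]/Num.norm /= mx_normrE (le_bigmax _ (fun ij => `|x ij.1 ij.2|) (ord0, i)).
rewrite prod_normE le_max; case: (ltnP k d) => h.
  by have := rowle (\row_(i < d) y i) (Ordinal h); rewrite mxE /= => ->.
have h2 : (k - d < d)%N by rewrite ltn_subLR.
by have := rowle (\row_(i < d) y (d + i)%N) (Ordinal h2); rewrite mxE /= subnKC// => ->; rewrite orbT.
Qed.

Lemma norm_le_crd z (M : R) : 0 <= M ->
  (forall k, (k < d + d)%N -> `|crd z k| <= M) -> `|z| <= M.
Proof.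
have [y ->] := vecP z => M0 h.
rewrite prod_normE ge_max; apply/andP; split; rewrite [leLHS]/Num.norm /= mx_normrE.
  apply/bigmax_leP; split=> // -[i j] _ /=; rewrite mxE.
  have kd : (j < d + d)%N by rewrite (leq_trans (ltn_ord j))// leq_addr.
  by have := h _ kd; rewrite crd_vec.
apply/bigmax_leP; split=> // -[i j] _ /=; rewrite mxE.
have kd : (d + j < d + d)%N by rewrite ltn_add2l.
by have := h _ kd; rewrite crd_vec.
Qed.

Lemma norm_le_sum z : `|z| <= \sum_(k < d + d) `|crd z k|.
Proof.
apply: norm_le_crd => [|k kd]; first exact: sumr_ge0.
by rewrite (bigD1 (Ordinal kd))//= lerDl sumr_ge0.
Qed.

Lemma pdot_le z v : `|pdot z v| <= (d + d)%:R * `|z| * `|v|.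
Proof.
rewrite pdot_crd (le_trans (ler_norm_sum _ _ _))//.
rewrite (@le_trans _ _ (\sum_(k < d + d) `|z| * `|v|))//.
  by apply: ler_sum => k _; rewrite normrM ler_pM// crd_le.
by rewrite sumr_const card_ord -[(_ * _) *+ _]mulr_natl mulrA.
Qed.

Lemma is_linear_pdot v : linear (fun z => pdot z v : R).
Proof. by move=> a x y; rewrite pdotDl pdotZl. Qed.

Definition pdotr v := fun z => pdot z v : R.
HB.instance Definition _ v := GRing.isLinear.Build R V R *:%R (pdotr v) (is_linear_pdot v).

Lemma continuous_pdotr v : continuous (pdotr v).
Proof.
apply: bounded_linear_continuous; apply/linear_boundedP; near=> r; move=> x.
rewrite (le_trans (pdot_le _ _))// mulrAC ler_wpM2r//.
Unshelve. all: end_near. Qed.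

(** A quadratic remainder is a little-o, and uniqueness of the differential identifies it with
    [pdotr u]. This is how transforms get differentiated under the integral sign. *)
Lemma diff_of_quadratic (f : V -> R) z u (C : R) :
  (forall h, `|h| <= 1 -> `|f (z + h) - f z - pdot h u| <= C * `|h| ^+ 2) ->
  differentiable f z /\ forall v, 'D_v f z = pdot v u.
Proof.
move=> q.
have E : f \o shift z = cst (f z) + pdotr u +o_ (0 : V) id.
  apply/eqaddoP => _/posnumP[e]; near=> h.
  have h1 : `|h| <= 1.
    by near: h; exact: (@nbhs0_le R (V : normedModType R) 1 ltr01).
  rewrite -[(_ - _) h]/(f (h + z) - (f z + pdot h u)) opprD addrA [h + z]addrC.
  rewrite (le_trans (q _ h1))// expr2 mulrA ler_wpM2r//.
  have K0 : 0 < `|C| + 1 by rewrite ltr_pwDr.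
  rewrite (@le_trans _ _ ((`|C| + 1) * `|h|))//.
    by rewrite ler_wpM2r// (le_trans (ler_norm _))// lerDl.
  by rewrite -ler_pdivlMl.
have D := diff_unique (@continuous_pdotr u) E.
have df : differentiable f z.
  by apply/diff_locallyP; rewrite D; split => //; exact: continuous_pdotr.
by split=> // v; rewrite deriveE// D.
Unshelve. all: end_near. Qed.

Lemma is_derive_line (f : V -> R) z v (t : R) : differentiable f (z + t *: v) ->
  is_derive t 1 (fun s : R => f (z + s *: v)) ('D_v f (z + t *: v)).
Proof.
move=> df.
have dl : is_diff t (fun s : R => z + s *: v) (fun s => s *: v).
  apply: is_diff_eq; apply/funext => s /=; rewrite !add0r.
  by case: (v).
have dfl : differentiable (f \o (fun s : R => z + s *: v)) t by apply: differentiable_comp.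
split; first exact: diff_derivable.
rewrite deriveE// diff_comp//= diff_val scale1r deriveE//.
Qed.

Lemma mean_value_line (f : V -> R) z v : (forall x, differentiable f x) ->
  exists2 s, 0 <= s <= 1 & f (z + v) - f z = 'D_v f (z + s *: v).
Proof.
move=> df.
have [||c c01] := @MVT_segment R (fun s => f (z + s *: v)) (fun s => 'D_v f (z + s *: v)) 0 1 ler01.
- by move=> x _; apply: is_derive_line.
- apply: continuous_subspaceT => x.
  by apply/differentiable_continuous/derivable1_diffP; have [] := is_derive_line (df (z + x *: v)).
rewrite scale1r scale0r addr0 subr0 mulr1 => E.
by exists c => //; rewrite in_itv in c01.
Qed.

Lemma deriveZv (f : V -> R) z v (a : R) : differentiable f z ->
  'D_(a *: v) f z = a * 'D_v f z.
Proof. by move=> df; rewrite !deriveE// linearZ. Qed.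

(** The mean value theorem is used twice on the segment: the remainder is s times the second
    derivative at the point z + t s v, with s and t in [0,1]. *)
Lemma taylor1 (f : V -> R) z v C : (forall x, differentiable f x) ->
  (forall x, differentiable ('D_v f) x) ->
  (forall s, 0 <= s <= 1 -> `|'D_v ('D_v f) (z + s *: v)| <= C) ->
  `|f (z + v) - f z - 'D_v f z| <= C.
Proof.
move=> df ddf b; have [s /andP[s0 s1] ->] := mean_value_line z v df.
have [t /andP[t0 t1] ->] := mean_value_line z (s *: v) ddf.
rewrite deriveZv// scalerA normrM.
have h : 0 <= t * s <= 1 by rewrite mulr_ge0//= mulr_ile1.
rewrite (le_trans _ (b _ h))// ler_piMl// ger0_norm//.
Qed.

End Phase.

(** * Smooth, Schwartz and slowly growing functions *)

Section Calculus.
Variables (R : realType) (d : nat).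
Local Notation V := ('rV[R]_d * 'rV[R]_d)%type.
Implicit Types (z u v : V) (f g m : V -> R).

(** A class of differentiable functions closed under directional derivatives suffices; no formula
    for iterated derivatives has to be written. *)
Lemma smooth_coind (S : (V -> R) -> Prop) :
  (forall f, S f -> forall z, differentiable f z) ->
  (forall f v, S f -> S ('D_v f)) -> forall f, S f -> smooth f.
Proof.
move=> Sd SD f Sf vs; suff : S (iter_deriv vs f) by exact: Sd.
by elim: vs => //= v vs IH; exact: SD.
Qed.

Lemma schwartz_coind (S : (V -> R) -> Prop) :
  (forall f, S f -> forall z, differentiable f z) ->
  (forall f v, S f -> S ('D_v f)) ->
  (forall f k, S f -> exists C : R, forall z, (1 + `|z|) ^+ k * `|f z| <= C) ->
  forall f, S f -> schwartz f.
Proof.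
move=> Sd SD Sb f Sf; split; first exact: (smooth_coind Sd SD).
move=> vs k; apply: Sb; by elim: vs => //= v vs IH; exact: SD.
Qed.

(** These are the multipliers of the Schwartz space; the growth degree may depend on the
    derivative. *)
Definition slow f := smooth f /\ forall vs, exists (k : nat) (C : R),
  forall z, `|iter_deriv vs f z| <= C * (1 + `|z|) ^+ k.

Lemma slow_coind (S : (V -> R) -> Prop) :
  (forall f, S f -> forall z, differentiable f z) ->
  (forall f v, S f -> S ('D_v f)) ->
  (forall f, S f -> exists (k : nat) (C : R), forall z, `|f z| <= C * (1 + `|z|) ^+ k) ->
  forall f, S f -> slow f.
Proof.
move=> Sd SD Sb f Sf; split; first exact: (smooth_coind Sd SD).
move=> vs; apply: Sb; by elim: vs => //= v vs IH; exact: SD.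
Qed.

Lemma iter_deriv_rcons vs v f : iter_deriv (rcons vs v) f = iter_deriv vs ('D_v f).
Proof. by elim: vs => //= u vs ->. Qed.

Lemma smooth_diff f z : smooth f -> differentiable f z.
Proof. by move=> /(_ [::] z). Qed.

Lemma smooth_derive f v : smooth f -> smooth ('D_v f).
Proof. by move=> sf vs z; rewrite -iter_deriv_rcons; exact: sf. Qed.

Lemma schwartz_diff f z : schwartz f -> differentiable f z.
Proof. by move=> [sf _]; exact: smooth_diff. Qed.

Lemma schwartz_derive f v : schwartz f -> schwartz ('D_v f).
Proof.
move=> [sf bf]; split; first exact: smooth_derive.
by move=> vs k; have [C h] := bf (rcons vs v) k; exists C => z; rewrite -iter_deriv_rcons.
Qed.

Lemma schwartz_bound f k : schwartz f -> exists C : R, forall z, (1 + `|z|) ^+ k * `|f z| <= C.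
Proof. by move=> [_ bf]; exact: (bf [::]). Qed.

Lemma slow_derive f v : slow f -> slow ('D_v f).
Proof.
move=> [sf bf]; split; first exact: smooth_derive.
by move=> vs; have [k [C h]] := bf (rcons vs v); exists k, C => z; rewrite -iter_deriv_rcons.
Qed.

Lemma differentiableDf f g z : differentiable f z -> differentiable g z ->
  differentiable (fun x => f x + g x) z.
Proof. exact: differentiableD. Qed.

Lemma differentiableMf f g z : differentiable f z -> differentiable g z ->
  differentiable (fun x => f x * g x) z.
Proof. exact: differentiableM. Qed.

Lemma differentiableVf f z : differentiable f z -> f z != 0 ->
  differentiable (fun x => (f x)^-1) z.
Proof. exact: differentiableV. Qed.

Lemma deriveDf f g v : (forall z, differentiable f z) -> (forall z, differentiable g z) ->
  'D_v (fun x => f x + g x) = fun x => 'D_v f x + 'D_v g x.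
Proof.
by move=> df dg; apply/funext => z; rewrite (@deriveD _ _ _ f g)//; exact: diff_derivable.
Qed.

Lemma deriveMf f g v : (forall z, differentiable f z) -> (forall z, differentiable g z) ->
  'D_v (fun x => f x * g x) = fun x => 'D_v f x * g x + f x * 'D_v g x.
Proof.
move=> df dg; apply/funext => z; rewrite (@deriveM _ _ f g)//; [|exact: diff_derivable..].
by rewrite addrC /GRing.scale /= [g z * _]mulrC.
Qed.

Lemma deriveVf f v : (forall z, differentiable f z) -> (forall z, f z != 0) ->
  'D_v (fun x => (f x)^-1) = fun x => - 1 * 'D_v f x * ((f x)^-1 * (f x)^-1).
Proof.
move=> df f0; apply/funext => z; rewrite (@deriveV _ _ f)//; last exact: diff_derivable.
by rewrite /GRing.scale /= expr2 invfM; ring.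
Qed.

(** The Leibniz and quotient rules only produce sums, products and inverses of members, so the class
    is closed under derivation. Inverses serve the later division by a sum of squares. *)
Inductive smooth_span : (V -> R) -> Prop :=
| smooth_span_base f : smooth f -> smooth_span f
| smooth_span_add f g : smooth_span f -> smooth_span g -> smooth_span (fun x => f x + g x)
| smooth_span_mul f g : smooth_span f -> smooth_span g -> smooth_span (fun x => f x * g x)
| smooth_span_inv f : smooth_span f -> (forall x, f x != 0) -> smooth_span (fun x => (f x)^-1).

Lemma smooth_cst (c : R) : smooth (fun _ : V => c).
Proof.
apply: (@smooth_coind (fun f => exists c, f = fun _ => c)); last by exists c.
  by move=> f [{}c ->] z; exact: differentiable_cst.
by move=> f v [{}c ->]; exists 0; apply/funext => z; rewrite derive_cst.
Qed.

Lemma smooth_span_diff f : smooth_span f -> forall z, differentiable f z.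
Proof.
elim => {f} [f sf z|f g _ IHf _ IHg z|f g _ IHf _ IHg z|f _ IHf f0 z].
- exact: smooth_diff.
- exact: differentiableDf.
- exact: differentiableMf.
- exact: differentiableVf.
Qed.

Lemma smooth_span_smooth f : smooth_span f -> smooth f.
Proof.
apply: smooth_coind; first exact: smooth_span_diff.
move=> {}f v; elim => {f} [f sf|f g af IHf ag IHg|f g af IHf ag IHg|f af IHf f0].
- exact/smooth_span_base/smooth_derive.
- by rewrite (deriveDf _ (smooth_span_diff af) (smooth_span_diff ag)); exact: smooth_span_add.
- rewrite (deriveMf _ (smooth_span_diff af) (smooth_span_diff ag)); by apply: smooth_span_add; exact: smooth_span_mul.
- rewrite (deriveVf _ (smooth_span_diff af) f0); apply: smooth_span_mul; last by apply: smooth_span_mul; exact: smooth_span_inv.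
  by apply: smooth_span_mul => //; apply/smooth_span_base/smooth_cst.
Qed.

(** Sums are included because the Leibniz rule turns one product into two of the same kind. *)
Inductive slow_span : (V -> R) -> Prop :=
| slow_span_mul f m : schwartz f -> slow m -> slow_span (fun z => f z * m z)
| slow_span_add f g : slow_span f -> slow_span g -> slow_span (fun z => f z + g z).

Lemma slow_span_diff f : slow_span f -> forall z, differentiable f z.
Proof.
elim => {f} [f m sf [slow_span _] z|f g _ IHf _ IHg z].
  by apply: differentiableMf; [exact: schwartz_diff|exact: smooth_diff].
exact: differentiableDf.
Qed.

Lemma slow_span_schwartz f : slow_span f -> schwartz f.
Proof.
apply: schwartz_coind; first exact: slow_span_diff.
  move=> {}f v; elim => {f} [f m sf lm|f g af IHf ag IHg].
    rewrite deriveMf => [|z|z]; last 2 first.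
    - exact: schwartz_diff.
    - by apply: smooth_diff; have [] := lm.
    by apply: slow_span_add; apply: slow_span_mul => //; [exact: schwartz_derive|exact: slow_derive].
  by rewrite (deriveDf _ (slow_span_diff af) (slow_span_diff ag)); exact: slow_span_add.
move=> {}f k; elim => {f} [f m sf lm|f g af [C hC] ag [D hD]].
  have [_ /(_ [::])[l [C hC]]] := lm.
  have [D hD] := schwartz_bound (k + l) sf.
  exists (D * `|C|) => z; rewrite normrM mulrA.
  have h := hC z; have h1 := hD z.
  apply: (@le_trans _ _ ((1 + `|z|) ^+ k * `|f z| * (`|C| * (1 + `|z|) ^+ l))).
    rewrite ler_wpM2l ?mulr_ge0 ?exprn_ge0 ?addr_ge0// (le_trans h)//.
    by rewrite ler_wpM2r ?exprn_ge0 ?addr_ge0// ler_norm.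
  rewrite [`|C| * _]mulrC mulrA ler_wpM2r//.
  by rewrite mulrAC -exprD.
exists (C + D) => z; rewrite (le_trans _ (lerD (hC z) (hD z)))// -mulrDr.
by rewrite ler_wpM2l ?exprn_ge0 ?addr_ge0// ler_normD.
Qed.

Lemma schwartzM f m : schwartz f -> slow m -> schwartz (fun z => f z * m z).
Proof. by move=> sf slow_span; apply: slow_span_schwartz; exact: slow_span_mul. Qed.

Lemma slow_affine v (c : R) : slow (fun z => pdot z v + c).
Proof.
apply: (@slow_coind (fun f => exists v c, f = fun z => pdot z v + c)); last by exists v, c.
- move=> f [{}v [{}c ->]] z; apply: differentiableDf; last exact: differentiable_cst.
  by apply: (@linear_differentiable _ _ _ (pdotr v)); exact: continuous_pdotr.
- move=> f u [{}v [{}c ->]]; exists 0, (pdot u v); apply/funext => z.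
  have dl x : differentiable (fun z => pdot z v) x.
    by apply: (@linear_differentiable _ _ _ (pdotr v)); exact: continuous_pdotr.
  have dc x : differentiable (fun _ : V => c) x by exact: differentiable_cst.
  rewrite [LHS](congr1 (fun F => F z) (deriveDf u dl dc)) derive_cst addr0 pdot0r add0r deriveE//.
  by rewrite (@diff_lin _ _ _ (pdotr v))//; exact: continuous_pdotr.
- move=> f [{}v [{}c ->]]; exists 1, ((d + d)%:R * `|v| + `|c|) => z; rewrite expr1.
  rewrite (le_trans (ler_normD _ _))// mulrDl lerD//; last first.
    by rewrite mulrDr mulr1 lerDl mulr_ge0.
  rewrite (le_trans (pdot_le _ _))// mulrAC ler_wpM2l ?mulr_ge0//.
  by rewrite lerDr.
Qed.

Lemma slow_pdot v : slow (fun z => pdot z v).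
Proof. by have := slow_affine v 0; under eq_fun do rewrite addr0. Qed.

Lemma slow_cst c : slow (fun _ : V => c).
Proof. by have := slow_affine 0 c; under eq_fun do rewrite pdot0r add0r. Qed.

(** Writing -sin as a cosine with phase advanced by pi/2 keeps derivatives inside the family c cos(.
    + th). *)
Lemma is_derive_cos_line v (th : R) z u :
  differentiable (fun z => cos (pdot z v + th)) z /\
  'D_u (fun z => cos (pdot z v + th)) z = cos (pdot z v + th + pi / 2) * pdot u v.
Proof.
have dl : differentiable (fun z => pdot z v + th) z.
  by have [s _] := slow_affine v th; exact: smooth_diff.
have dc : is_diff (pdot z v + th) (@cos R) ( *:%R^~ (- sin (pdot z v + th))).
  have dc1 := is_derive_cos (pdot z v + th).
  apply: DiffDef; first exact/derivable1_diffP.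
  by rewrite deriv1E//= derive1E derive_val.
have dc0 : differentiable (@cos R) (pdot z v + th) by case: dc.
have dcl : differentiable ((@cos R) \o (fun z => pdot z v + th)) z.
  exact: differentiable_comp.
split=> //; rewrite deriveE// [X in 'd X z](_ : _ = (@cos R) \o (fun z => pdot z v + th))//.
rewrite diff_comp//=.
rewrite diff_val /= cosDpihalf /GRing.scale /= mulrC; congr (_ * _).
rewrite -deriveE//.
have dp x : differentiable (fun z => pdot z v) x by have [s _] := slow_pdot v; exact: smooth_diff.
have dk x : differentiable (fun _ : V => th) x by exact: differentiable_cst.
rewrite [LHS](congr1 (fun F => F z) (deriveDf u dp dk)) derive_cst addr0 deriveE//.
by rewrite (@diff_lin _ _ _ (pdotr v))//; exact: continuous_pdotr.
Qed.

Lemma slow_cos v (th : R) : slow (fun z => cos (pdot z v + th)).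
Proof.
apply: (@slow_coind (fun f => exists (c th : R), f = fun z => c * cos (pdot z v + th))); last first.
- by exists 1, th; apply/funext => z; rewrite mul1r.
- move=> f [c [{}th ->]]; exists 0%N, `|c| => z; rewrite expr0 mulr1 normrM.
  by rewrite ler_piMr// ler_norml cos_geN1 cos_le1.
- move=> f u [c [{}th ->]]; exists (c * pdot u v), (th + pi / 2); apply/funext => z.
  have dk x : differentiable (fun _ : V => c) x by exact: differentiable_cst.
  have dc x : differentiable (fun z => cos (pdot z v + th)) x by have [] := is_derive_cos_line v th x 0.
  rewrite [LHS](congr1 (fun F => F z) (deriveMf u dk dc)) derive_cst mul0r add0r; have [_ ->] := is_derive_cos_line v th z u.
  by rewrite addrA mulrA mulrAC.
- move=> f [c [{}th ->]] z; apply: differentiableMf; first exact: differentiable_cst.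
  by have [] := is_derive_cos_line v th z 0.
Qed.

Lemma schwartzZ c f : schwartz f -> schwartz (fun z => c * f z).
Proof.
by move=> sf; have := schwartzM sf (slow_cst c); under eq_fun do rewrite mulrC.
Qed.

Lemma schwartzD f g : schwartz f -> schwartz g -> schwartz (fun z => f z + g z).
Proof.
move=> sf sg; have h := slow_cst 1.
have := slow_span_schwartz (slow_span_add (slow_span_mul sf h) (slow_span_mul sg h)).
by under eq_fun do rewrite !mulr1.
Qed.

End Calculus.

(** * Affine substitutions, compactness, and compactly supported smooth functions *)

Section SmoothOps.
Variables (R : realType) (d : nat).
Local Notation V := ('rV[R]_d * 'rV[R]_d)%type.
Implicit Types (z u v a : V) (f g m : V -> R).

Lemma smoothD f g : smooth f -> smooth g -> smooth (fun z => f z + g z).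
Proof. by move=> sf sg; apply: smooth_span_smooth; apply: smooth_span_add; exact: smooth_span_base. Qed.

Lemma smoothM f g : smooth f -> smooth g -> smooth (fun z => f z * g z).
Proof. by move=> sf sg; apply: smooth_span_smooth; apply: smooth_span_mul; exact: smooth_span_base. Qed.

Lemma smoothV f : smooth f -> (forall z, f z != 0) -> smooth (fun z => (f z)^-1).
Proof. by move=> sf f0; apply: smooth_span_smooth; apply: smooth_span_inv => //; exact: smooth_span_base. Qed.

Lemma smooth_sum n (F : 'I_n -> V -> R) : (forall i, smooth (F i)) ->
  smooth (fun z => \sum_(i < n) F i z).
Proof.
elim: n F => [|n IH] F sF.
  by under eq_fun do rewrite big_ord0; exact: smooth_cst.
under eq_fun do rewrite big_ord_recl.
by apply: smoothD => //; apply: IH => i.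
Qed.

Definition dilate (b c : R) z : V := (b *: z.1, c *: z.2).

Lemma is_linear_dilate b c : linear (dilate b c).
Proof.
by move=> k [x1 x2] [y1 y2]; congr (_, _) => /=;
   rewrite scalerDr !scalerA mulrC.
Qed.

HB.instance Definition _ b c := GRing.isLinear.Build R V V *:%R (dilate b c) (is_linear_dilate b c).

Lemma continuous_dilate b c : continuous (dilate b c).
Proof.
apply: bounded_linear_continuous; apply/linear_boundedP; near=> r; move=> z.
apply: (@le_trans _ _ ((`|b| + `|c|) * `|z|)); last by rewrite ler_wpM2r.
rewrite !prod_normE ge_max !normrZ; apply/andP; split.
  by rewrite ler_pM// ?lerDl// le_max lexx.
by rewrite ler_pM// ?lerDr// le_max lexx orbT.
Unshelve. all: end_near. Qed.

Lemma smooth_affine (b c : R) a f : smooth f -> smooth (fun z => f (dilate b c z + a)).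
Proof.
move=> sf; apply: (@smooth_coind _ _ (fun g => exists f, smooth f /\ g = fun z => f (dilate b c z + a))); last by exists f.
- move=> g [{sf}f [sf ->]] z.
  have dl : differentiable (fun z => dilate b c z + a) z.
    apply: (@differentiableD _ _ _ (dilate b c) (cst a) z) => //.
    by apply: (@linear_differentiable _ _ _ (dilate b c)); exact: continuous_dilate.
  apply: (@differentiable_comp _ _ _ _ (fun z => dilate b c z + a) f) => //.
  exact: smooth_diff.
- move=> g v [{sf}f [sf ->]]; exists ('D_(dilate b c v) f); split; first exact: smooth_derive.
  apply/funext => z; rewrite /derive; apply: (congr1 (fun F : R -> R => lim (F @ 0^'))); apply/funext => h /=.
  by rewrite (is_linear_dilate b c h v z) addrA.
Qed.


Lemma peetre (u v : V) : 1 + `|u + v| <= (1 + `|u|) * (1 + `|v|).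
Proof.
rewrite (@le_trans _ _ (1 + (`|u| + `|v|)))// ?lerD2l ?ler_normD//.
by rewrite mulrDl mul1r mulrDr mulr1 addrA -[leLHS]addr0 -!addrA lerD2l addrCA lerD2l lerD2l mulr_ge0.
Qed.

Lemma derive_translate f a v : 'D_v (fun z => f (z + a)) = fun z => 'D_v f (z + a).
Proof.
apply/funext => z; rewrite /derive; apply: (congr1 (fun F : R -> R => lim (F @ 0^'))); apply/funext => h /=.
by rewrite addrA.
Qed.

Lemma schwartz_translate f a : schwartz f -> schwartz (fun z => f (z + a)).
Proof.
move=> sf; apply: (@schwartz_coind _ _ (fun g => exists f, schwartz f /\ g = fun z => f (z + a))); last by exists f.
- move=> g [{sf}f [sf ->]] z.
  have dl : differentiable (fun z : V => z + a) z.
    exact: (@differentiableD _ _ _ (@id V) (cst a) z).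
  apply: (@differentiable_comp _ _ _ _ (fun z => z + a) f) => //.
  exact: schwartz_diff.
- move=> g v [{sf}f [sf ->]]; exists ('D_v f); split; first exact: schwartz_derive.
  exact: derive_translate.
- move=> g k [{sf}f [sf ->]]; have [C hC] := schwartz_bound k sf.
  exists ((1 + `|a|) ^+ k * C) => z.
  apply: le_trans (ler_wpM2l _ (hC (z + a))); last by rewrite exprn_ge0// addr_ge0.
  rewrite mulrA -exprMn ler_wpM2r// lerXn2r ?nnegrE ?mulr_ge0 ?addr_ge0//.
  by have := peetre (z + a) (- a); rewrite normrN addrK mulrC.
Qed.

Lemma schwartz_transl f a : schwartz f -> schwartz (transl a f).
Proof. exact: schwartz_translate. Qed.

Lemma bounded_on_ball f (M : R) : continuous f ->
  exists C : R, forall z, `|z| <= M -> `|f z| <= C.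
Proof.
move=> cf; have [M0|M0] := ltP M 0.
  by exists 0 => z zM; have := le_lt_trans zM M0; rewrite normr_lt0.
pose A := [set x : 'rV[R]_d | `|x| <= M].
have cA : compact A.
  apply: bounded_closed_compact.
    by exists M; split; [exact: num_real|move=> x /ltW Mx y; rewrite /A /= => /le_trans; apply].
  apply: (@closed_comp _ _ (fun x : 'rV[R]_d => `|x|) [set t : R | t <= M]); last exact: closed_le.
  by move=> x _; exact: norm_continuous.
have [||c _ hc] := @compact_EVT_max (V : topologicalType) R (fun z => `|f z|) (A `*` A) _ (compact_setX cA cA).
- by exists 0; split; rewrite /A /= normr0.
- by apply: continuous_subspaceT => z; apply: (@continuous_comp _ _ _ f); [exact: cf|exact: norm_continuous].
exists `|f c| => z; rewrite prod_normE ge_max => /andP[z1 z2].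
by apply: hc; rewrite inE; split.
Qed.

Lemma smooth_continuous f : smooth f -> continuous f.
Proof. by move=> sf z; apply/differentiable_continuous/smooth_diff. Qed.

Lemma compact_support_schwartz f (M : R) : smooth f ->
  (forall z, M < `|z| -> f z = 0) -> schwartz f.
Proof.
move=> sf f0; apply: (@schwartz_coind _ _ (fun f => smooth f /\ (forall z, M < `|z| -> f z = 0))) => //.
- by move=> g [sg _] z; exact: smooth_diff.
- move=> g v [sg g0]; split; first exact: smooth_derive.
  (* The exterior of the closed ball is open, so [g] vanishes in a whole neighbourhood of [z]. *)
  move=> z zM; rewrite (@near_eq_derive _ _ _ g (fun=> 0))//; first by rewrite derive_cst.
  have op : open [set z : V | M < `|z|].
    apply: (@open_comp _ _ (fun x : V => `|x|) [set t : R | M < t]); last exact: open_gt.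
    by move=> x _; exact: norm_continuous.
  by have := open_nbhs_nbhs (conj op zM); apply: filterS => x; exact: g0.
- move=> g k [sg g0]; have [C hC] := bounded_on_ball M (smooth_continuous sg).
  exists ((1 + `|M|) ^+ k * `|C|) => z; have [zM|zM] := leP `|z| M; last first.
    by rewrite g0// normr0 mulr0 mulr_ge0// exprn_ge0// addr_ge0.
  apply: ler_pM => //.
    by rewrite lerXn2r ?nnegrE ?addr_ge0// lerD2l (le_trans zM)// ler_norm.
  by rewrite (le_trans (hC _ zM))// ler_norm.
Qed.

End SmoothOps.

(** * Integration of Schwartz functions *)

Section Integral.
Variables (R : realType) (d : nat).
Local Notation V := ('rV[R]_d * 'rV[R]_d)%type.
Implicit Types (z u v a : V) (f g m : V -> R) (y : nat -> R).
Local Notation w := (fun t : R => (1 + t ^+ 2)^-1).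
Local Notation vec := (@vec R d).
Local Notation basis := (@basis R d).
Local Notation n2 := ((d + d) * 2)%N.
Local Notation mass := (weight_mass R ^+ (d + d)).

Lemma weight_ge_norm z (k : nat) : (k < d + d)%N ->
  ((1 + `|z|) ^+ 2)^-1 <= w (crd z k).
Proof.
move=> kd; rewrite lef_pV2 ?posrE ?exprn_gt0 ?ltr_pwDl// ?sqr_ge0//.
have := crd_le z kd; have := normr_ge0 z; rewrite -(real_normK (num_real (crd z k))).
by have := normr_ge0 (crd z k); nra.
Qed.

(** Two powers of 1 + |z| are spent per coordinate, whence the exponent [n2]; the powers for
    coordinates outside [P] are compared with 1. *)
Lemma prod_weight_ge_norm z y (P : pred 'I_(d + d)) :
  (forall k, P k -> y k = crd z k) ->
  ((1 + `|z|) ^+ n2)^-1 <= \prod_(k < d + d | P k) w (y k).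
Proof.
move=> h; rewrite mulnC exprM -exprVn -[in leLHS](card_ord (d + d)) -prodr_const.
rewrite [leRHS]big_mkcond /=; apply: ler_prod => k _.
have p0 : 0 < 1 + `|z| by rewrite ltr_pwDl.
rewrite invr_ge0 exprn_ge0 ?(ltW p0)//=; case: ifP => Pk; first by rewrite h// weight_ge_norm.
by rewrite invf_le1 ?exprn_gt0// exprn_ege1// lerDl.
Qed.

Lemma decay_vec f (C : R) : (forall z, (1 + `|z|) ^+ n2 * `|f z| <= C) ->
  decay (d + d) C (f \o vec).
Proof.
move=> h y /=; have := h (vec y); set z := vec y => hz.
have p0 : 0 < (1 + `|z|) ^+ n2 by rewrite exprn_gt0// ltr_pwDl.
have C0 : 0 <= C by apply: le_trans hz; rewrite mulr_ge0 ?(ltW p0).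
have : `|f z| <= C * ((1 + `|z|) ^+ n2)^-1 by rewrite ler_pdivlMr// mulrC.
move=> /le_trans; apply; rewrite ler_wpM2l//; apply: prod_weight_ge_norm => k _.
by rewrite crd_vec.
Qed.

Lemma schwartz_tame f : schwartz f -> tame (d + d) (f \o vec).
Proof.
move=> sf; split; first by move=> y y' /eq_vec /= ->.
have [C0 h0] := schwartz_bound n2 sf.
have /choice[K hK] : forall i : 'I_(d + d), exists C : R, forall z, (1 + `|z|) ^+ n2 * `|'D_(basis i) f z| <= C.
  by move=> i; apply: schwartz_bound; exact: schwartz_derive.
exists (`|C0| + \sum_i `|K i|); split.
  apply: decay_vec => z; rewrite (le_trans (h0 z))// (le_trans (ler_norm _))// lerDl sumr_ge0//.
move=> i y y' yy' /=.
have E : vec y = vec y' + (y i - y' i) *: basis i.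
  rewrite -vecZ -vecD; apply: eq_vec => k kd.
  have [->|ki] := eqVneq k i; first by rewrite mulr1 addrC subrK.
  by rewrite mulr0 addr0 yy'.
rewrite E; have [s _ ->] := mean_value_line (vec y') ((y i - y' i) *: basis i) (fun x => schwartz_diff x sf).
rewrite deriveZv; last exact: schwartz_diff.
rewrite normrM [_ * `|y i - _|]mulrC -mulrA ler_wpM2l//.
set z := _ + _; have hz := hK i z.
have p0 : 0 < (1 + `|z|) ^+ n2 by rewrite exprn_gt0// ltr_pwDl.
have Kn : `|K i| <= `|C0| + \sum_i `|K i|.
  by rewrite (bigD1 i)//= addrCA lerDl addr_ge0 ?sumr_ge0.
have : `|'D_(basis i) f z| <= `|K i| * ((1 + `|z|) ^+ n2)^-1.
  by rewrite ler_pdivlMr// mulrC (le_trans hz)// ler_norm.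
move=> /le_trans; apply; apply: ler_pM => //.
(* The intermediate point differs from [y'] only along [basis i], so on the coordinates kept in the
   product it agrees with [y]. *)
apply: prod_weight_ge_norm => k ki.
rewrite yy'; last by [].
rewrite /z /crd pdotDl pdotZl pdotZl -![pdot _ (basis k)]/(crd _ k) !crd_vec//.
have -> : (k == i :> nat) = false by apply: negbTE; exact: ki.
by rewrite !mulr0 addr0.
Qed.

Lemma int2d_bound f (C : R) : schwartz f ->
  (forall z, (1 + `|z|) ^+ n2 * `|f z| <= C) -> `|int2d f| <= C * mass.
Proof. by move=> sf h; apply: iint_bound; [exact: schwartz_tame|exact: decay_vec]. Qed.

Lemma int2d_lin f g (a b : R) : schwartz f -> schwartz g ->
  int2d (fun z => a * f z + b * g z) = a * int2d f + b * int2d g.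
Proof. by move=> sf sg; apply: (iint_lin a b (schwartz_tame sf) (schwartz_tame sg)). Qed.

Lemma schwartz0 : schwartz (fun _ : V => 0 : R).
Proof.
by apply: (@compact_support_schwartz _ _ _ 0) => //; exact: smooth_cst.
Qed.

Lemma int2d_0 : int2d (fun _ : V => 0 : R) = 0.
Proof.
have := int2d_lin 0 0 schwartz0 schwartz0.
rewrite (_ : (fun z => _) = (fun _ : V => 0)); last by apply/funext => z; rewrite !mul0r addr0.
by rewrite !mul0r addr0.
Qed.

Lemma int2dZ f (a : R) : schwartz f -> int2d (fun z => a * f z) = a * int2d f.
Proof.
move=> sf; have := int2d_lin a 0 sf sf; rewrite mul0r addr0 => <-.
by congr int2d; apply/funext => z; rewrite mul0r addr0.
Qed.

Lemma int2dD f g : schwartz f -> schwartz g ->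
  int2d (fun z => f z + g z) = int2d f + int2d g.
Proof.
move=> sf sg; have := int2d_lin 1 1 sf sg; rewrite !mul1r => <-.
by congr int2d; apply/funext => z; rewrite !mul1r.
Qed.

Lemma int2dB f g : schwartz f -> schwartz g ->
  int2d (fun z => f z - g z) = int2d f - int2d g.
Proof.
move=> sf sg; have := int2d_lin 1 (-1) sf sg; rewrite mul1r mulN1r => <-.
by congr int2d; apply/funext => z; rewrite mul1r mulN1r.
Qed.

Lemma schwartz_sum n (F : 'I_n -> V -> R) : (forall i, schwartz (F i)) ->
  schwartz (fun z => \sum_(i < n) F i z).
Proof.
elim: n F => [|n IH] F sF.
  by under eq_fun do rewrite big_ord0; exact: schwartz0.
under eq_fun do rewrite big_ord_recl.
by apply: schwartzD => //; apply: IH => i.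
Qed.

Lemma int2d_sum n (F : 'I_n -> V -> R) : (forall i, schwartz (F i)) ->
  int2d (fun z => \sum_(i < n) F i z) = \sum_(i < n) int2d (F i).
Proof.
elim: n F => [|n IH] F sF.
  by rewrite big_ord0; under eq_fun do rewrite big_ord0; exact: int2d_0.
rewrite big_ord_recl -IH// -int2dD//; last exact: schwartz_sum.
by congr int2d; apply/funext => z; rewrite big_ord_recl.
Qed.

Lemma int2d_affine f (b c : R) a : schwartz f -> 0 < b -> 0 < c ->
  int2d f = (b ^+ d * c ^+ d) * int2d (fun z => f (dilate b c z + a)).
Proof.
move=> sf b0 c0.
pose cc k : R := if (k < d)%N then b else c.
have cc0 k : 0 < cc k by rewrite /cc; case: ifP.
have := iint_affine (crd a) cc0 (schwartz_tame sf).
rewrite big_split_ord /= (eq_bigr (fun=> b)); last by move=> i _; rewrite /cc ltn_ord.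
rewrite prodr_const card_ord.
rewrite (eq_bigr (fun=> c)); last by move=> i _; rewrite /cc ltnNge leq_addr.
rewrite prodr_const card_ord.
rewrite -[iint _ (f \o _)]/(int2d f) => ->; congr (_ * iint _ _).
apply/funext => y /=; congr f.
rewrite -{2}(vec_crd a) -[(_, _)]/(vec y).
rewrite vecD; congr (_ + _); congr (_, _); apply/rowP => i; rewrite !mxE /cc.
  by rewrite ltn_ord.
by rewrite ltnNge leq_addr.
Qed.

Lemma int2d_translate f a : schwartz f -> int2d (fun z => f (z + a)) = int2d f.
Proof.
move=> sf; rewrite (int2d_affine a sf ltr01 ltr01) !expr1n !mul1r.
by congr int2d; apply/funext => z; rewrite /dilate !scale1r; case: z.
Qed.

(** By translation invariance f(. + h v) - f has integral 0, while Taylor's formula makes that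
    integral h times the integral of the derivative up to O(h^2). Divide by h and let h tend to
    0. *)
Lemma int2d_derive f v : schwartz f -> int2d ('D_v f) = 0.
Proof.
move=> sf; have sDf := schwartz_derive v sf; have sDDf := schwartz_derive v sDf.
have [C hC] := schwartz_bound n2 sDDf.
pose K := (1 + `|v|) ^+ n2 * `|C| * mass.
have K0 : 0 <= K by rewrite !mulr_ge0// exprn_ge0// ?addr_ge0// ?weight_mass_ge0.
have bnd h : 0 < h -> h <= 1 -> `|int2d ('D_v f)| <= K * h.
  move=> h0 h1; rewrite -(ler_pM2l h0) -{1}(gtr0_norm h0) -normrM.
  pose g z := f (z + h *: v) - f z - h * 'D_v f z.
  have st : schwartz (fun z => f (z + h *: v)) by exact: schwartz_translate.
  have s1 : schwartz (fun z => f (z + h *: v) - f z).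
    have := schwartzD st (schwartzZ (-1) sf).
    by under eq_fun do rewrite mulN1r.
  have sg : schwartz g.
    have := schwartzD s1 (schwartzZ (-h) sDf).
    by under eq_fun do rewrite mulNr.
  have -> : h * int2d ('D_v f) = - int2d g.
    rewrite /g (int2dB s1 (schwartzZ h sDf)) (int2dB st sf) int2d_translate// int2dZ//.
    by rewrite subrr sub0r opprK.
  rewrite normrN; have -> : h * (K * h) = ((1 + `|v|) ^+ n2 * `|C|) * h ^+ 2 * mass.
    by rewrite /K; ring.
  apply: int2d_bound => // z.
  have p0 : 0 < (1 + `|z|) ^+ n2 by rewrite exprn_gt0// ltr_pwDl.
  rewrite mulrC -ler_pdivlMr// /g -deriveZv; last exact: schwartz_diff.
  have ezf : 'D_(h *: v) f = fun z => h * 'D_v f z.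
    by apply/funext => x; rewrite deriveZv//; exact: schwartz_diff.
  apply: taylor1 => [x|x|s /andP[s0 s1']]; first exact: schwartz_diff.
    by rewrite ezf; apply: schwartz_diff; exact: schwartzZ.
  have -> : 'D_(h *: v) ('D_(h *: v) f) (z + s *: (h *: v)) =
     h ^+ 2 * 'D_v ('D_v f) (z + s *: (h *: v)).
    rewrite deriveZv; last by rewrite ezf; apply: schwartz_diff; exact: schwartzZ.
    rewrite ezf expr2 -mulrA; congr (_ * _).
    have := @deriveZ _ _ _ ('D_v f) h (z + s *: (h *: v)) v (diff_derivable (schwartz_diff _ sDf)).
    exact.
  rewrite normrM ger0_norm ?sqr_ge0// ler_pdivlMr// mulrC mulrCA [leRHS]mulrC ler_wpM2l ?sqr_ge0//.
  set x := z + _.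
  (* The intermediate point is within |v| of [z] since s and h are at most 1, so the weight moves
     from [z] to [x] at a cost independent of h. *)
  have xz : 1 + `|z| <= (1 + `|v|) * (1 + `|x|).
    have -> : z = x + (- (s *: (h *: v))) by rewrite /x addrK.
    rewrite (le_trans (peetre _ _))// mulrC ler_wpM2r ?addr_ge0// lerD2l normrN !normrZ.
    by rewrite mulrA ler_piMl// !ger0_norm// ?mulr_ile1// ltW.
  apply: (@le_trans _ _ (((1 + `|v|) * (1 + `|x|)) ^+ n2 * `|'D_v ('D_v f) x|)).
    by rewrite ler_wpM2r// lerXn2r ?nnegrE ?mulr_ge0 ?addr_ge0.
  rewrite exprMn -mulrA ler_wpM2l ?exprn_ge0 ?addr_ge0// (le_trans (hC x))//.
  exact: ler_norm.
apply/eqP; rewrite -normr_le0; apply/ler_addgt0Pr => e e0; rewrite add0r.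
pose h := Num.min 1 (e / (K + 1)).
have K1 : 0 < K + 1 by rewrite ltr_wpDl.
have h0 : 0 < h by rewrite lt_min ltr01 divr_gt0.
have h1 : h <= 1 by rewrite ge_min lexx.
rewrite (le_trans (bnd _ h0 h1))//.
have : h <= e / (K + 1) by rewrite ge_min lexx orbT.
rewrite ler_pdivlMr// => /(le_trans _); apply.
by rewrite mulrC ler_wpM2l ?(ltW h0)// lerDl.
Qed.

End Integral.

(** * Trigonometric transforms *)

Section Transform.
Variables (R : realType) (d : nat).
Local Notation V := ('rV[R]_d * 'rV[R]_d)%type.
Implicit Types (z u v a : V) (f g h : V -> R) (y : nat -> R) (th eta : R).
Local Notation vec := (@vec R d).
Local Notation basis := (@basis R d).
Local Notation n2 := ((d + d) * 2)%N.
Local Notation mass := (weight_mass R ^+ (d + d)).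

Lemma sin_lipschitz (a b : R) : `|sin (a + b) - sin a| <= `|b|.
Proof.
have dF (t : R) : is_derive t 1 (fun t => sin (a + t * b)) (cos (a + t * b) * b).
  by apply: is_derive_eq; rewrite ?scaler0 ?add0r ?addr0 /GRing.scale /= ?mulr1 ?mul1r// mulrC.
have [|c _] := @MVT_segment R (fun t => sin (a + t * b)) _ 0 1 ler01 (fun t _ => dF t).
  by apply: continuous_subspaceT => x; apply/differentiable_continuous/derivable1_diffP; have [] := dF x.
rewrite mul1r mul0r addr0 subr0 mulr1 => ->.
by rewrite normrM ler_piMl// ler_norml cos_geN1 cos_le1.
Qed.

(** The mean value theorem gives -sin at an intermediate point, and the Lipschitz bound for sine
    controls its distance to -sin a = cos(a + pi/2). *)
Lemma cos_taylor (a b : R) : `|cos (a + b) - cos a - cos (a + pi / 2) * b| <= b ^+ 2.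
Proof.
have dF (t : R) : is_derive t 1 (fun t => cos (a + t * b)) (- sin (a + t * b) * b).
  by apply: is_derive_eq; rewrite ?scaler0 ?add0r ?addr0 /GRing.scale /= ?mulr1 ?mul1r// mulrC.
have [|c c01] := @MVT_segment R (fun t => cos (a + t * b)) _ 0 1 ler01 (fun t _ => dF t).
  by apply: continuous_subspaceT => x; apply/differentiable_continuous/derivable1_diffP; have [] := dF x.
rewrite mul1r mul0r addr0 subr0 mulr1 => ->.
rewrite cosDpihalf -mulrBl normrM -real_normK ?num_real// expr2 ler_wpM2r//.
rewrite opprK addrC -normrN opprD opprK addrC -[leRHS]mul1r.
rewrite (le_trans (sin_lipschitz _ _))// normrM ler_wpM2r//.
by move: c01; rewrite in_itv /= => /andP[c0 c1]; rewrite ger0_norm.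
Qed.

(** Cosine and sine transforms in one: phase 0 gives [fourC], phase -pi/2 gives [fourS].
    Differentiation and multiplication by a coordinate shift the phase by pi/2. *)
Definition trig th g z : R := int2d (fun ze => g ze * cos (pdot z ze + th)).

Lemma schwartz_cosM th g z : schwartz g -> schwartz (fun ze => g ze * cos (pdot z ze + th)).
Proof.
move=> sg; have := schwartzM sg (slow_cos z th).
by under eq_fun do rewrite pdotC.
Qed.

Lemma schwartz_pdotM g v : schwartz g -> schwartz (fun ze => g ze * pdot v ze).
Proof.
move=> sg; have := schwartzM sg (slow_pdot v).
by under eq_fun do rewrite pdotC.
Qed.

Lemma trig_lin th g h (a b : R) z : schwartz g -> schwartz h ->
  trig th (fun ze => a * g ze + b * h ze) z = a * trig th g z + b * trig th h z.
Proof.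
move=> sg sh; rewrite /trig -int2d_lin; [|exact: schwartz_cosM..].
by congr int2d; apply/funext => ze; ring.
Qed.

Lemma trig_sum th n (F : 'I_n -> V -> R) z : (forall i, schwartz (F i)) ->
  trig th (fun ze => \sum_(i < n) F i ze) z = \sum_(i < n) trig th (F i) z.
Proof.
move=> sF; rewrite /trig -int2d_sum => [|i]; last exact: schwartz_cosM.
by congr int2d; apply/funext => ze; rewrite mulr_suml.
Qed.

Lemma trigZ th g (a : R) z : schwartz g ->
  trig th (fun ze => a * g ze) z = a * trig th g z.
Proof.
move=> sg; rewrite /trig -int2dZ; last exact: schwartz_cosM.
by congr int2d; apply/funext => ze; rewrite mulrA.
Qed.

Lemma trig_bound th g (C : R) z : schwartz g ->
  (forall ze, (1 + `|ze|) ^+ n2 * `|g ze| <= C) -> `|trig th g z| <= C * mass.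
Proof.
move=> sg hC; apply: int2d_bound; first exact: schwartz_cosM.
move=> ze; rewrite (le_trans _ (hC ze))// ler_wpM2l ?exprn_ge0 ?addr_ge0//.
by rewrite normrM ler_piMr// ler_norml cos_geN1 cos_le1.
Qed.

(** The remainder of [cos_taylor] is quadratic in the increment and integrable against [g], so
    [diff_of_quadratic] applies. *)
Lemma trig_diff_derive th g z : schwartz g ->
  differentiable (trig th g) z /\
  forall v, 'D_v (trig th g) z = trig (th + pi / 2) (fun ze => g ze * pdot v ze) z.
Proof.
move=> sg.
(* The candidate gradient, coordinate by coordinate; linearity of the transform turns it into the
   directional formula [E]. *)
pose u := vec (fun k => trig (th + pi / 2) (fun ze => g ze * pdot (basis k) ze) z).
have E v : pdot v u = trig (th + pi / 2) (fun ze => g ze * pdot v ze) z.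
  rewrite pdot_crd.
  transitivity (\sum_(k < d + d) trig (th + pi / 2) (fun ze => crd v k * (g ze * pdot (basis k) ze)) z).
    by apply: eq_bigr => k _; rewrite crd_vec// trigZ//; exact: schwartz_pdotM.
  rewrite -trig_sum => [|k]; last by apply: schwartzZ; exact: schwartz_pdotM.
  congr trig; apply/funext => ze; rewrite pdot_crd mulr_sumr; apply: eq_bigr => k _.
  by rewrite [pdot (basis k) ze]pdotC -/(crd ze k); ring.
(* The two powers beyond [n2] pay for the square of [pdot h ze]. *)
have [C hC] := schwartz_bound (n2 + 2) sg.
have [|df D] := @diff_of_quadratic R d (trig th g) z u ((d + d)%:R ^+ 2 * C * mass); last first.
  by split=> // v; rewrite D E.
move=> h _; rewrite E.
pose G ze := g ze * cos (pdot (z + h) ze + th) - g ze * cos (pdot z ze + th).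
pose H ze := (g ze * pdot h ze) * cos (pdot z ze + (th + pi / 2)).
have sG : schwartz G.
  have := schwartzD (schwartz_cosM th (z + h) sg) (schwartzZ (-1) (schwartz_cosM th z sg)).
  by under eq_fun do rewrite mulN1r.
have sH : schwartz H by apply: schwartz_cosM; exact: schwartz_pdotM.
have -> : trig th g (z + h) - trig th g z - trig (th + pi / 2) (fun ze => g ze * pdot h ze) z =
   int2d (fun ze => G ze - H ze).
  by rewrite int2dB// int2dB//; exact: schwartz_cosM.
have sGH : schwartz (fun ze => G ze - H ze).
  by have := schwartzD sG (schwartzZ (-1) sH); under eq_fun do rewrite mulN1r.
have -> : (d + d)%:R ^+ 2 * C * mass * `|h| ^+ 2 = ((d + d)%:R ^+ 2 * `|h| ^+ 2 * C) * mass by ring.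
apply: int2d_bound => // ze.
have -> : G ze - H ze = g ze * (cos ((pdot z ze + th) + pdot h ze) - cos (pdot z ze + th) -
    cos ((pdot z ze + th) + pi / 2) * pdot h ze).
  rewrite /G /H; have -> : pdot (z + h) ze + th = pdot z ze + th + pdot h ze by rewrite pdotDl addrAC.
  have -> : pdot z ze + (th + pi / 2) = pdot z ze + th + pi / 2 by rewrite addrA.
  by ring.
rewrite normrM.
have b2 := cos_taylor (pdot z ze + th) (pdot h ze).
have p2 : pdot h ze ^+ 2 <= (d + d)%:R ^+ 2 * `|h| ^+ 2 * (1 + `|ze|) ^+ 2.
  rewrite -real_normK ?num_real// -!exprMn lerXn2r ?nnegrE ?mulr_ge0 ?addr_ge0//.
  by rewrite (le_trans (pdot_le _ _))// ler_wpM2l ?mulr_ge0// lerDr.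
have c0 : 0 <= (1 + `|ze|) ^+ n2 * `|g ze| by rewrite mulr_ge0// exprn_ge0 ?addr_ge0.
rewrite mulrA (le_trans (ler_wpM2l c0 (le_trans b2 p2)))//.
rewrite mulrCA ler_wpM2l ?mulr_ge0 ?sqr_ge0//.
by rewrite mulrAC -exprD.
Qed.

Lemma trig_derive th g v : schwartz g ->
  'D_v (trig th g) = trig (th + pi / 2) (fun ze => g ze * pdot v ze).
Proof. by move=> sg; apply/funext => z; have [_ ->] := trig_diff_derive th z sg. Qed.

(** Integration by parts: g(x) cos(z.x + th - pi/2), differentiated in the k-th direction, has
    integral 0, and the derivative of the cosine is z_k cos(z.x + th). *)
Lemma crd_trig th g z (k : nat) : schwartz g ->
  crd z k * trig th g z = - trig (th - pi / 2) ('D_(basis k) g) z.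
Proof.
move=> sg; have := int2d_derive (basis k) (schwartz_cosM (th - pi / 2) z sg).
rewrite deriveMf => [|x|x]; last 2 first.
- exact: schwartz_diff.
- have [+ _] := is_derive_cos_line z (th - pi / 2) x 0.
  by under eq_fun do rewrite pdotC.
have -> : (fun x => 'D_(basis k) g x * cos (pdot z x + (th - pi / 2)) +
    g x * 'D_(basis k) (fun x => cos (pdot z x + (th - pi / 2))) x) =
  (fun x => 'D_(basis k) g x * cos (pdot z x + (th - pi / 2)) +
    crd z k * (g x * cos (pdot z x + th))).
  apply/funext => x; congr (_ + _); rewrite mulrCA; congr (_ * _).
  have [_ +] := is_derive_cos_line z (th - pi / 2) x (basis k).
  under [X in 'D__ X _ = _ -> _]eq_fun do rewrite pdotC.
  by move=> ->; rewrite (addrA (pdot x z)) subrK [pdot (basis k) z]pdotC -/(crd z k) pdotC mulrC.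
have sD := schwartz_derive (basis k) sg.
rewrite int2dD; [|exact: schwartz_cosM|by apply: schwartzZ; exact: schwartz_cosM].
rewrite int2dZ; last exact: schwartz_cosM.
by move=> /eqP; rewrite addrC addr_eq0 => /eqP.
Qed.

(** Decay is gained one power at a time: |z| is at most the sum of the |z_k|, and [crd_trig] trades
    each factor z_k for a derivative of [g] and a new phase. Hence the induction ranges over all [g]
    and [th]. *)
Lemma trig_schwartz th g : schwartz g -> schwartz (trig th g).
Proof.
move=> sg; apply: (@schwartz_coind _ _ (fun F => exists th g, schwartz g /\ F = trig th g)); last by exists th, g.
- by move=> f [{}th [{sg}g [sg ->]]] z; have [] := trig_diff_derive th z sg.
- move=> f v [{}th [{sg}g [sg ->]]]; exists (th + pi / 2), (fun ze => g ze * pdot v ze).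
  by split; [exact: schwartz_pdotM|exact: trig_derive].
move=> f k [{}th [{sg}g [sg ->]]]; elim: k th g sg => [|k IH] th g sg.
  have [C hC] := schwartz_bound n2 sg; exists (C * mass) => z.
  by rewrite expr0 mul1r; exact: trig_bound.
have [C hC] := IH th g sg.
have /choice[K hK] : forall i : 'I_(d + d), exists C : R, forall z,
    (1 + `|z|) ^+ k * `|trig (th - pi / 2) ('D_(basis i) g) z| <= C.
  by move=> i; apply: IH; exact: schwartz_derive.
exists (C + \sum_i K i) => z.
rewrite exprSr -mulrA (@le_trans _ _ ((1 + `|z|) ^+ k * (`|trig th g z| +
   \sum_(i < d + d) `|trig (th - pi / 2) ('D_(basis i) g) z|)))//.
  rewrite ler_wpM2l ?exprn_ge0 ?addr_ge0// mulrDl mul1r lerD2l.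
  rewrite (le_trans (ler_wpM2r _ (norm_le_sum z)))// mulr_suml; apply: ler_sum => i _.
  by rewrite -normrM crd_trig// normrN.
by rewrite mulrDr mulr_sumr lerD// ler_sum.
Qed.

Lemma trig_int0 th h (F : 'I_(d + d) -> V -> R) : (forall k, schwartz (F k)) ->
  h = (fun ze => \sum_(k < d + d) F k ze * pdot (basis k) ze) ->
  int2d (trig th h) = 0.
Proof.
move=> sF ->.
(* The phase th - pi/2 is chosen so that the derivative brings it back to [th]. *)
have -> : trig th (fun ze => \sum_(k < d + d) F k ze * pdot (basis k) ze) =
  (fun z => \sum_(k < d + d) 'D_(basis k) (trig (th - pi / 2) (F k)) z).
  apply/funext => z; rewrite trig_sum => [|k]; last exact: schwartz_pdotM.
  by apply: eq_bigr => k _; rewrite (trig_diff_derive _ z (sF k)).2 subrK.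
rewrite int2d_sum => [|k]; last by apply: schwartz_derive; exact: trig_schwartz.
by rewrite big1// => k _; rewrite int2d_derive//; exact: trig_schwartz.
Qed.

(* Away from the origin divide by |ze|^2 = sum_k ze_k^2; the bump chi, supported where h
   vanishes, only keeps the denominator positive. *)
Lemma trig_int_vanishing th h chi (M e : R) : 0 < e ->
  smooth h -> (forall z, M < `|z| -> h z = 0) -> (forall z, `|z| < e -> h z = 0) ->
  smooth chi -> chi 0 = 1 -> (forall z, e <= `|z| -> chi z = 0) ->
  int2d (trig th h) = 0.
Proof.
move=> e0 sh hM he sc c0 ce.
pose D z := \sum_(k < d + d) crd z k * crd z k + chi z * chi z.
have sD : smooth D.
  apply: smoothD; last exact: smoothM.
  by apply: smooth_sum => k; have [s _] := slow_pdot (basis k); exact: smoothM.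
have S0 z : 0 <= \sum_(k < d + d) crd z k * crd z k.
  by apply: sumr_ge0 => k _; rewrite -expr2 sqr_ge0.
have Sz z : \sum_(k < d + d) crd z k * crd z k = 0 -> z = 0.
  move=> /eqP; rewrite psumr_eq0 => [/allP /= z0|k _]; last by rewrite -expr2 sqr_ge0.
  apply/eqP; rewrite -normr_le0; apply: norm_le_crd => // k kd.
  have := z0 (Ordinal kd); rewrite mem_index_enum => /(_ isT).
  by rewrite -expr2 sqrf_eq0 => /eqP ->; rewrite normr0.
have D0 z : D z != 0.
  rewrite /D paddr_eq0 -?expr2 ?sqr_ge0//; apply/negP => /andP[/eqP/Sz ->].
  by rewrite c0 expr1n oner_eq0.
pose q z := h z * (D z)^-1.
have sq : smooth q by apply: smoothM => //; exact: smoothV.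
apply: (@trig_int0 _ _ (fun k z => q z * pdot (basis k) z)).
  move=> k; apply: schwartz_pdotM; apply: (@compact_support_schwartz _ _ _ M) => //.
  by move=> z zM; rewrite /q hM// mul0r.
apply/funext => z.
transitivity (q z * \sum_(k < d + d) crd z k * crd z k); last first.
  rewrite mulr_sumr; apply: eq_bigr => k _.
  by rewrite ![pdot (basis k) z]pdotC -/(crd z k) mulrA.
have [ze|ze] := ltP `|z| e; first by rewrite /q he// !mul0r.
rewrite /q; have := D0 z; rewrite /D ce// mulr0 addr0 => S1.
by rewrite divfK.
Qed.

(** Product-to-sum formula: multiplying the transform by a wave of frequency [a] translates [g] by
    [a] and by [-a], while the phases add and subtract. *)
Lemma trig_mod th eta g z a : schwartz g ->
  trig th g z * cos (pdot z a + eta) =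
  2^-1 * trig (th + eta) (fun ze => g (ze - a)) z + 2^-1 * trig (th - eta) (fun ze => g (ze + a)) z.
Proof.
move=> sg.
have s1 := schwartz_translate (-a) sg; have s2 := schwartz_translate a sg.
rewrite /trig -(int2d_translate a (schwartz_cosM (th + eta) z s1)).
rewrite -(int2d_translate (- a) (schwartz_cosM (th - eta) z s2)).
rewrite -int2d_lin; last 2 first.
- exact: (schwartz_translate a (schwartz_cosM (th + eta) z s1)).
- exact: (schwartz_translate (- a) (schwartz_cosM (th - eta) z s2)).
rewrite mulrC -int2dZ; last exact: schwartz_cosM.
congr int2d; apply/funext => ze; rewrite addrK subrK pdotBr pdotDr.
have -> : pdot z ze + pdot z a + (th + eta) = (pdot z ze + th) + (pdot z a + eta) by ring.
have -> : pdot z ze - pdot z a + (th - eta) = (pdot z ze + th) - (pdot z a + eta) by ring.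
by rewrite cosB (cosD (pdot z ze + th) (pdot z a + eta)); field.
Qed.

Lemma trig_trig th eta g a : schwartz g ->
  trig eta (trig th g) a =
  2^-1 * int2d (trig (th + eta) (fun ze => g (ze - a))) +
  2^-1 * int2d (trig (th - eta) (fun ze => g (ze + a))).
Proof.
move=> sg; rewrite -int2d_lin; last 2 first.
- by apply: trig_schwartz; exact: schwartz_translate.
- by apply: trig_schwartz; exact: schwartz_translate.
by rewrite {1}/trig; congr int2d; apply/funext => z; rewrite pdotC trig_mod.
Qed.

Lemma pdot_dilate (b c : R) z v : pdot (dilate b c z) v = pdot z (dilate b c v).
Proof.
by rewrite /pdot /edot /dilate /=; congr (_ + _); apply: eq_bigr => i _; rewrite !mxE; ring.
Qed.

Lemma dilateK (b c : R) z : b != 0 -> c != 0 -> dilate b^-1 c^-1 (dilate b c z) = z.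
Proof. by move=> b0 c0; case: z => x v; rewrite /dilate /= !scalerA !mulVf// !scale1r. Qed.

Lemma trig_dilate th g (b c : R) z : schwartz g -> 0 < b -> 0 < c ->
  trig th g (dilate b^-1 c^-1 z) = (b ^+ d * c ^+ d) * trig th (fun ze => g (dilate b c ze)) z.
Proof.
move=> sg b0 c0; rewrite {1}/trig (int2d_affine 0 (schwartz_cosM _ _ sg) b0 c0).
congr (_ * _); congr int2d; apply/funext => ze.
by rewrite addr0 pdot_dilate dilateK ?gt_eqF.
Qed.

End Transform.

(** * Littlewood-Paley blocks *)

Section Blocks.
Variables (R : realType) (d : nat).
Hypothesis d_gt0 : (0 < d)%N.
Local Notation V := ('rV[R]_d * 'rV[R]_d)%type.
Implicit Types (z u v a : V) (f g h : V -> R) (th eta : R).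

Lemma norm_le_enorm (x : 'rV[R]_d) : `|x| <= enorm x.
Proof.
rewrite [leLHS]/Num.norm /= mx_normrE; apply/bigmax_leP; split; first exact: sqrtr_ge0.
case=> i j _ /=; rewrite ord1 -sqrtr_sqr ler_wsqrtr// (bigD1 j)//= lerDl.
by apply: sumr_ge0 => k _; exact: sqr_ge0.
Qed.

Lemma enorm_ge0 (x : 'rV[R]_d) : 0 <= enorm x.
Proof. exact: sqrtr_ge0. Qed.

Lemma enorm_le_norm (x : 'rV[R]_d) : enorm x <= d%:R * `|x|.
Proof.
have d1 : 1 <= d%:R :> R by rewrite ler1n.
rewrite -(@ger0_norm _ (d%:R * `|x|)) ?mulr_ge0// -sqrtr_sqr ler_wsqrtr//.
rewrite (@le_trans _ _ (\sum_(i < d) `|x| ^+ 2))//.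
  apply: ler_sum => i _; rewrite -real_normK ?num_real// lerXn2r ?nnegrE//.
  by rewrite [leRHS]/Num.norm /= mx_normrE (le_bigmax _ (fun ij => `|x ij.1 ij.2|) (ord0, i)).
rewrite sumr_const card_ord -[_ *+ d]mulr_natl exprMn ler_wpM2r ?sqr_ge0//.
by rewrite expr2 ler_pMl// ltr0n.
Qed.

Lemma cbrtK (r : R) : 0 <= r -> (r `^ (3^-1)) ^+ 3 = r.
Proof. by move=> r0; rewrite -powR_mulrn ?powR_ge0// -powRrM mulVf// powRr1. Qed.

Lemma cbrt_le (r s : R) : 0 <= r -> 0 <= s -> r <= s ^+ 3 -> r `^ (3^-1) <= s.
Proof.
move=> r0 s0; rewrite -{1}(cbrtK r0) => h.
by rewrite -(@ler_pXn2r _ 3) ?nnegrE ?powR_ge0.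
Qed.

Lemma anorm_ge0 z : 0 <= anorm z.
Proof. by rewrite addr_ge0 ?powR_ge0 ?enorm_ge0. Qed.

Lemma anorm_le_norms z (r : R) : anorm z <= r -> `|z.1| <= r ^+ 3 /\ `|z.2| <= r.
Proof.
move=> zr; split.
  rewrite (le_trans (norm_le_enorm _))// -(cbrtK (enorm_ge0 _)).
  rewrite lerXn2r ?nnegrE ?powR_ge0//; first by rewrite (le_trans _ zr)// anorm_ge0.
  by rewrite (le_trans _ zr)// lerDl enorm_ge0.
by rewrite (le_trans (norm_le_enorm _))// (le_trans _ zr)// lerDr powR_ge0.
Qed.

(** Passing from the sup norm to the Euclidean norm costs a factor d in each of the two terms; under
    the cube root, d is bounded by d^3. *)
Lemma norms_le_anorm z (s : R) : 0 <= s -> `|z.1| <= s ^+ 3 -> `|z.2| <= s ->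
  anorm z <= 2 * d%:R * s.
Proof.
move=> s0 z1 z2; have d1 : 1 <= d%:R :> R by rewrite ler1n.
have -> : 2 * d%:R * s = d%:R * s + d%:R * s by ring.
apply: lerD; last by rewrite (le_trans (enorm_le_norm _))// ler_wpM2l.
apply: cbrt_le; rewrite ?enorm_ge0 ?mulr_ge0//.
rewrite (le_trans (enorm_le_norm _))// exprMn ler_pM//.
by rewrite ler_eXnr.
Qed.

Variable chi0 : V -> R.
Hypothesis chi0_smooth : smooth chi0.
Hypothesis chi0_one : forall xi, anorm xi <= 1 -> chi0 xi = 1.
Hypothesis chi0_zero : forall xi, 4 / 3 < anorm xi -> chi0 xi = 0.
Local Notation s0 := ((2 * d%:R)^-1 : R).

Lemma s0_gt0 : 0 < s0.
Proof. by rewrite invr_gt0 mulr_gt0// ltr0n. Qed.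

Lemma chi0_zero_norm z : (4 / 3) ^+ 3 < `|z.1| \/ 4 / 3 < `|z.2| -> chi0 z = 0.
Proof.
move=> h; apply: chi0_zero; rewrite ltNge; apply/negP => /anorm_le_norms[z1 z2].
by case: h; rewrite ltNge ?z1 ?z2.
Qed.

(** [s0] is the inverse of the constant 2d of [norms_le_anorm]. *)
Lemma chi0_one_norm z : `|z.1| <= s0 ^+ 3 -> `|z.2| <= s0 -> chi0 z = 1.
Proof.
move=> z1 z2; apply: chi0_one; rewrite (le_trans (norms_le_anorm (ltW s0_gt0) z1 z2))//.
by rewrite divff// mulf_neq0// pnatr_eq0 -lt0n.
Qed.

Lemma chi0_zero_large z : 8 <= `|z| -> chi0 z = 0.
Proof.
move=> z8; apply: chi0_zero_norm; move: z8; rewrite prod_normE le_max => /orP[h|h]; [left|right];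
  by apply: lt_le_trans h; lra.
Qed.

(** A rescaled [chi0] serves: it is 1 at the origin and 0 once the norm reaches 8, since 8 exceeds
    both 4/3 and its cube. *)
Lemma bump_exists (e : R) : 0 < e ->
  exists chi, [/\ smooth chi, chi 0 = 1 & forall z, e <= `|z| -> chi z = 0].
Proof.
move=> e0; exists (fun z => chi0 (dilate (8 / e) (8 / e) z + 0)); split.
- exact: smooth_affine.
- by rewrite addr0 /dilate /= !scaler0; apply: chi0_one_norm; rewrite /= normr0 ?exprn_ge0// ltW ?s0_gt0.
- move=> z ze; apply: chi0_zero_large; rewrite addr0.
  have -> : dilate (8 / e) (8 / e) z = (8 / e) *: z by case: z {ze}.
  rewrite normrZ gtr0_norm ?divr_gt0// mulrAC ler_pdivlMr// ler_wpM2l//.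
Qed.

Lemma trig_trig_vanish th eta g a (M e : R) : smooth g ->
  (forall z, M < `|z| -> g z = 0) -> 0 < e ->
  (forall z, `|z| < e -> g (z - a) = 0 /\ g (z + a) = 0) ->
  trig eta (trig th g) a = 0.
Proof.
move=> sg gM e0 ga; have Sg := compact_support_schwartz sg gM.
have [chi [sc c0 ce]] := bump_exists e0.
have sh b : smooth (fun z => g (z + b)).
  by have := smooth_affine 1 1 b sg; under eq_fun => z do rewrite /dilate !scale1r -surjective_pairing.
have hM b z : M + `|b| < `|z| -> g (z + b) = 0.
  move=> h; apply: gM; rewrite -(ltrD2r `|b|) (lt_le_trans h)//.
  by rewrite -{1}(addrK b z) ler_normB.
rewrite trig_trig//.
rewrite (trig_int_vanishing _ e0 (sh (- a)) (hM (- a)) _ sc c0 ce); last by move=> z /ga[].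
rewrite (trig_int_vanishing _ e0 (sh a) (hM a) _ sc c0 ce); last by move=> z /ga[].
by rewrite !mulr0 addr0.
Qed.

Lemma adilE (t : R) z : adil t z = dilate (t ^+ 3) t z. Proof. by []. Qed.

Lemma smooth_dilate (b c : R) g : smooth g -> smooth (fun z => g (dilate b c z)).
Proof. by move=> sg; have := smooth_affine b c 0 sg; under eq_fun do rewrite addr0. Qed.

Lemma smooth_lp_phi j : smooth (lp_phi chi0 j).
Proof.
case: j => [|j]; first exact: chi0_smooth.
rewrite /lp_phi; have := smoothD (smooth_dilate (((2^-1) ^+ j.+1) ^+ 3) ((2^-1) ^+ j.+1) chi0_smooth)
  (smoothM (smooth_cst (-1)) (smooth_dilate (((2^-1) ^+ j) ^+ 3) ((2^-1) ^+ j) chi0_smooth)).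
by under eq_fun do rewrite mulN1r.
Qed.

Lemma norm_adil (T : R) z : 0 < T ->
  `|(adil T^-1 z).1| = `|z.1| / T ^+ 3 /\ `|(adil T^-1 z).2| = `|z.2| / T.
Proof.
move=> T0; rewrite (_ : (adil T^-1 z).1 = (T ^+ 3)^-1 *: z.1); last by rewrite -exprVn.
rewrite (_ : (adil T^-1 z).2 = T^-1 *: z.2)// !normrZ.
by rewrite !gtr0_norm ?invr_gt0 ?exprn_gt0// ![_^-1 * _]mulrC.
Qed.

Lemma chi0_adil_zero (T : R) z : 0 < T ->
  (4 / 3 * T) ^+ 3 < `|z.1| \/ 4 / 3 * T < `|z.2| -> chi0 (adil T^-1 z) = 0.
Proof.
move=> T0 h; apply: chi0_zero_norm; have [-> ->] := norm_adil z T0.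
by case: h => h; [left|right]; rewrite ltr_pdivlMr ?exprn_gt0// -exprMn.
Qed.

Lemma chi0_adil_one (T : R) z : 0 < T ->
  `|z.1| <= (s0 * T) ^+ 3 -> `|z.2| <= s0 * T -> chi0 (adil T^-1 z) = 1.
Proof.
move=> T0 z1 z2; have [n1 n2] := norm_adil z T0; apply: chi0_one_norm.
  by rewrite n1 ler_pdivrMr ?exprn_gt0// -exprMn.
by rewrite n2 ler_pdivrMr.
Qed.

Lemma lp_phi_zero_out j z : (4 / 3 * 2 ^+ j) ^+ 3 < `|z.1| \/ 4 / 3 * 2 ^+ j < `|z.2| ->
  lp_phi chi0 j z = 0.
Proof.
case: j => [|j]; first by rewrite expr0 mulr1; exact: chi0_zero_norm.
move=> h; rewrite /lp_phi !exprVn (chi0_adil_zero _ h)// (chi0_adil_zero (T := 2 ^+ j)) ?subr0//.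
have le2 : 4 / 3 * 2 ^+ j <= 4 / 3 * 2 ^+ j.+1 :> R.
  by rewrite ler_wpM2l// ler_eXn2l ?ltr1n.
case: h => h; [left|right]; apply: le_lt_trans h => //.
by rewrite lerXn2r ?nnegrE// mulr_ge0// exprn_ge0.
Qed.

Lemma lp_phi_zero_in j z : `|z.1| <= (s0 * 2 ^+ j) ^+ 3 -> `|z.2| <= s0 * 2 ^+ j ->
  lp_phi chi0 j.+1 z = 0.
Proof.
move=> z1 z2; rewrite /lp_phi !exprVn !chi0_adil_one ?subrr//.
- apply: (le_trans z1); rewrite lerXn2r ?nnegrE ?mulr_ge0 ?exprn_ge0 ?(ltW s0_gt0)//.
  by rewrite ler_wpM2l ?(ltW s0_gt0)// ler_eXn2l ?ltr1n.
- by apply: (le_trans z2); rewrite ler_wpM2l ?(ltW s0_gt0)// ler_eXn2l ?ltr1n.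
Qed.

Lemma lp_phi_support j z : (4 / 3 * 2 ^+ j) ^+ 3 + 4 / 3 * 2 ^+ j < `|z| -> lp_phi chi0 j z = 0.
Proof.
have p : 0 <= 4 / 3 * 2 ^+ j :> R by rewrite mulr_ge0// exprn_ge0.
move=> h; apply: lp_phi_zero_out; move: h; rewrite prod_normE lt_max => /orP[h|h]; [left|right].
  by apply: le_lt_trans h; rewrite lerDl.
by apply: le_lt_trans h; rewrite lerDr exprn_ge0.
Qed.

Lemma schwartz_lp_phi j : schwartz (lp_phi chi0 j).
Proof. exact: (compact_support_schwartz (smooth_lp_phi j) (@lp_phi_support j)). Qed.

Lemma lp_checkE j : lp_check chi0 j = fun z => ((2 * pi) ^+ (d + d))^-1 * trig 0 (lp_phi chi0 j) z.
Proof.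
apply/funext => z; rewrite /lp_check /ifourRe; congr (_ * int2d _).
by apply/funext => ze; rewrite addr0.
Qed.

Lemma schwartz_lp_check j : schwartz (lp_check chi0 j).
Proof. by rewrite lp_checkE; apply: schwartzZ; apply: trig_schwartz; exact: schwartz_lp_phi. Qed.

Lemma fourCE f a : fourC f a = trig 0 f a.
Proof. by congr int2d; apply/funext => z; rewrite addr0 pdotC. Qed.

Lemma fourSE f a : fourS f a = trig (- (pi / 2)) f a.
Proof.
congr int2d; apply/funext => z; rewrite pdotC; congr (_ * _).
by rewrite -[in LHS](subrK (pi / 2) (pdot _ _)) sinDpihalf.
Qed.

(** The excess of the offending component of [a] over the support box is the radius of a ball around
    0 on which both translates of [lp_phi] vanish. *)
Lemma lp_check_trig_out th j a :
  (4 / 3 * 2 ^+ j) ^+ 3 < `|a.1| \/ 4 / 3 * 2 ^+ j < `|a.2| ->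
  trig th (lp_check chi0 j) a = 0.
Proof.
move=> h; rewrite lp_checkE trigZ; last by apply: trig_schwartz; exact: schwartz_lp_phi.
have tri (x y : 'rV[R]_d) (r : R) : `|x| < `|y| - r -> r < `|x - y| /\ r < `|x + y|.
  rewrite ltrBrDr -ltrBrDl => xy; split; apply: (lt_le_trans xy).
    by rewrite distrC lerB_dist.
  by rewrite [x + y]addrC lerB_normD.
have key (e : R) : 0 < e -> (forall z, `|z| < e -> lp_phi chi0 j (z - a) = 0 /\ lp_phi chi0 j (z + a) = 0) ->
  trig th (trig 0 (lp_phi chi0 j)) a = 0.
  by move=> e0 ze; exact: (trig_trig_vanish _ _ (smooth_lp_phi j) (@lp_phi_support j) e0 ze).
case: h => h.
  rewrite (key _ (_ : 0 < `|a.1| - (4 / 3 * 2 ^+ j) ^+ 3)) ?mulr0 ?subr_gt0//.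
  move=> z; rewrite prod_normE gt_max => /andP[/tri[z1 z2] _].
  by split; apply: lp_phi_zero_out; left.
rewrite (key _ (_ : 0 < `|a.2| - 4 / 3 * 2 ^+ j)) ?mulr0 ?subr_gt0//.
move=> z; rewrite prod_normE gt_max => /andP[_ /tri[z1 z2]].
by split; apply: lp_phi_zero_out; right.
Qed.

(** In the inner box both cut-offs forming [lp_phi] equal 1 and cancel; the smaller gap to its
    boundary is the radius for [trig_trig_vanish]. *)
Lemma lp_check_trig_in th j a :
  `|a.1| < (s0 * 2 ^+ j) ^+ 3 -> `|a.2| < s0 * 2 ^+ j ->
  trig th (lp_check chi0 j.+1) a = 0.
Proof.
move=> a1 a2; rewrite lp_checkE trigZ; last by apply: trig_schwartz; exact: schwartz_lp_phi.
pose e := Num.min ((s0 * 2 ^+ j) ^+ 3 - `|a.1|) (s0 * 2 ^+ j - `|a.2|).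
have e0 : 0 < e by rewrite lt_min !subr_gt0 a1 a2.
rewrite (trig_trig_vanish _ _ (smooth_lp_phi j.+1) (@lp_phi_support j.+1) e0) ?mulr0//.
move=> z; rewrite prod_normE gt_max /e !lt_min => /andP[/andP[z1 _] /andP[_ z2]].
have tri (x y : 'rV[R]_d) (r : R) : `|x| < r - `|y| -> `|x - y| <= r /\ `|x + y| <= r.
  rewrite ltrBrDr => /ltW xy; split; apply: le_trans xy; last exact: ler_normD.
  exact: ler_normB.
have [y1 y2] := tri _ _ _ z1; have [y3 y4] := tri _ _ _ z2.
by split; apply: lp_phi_zero_in.
Qed.

(** The Jacobians of the inner and outer transforms cancel; this scale invariance is the source of
    bounds uniform in the block index. *)
Lemma trig_trig_dilate th eta g a (b c : R) : schwartz g ->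
  schwartz (fun z => g (dilate b c z)) -> 0 < b -> 0 < c ->
  trig eta (trig th (fun z => g (dilate b c z))) a = trig eta (trig th g) (dilate b c a).
Proof.
move=> sg sgd b0 c0.
have J0 : b ^+ d * c ^+ d != 0 by rewrite mulf_neq0 ?expf_neq0 ?gt_eqF.
have E : trig th (fun z => g (dilate b c z)) =
    fun z => (b ^+ d * c ^+ d)^-1 * trig th g (dilate b^-1 c^-1 z).
  by apply/funext => z; rewrite trig_dilate// mulKf.
have sF : schwartz (fun z => trig th g (dilate b^-1 c^-1 z)).
  have := schwartzZ (b ^+ d * c ^+ d) (trig_schwartz th sgd).
  by under eq_fun do rewrite -trig_dilate//.
rewrite E trigZ// -[in RHS](invrK b) -[in RHS](invrK c).
rewrite trig_dilate ?invr_gt0//; last exact: trig_schwartz.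
by rewrite !exprVn -invfM.
Qed.

Lemma lp_phi_dilate j : lp_phi chi0 j.+1 =
  fun z => lp_phi chi0 1 (dilate (((2^-1) ^+ j) ^+ 3) ((2^-1) ^+ j) z).
Proof.
have adil_comp s t z : adil s (adil t z) = adil (s * t) z.
  by rewrite /adil !scalerA exprMn.
by apply/funext => z; rewrite -adilE /lp_phi !adil_comp -exprS expr0 mul1r.
Qed.

(** Only blocks 0 and 1 have to be estimated: every later block is an anisotropic dilation of block
    1. *)
Lemma lp_check_trig_bounded th : exists C : R, forall j a, `|trig th (lp_check chi0 j) a| <= C.
Proof.
have bnd j : exists C : R, forall a, `|trig th (trig 0 (lp_phi chi0 j)) a| <= C.
  have sT := trig_schwartz 0 (schwartz_lp_phi j).
  have [C hC] := schwartz_bound ((d + d) * 2) sT.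
  by exists (C * weight_mass R ^+ (d + d)) => a; exact: trig_bound.
have [C0 h0] := bnd 0%N; have [C1 h1] := bnd 1%N.
pose c : R := ((2 * pi) ^+ (d + d))^-1.
have c0 : 0 <= c by rewrite invr_ge0 exprn_ge0// mulr_ge0// pi_ge0.
exists (c * (`|C0| + `|C1|)) => j a.
rewrite lp_checkE trigZ; last by apply: trig_schwartz; exact: schwartz_lp_phi.
rewrite normrM ger0_norm// ler_wpM2l//; case: j => [|j].
  by rewrite (le_trans (h0 a))// (le_trans (ler_norm _))// lerDl.
rewrite lp_phi_dilate trig_trig_dilate ?exprn_gt0 ?invr_gt0//.
- by rewrite (le_trans (h1 _))// (le_trans (ler_norm _))// lerDr.
- exact: schwartz_lp_phi.
- by rewrite -lp_phi_dilate; exact: schwartz_lp_phi.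
Qed.

End Blocks.

(** * Variance of block increments *)

(** The integral of a nonnegative function is a supremum over simple functions below it, so the
    comparison reaches functions whose measurability is not established, such as the spectral
    density. *)
Lemma ge0_le_integral_all dT (T : measurableType dT) (R : realType)
    (mu : {measure set T -> \bar R}) (f g : T -> \bar R) :
  (forall x, (0 <= f x)%E) -> (forall x, (f x <= g x)%E) ->
  (\int[mu]_x f x <= \int[mu]_x g x)%E.
Proof.
move=> f0 fg; have g0 x : (0 <= g x)%E by apply: le_trans (fg x).
rewrite !ge0_integralTE//; apply: le_ereal_sup => _ [h hf <-]; exists h => // x.
exact: le_trans (hf x) (fg x).
Qed.

Section Variance.
Variables (R : realType) (d : nat).
Hypothesis d_gt0 : (0 < d)%N.
Local Notation V := ('rV[R]_d * 'rV[R]_d)%type.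
Implicit Types (z u v a : V) (f g h : V -> R) (th eta p : R).
Variable chi0 : V -> R.
Hypothesis chi0_smooth : smooth chi0.
Hypothesis chi0_one : forall xi, anorm xi <= 1 -> chi0 xi = 1.
Hypothesis chi0_zero : forall xi, 4 / 3 < anorm xi -> chi0 xi = 0.

Lemma trig_transl th f a z : schwartz f ->
  trig th (transl z f) a = trig (th + pdot a z) f a.
Proof.
move=> sf; rewrite /trig -(int2d_translate z (schwartz_cosM th a (schwartz_transl z sf))).
congr int2d; apply/funext => w; by rewrite /transl addrK pdotDr -addrA [_ z + th]addrC.
Qed.

(** Translation in space only changes the phase, and by angle addition each phase is a combination
    of two fixed ones. Bounds uniform in the phase and Lipschitz in it both follow. *)
Lemma trig_phase th p f a : schwartz f ->
  trig (th + p) f a = cos p * trig th f a - sin p * trig (th - pi / 2) f a.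
Proof.
move=> sf; rewrite /trig -!int2dZ; [|exact: schwartz_cosM..].
rewrite -int2dB; [|by apply: schwartzZ; exact: schwartz_cosM..].
congr int2d; apply/funext => w.
have -> : cos (pdot a w + (th - pi / 2)) = sin (pdot a w + th).
  by rewrite addrA -[in RHS](subrK (pi / 2) (_ + th)) sinDpihalf.
have -> : cos (pdot a w + (th + p)) = cos (pdot a w + th) * cos p - sin (pdot a w + th) * sin p.
  by rewrite addrA (cosD (_ + th)).
by ring.
Qed.

Lemma cos_lipschitz (a b : R) : `|cos (a + b) - cos a| <= `|b|.
Proof.
by have := sin_lipschitz (a + pi / 2) b; rewrite addrAC !sinDpihalf.
Qed.

Lemma trig_phase_bound th p f a (K : R) : schwartz f ->
  (forall th, `|trig th f a| <= K) -> `|trig (th + p) f a| <= 2 * K.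
Proof. by move=> sf h; rewrite (le_trans (h _))// ler_peMl ?ler1n// (le_trans _ (h 0)). Qed.

Lemma trig_phase_lipschitz th p q f a (K : R) : schwartz f ->
  (forall th, `|trig th f a| <= K) ->
  `|trig (th + p) f a - trig (th + q) f a| <= 2 * K * `|p - q|.
Proof.
move=> sf h; rewrite (trig_phase th p)// (trig_phase th q)//.
set A := trig th f a; set B := trig (th - pi / 2) f a.
have -> : cos p * A - sin p * B - (cos q * A - sin q * B) =
  (cos (q + (p - q)) - cos q) * A - (sin (q + (p - q)) - sin q) * B.
  by rewrite subrKC; ring.
rewrite (le_trans (ler_normB _ _))// !normrM.
have -> : 2 * K * `|p - q| = `|p - q| * K + `|p - q| * K by ring.
by apply: lerD; apply: ler_pM => //; [exact: cos_lipschitz|exact: h|exact: sin_lipschitz|exact: h].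
Qed.

Definition spectral_density f a : R := fourC f a * fourC f a + fourS f a * fourS f a.

Lemma spectral_density_ge0 f a : 0 <= spectral_density f a.
Proof. by rewrite addr_ge0// -expr2 sqr_ge0. Qed.

Lemma spectral_density_le f a (M : R) : (forall th, `|trig th f a| <= M) ->
  spectral_density f a <= 2 * M ^+ 2.
Proof.
move=> h; rewrite /spectral_density fourCE fourSE.
have sq th : trig th f a * trig th f a <= M ^+ 2.
  rewrite -expr2 -real_normK ?num_real// lerXn2r ?nnegrE//.
  exact: le_trans (h 0).
have -> : 2 * M ^+ 2 = M ^+ 2 + M ^+ 2 by ring.
by rewrite lerD.
Qed.

(** [b = 0] gives a single translate and [b = -1] an increment, so one computation serves all
    levels. The factor 1 matches the linearity clause of [gaussian_noise]. *)
Definition block_pair j (b : R) z z' : V -> R :=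
  fun w => 1 * transl z (lp_check chi0 j) w + b * transl z' (lp_check chi0 j) w.

Lemma schwartz_block_pair j b z z' : schwartz (block_pair j b z z').
Proof.
have s u : schwartz (transl u (lp_check chi0 j)).
  by apply: schwartz_transl; exact: schwartz_lp_check.
by apply: schwartzD; exact: schwartzZ.
Qed.

Lemma trig_block_pair th j b z z' a : trig th (block_pair j b z z') a =
  trig (th + pdot a z) (lp_check chi0 j) a + b * trig (th + pdot a z') (lp_check chi0 j) a.
Proof.
have sf := schwartz_lp_check chi0_smooth chi0_zero j.
have s u : schwartz (transl u (lp_check chi0 j)) by exact: schwartz_transl.
by rewrite trig_lin// !trig_transl// mul1r.
Qed.

Lemma lp_check_trig_unif : exists2 K : R, 0 <= K &
  forall j th a, `|trig th (lp_check chi0 j) a| <= K.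
Proof.
have [C hC] := lp_check_trig_bounded chi0_smooth chi0_zero 0.
have [D hD] := lp_check_trig_bounded chi0_smooth chi0_zero (0 - pi / 2).
have C0 : 0 <= C := le_trans (normr_ge0 _) (hC 0%N 0).
have D0 : 0 <= D := le_trans (normr_ge0 _) (hD 0%N 0).
exists (C + D); first exact: addr_ge0.
move=> j th a; rewrite -[th]add0r trig_phase; last exact: schwartz_lp_check.
rewrite (le_trans (ler_normB _ _))// !normrM lerD//.
  by rewrite (le_trans _ (hC j a))// ler_piMl// ler_norml cos_geN1 cos_le1.
by rewrite (le_trans _ (hD j a))// ler_piMl// ler_norml sin_geN1 sin_le1.
Qed.

(** Block j + 1 vanishes on the inner box of size s0 2^j = (s0 / 2) 2^(j+1), whence the halved
    constant. Adding 1 to [anorm] lets block 0, which sees frequency 0, satisfy the same lower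
    bound. *)
Definition in_shell j a := [/\ `|a.1| <= (4 / 3 * 2 ^+ j) ^+ 3, `|a.2| <= 4 / 3 * 2 ^+ j &
  (2 * d%:R)^-1 / 2 * 2 ^+ j <= 1 + anorm a].

Lemma trig_shell j a : in_shell j a \/ forall th, trig th (lp_check chi0 j) a = 0.
Proof.
have [a1|a1] := leP (`|a.1|) ((4 / 3 * 2 ^+ j) ^+ 3); last first.
  by right => th; apply: lp_check_trig_out => //; left.
have [a2|a2] := leP (`|a.2|) (4 / 3 * 2 ^+ j); last first.
  by right => th; apply: lp_check_trig_out => //; right.
have s1 : (2 * d%:R)^-1 <= 1 :> R.
  by rewrite invf_le1 ?mulr_gt0 ?ltr0n// -natrM ler1n muln_gt0.
case: j a1 a2 => [|j] a1 a2.
  left; split=> //; rewrite expr0 mulr1 (@le_trans _ _ 1)//; last by rewrite lerDl anorm_ge0.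
  by rewrite ler_pdivrMr// mul1r (le_trans s1)// ler1n.
have [sh|sh] := leP ((2 * d%:R)^-1 * 2 ^+ j) (anorm a).
  left; split=> //; rewrite exprS mulrA divfK// (le_trans sh)// lerDr//.
have [b1 b2] := anorm_le_norms (lexx (anorm a)).
right => th; apply: lp_check_trig_in => //; last exact: le_lt_trans sh.
apply: (le_lt_trans b1); rewrite ltrXn2r ?anorm_ge0 //.
Qed.

(** For ell >= 0 the inner bound of the shell is used, for ell < 0 the outer one, because the power
    is then decreasing. *)
Lemma shell_weight (ell : R) : exists2 c : R, 0 < c &
  forall j a, in_shell j a -> c * (2 ^+ j) `^ ell <= (1 + anorm a) `^ ell.
Proof.
pose c1 : R := (2 * d%:R)^-1 / 2; pose c2 : R := 1 + 2 * d%:R * (4 / 3).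
have d1 : 1 <= d%:R :> R by rewrite ler1n.
have c10 : 0 < c1 by rewrite divr_gt0// invr_gt0 mulr_gt0// ltr0n.
have c20 : 0 < c2 by rewrite /c2; nra.
have p2 (j : nat) : 1 <= 2 ^+ j :> R by rewrite exprn_ege1// ler1n.
have up j a : in_shell j a -> 1 + anorm a <= c2 * 2 ^+ j.
  move=> [a1 a2 _]; have p0 : 0 <= 4 / 3 * 2 ^+ j :> R by rewrite mulr_ge0 ?exprn_ge0.
  have h := norms_le_anorm d_gt0 p0 a1 a2.
  by rewrite /c2 mulrDl mul1r lerD// (le_trans h)// !mulrA.
have pos a : 0 < 1 + anorm a by rewrite ltr_pwDl// anorm_ge0.
have q2 (j : nat) : 0 <= 2 ^+ j :> R by rewrite exprn_ge0.
have [l0|l0] := leP 0 ell.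
  exists (c1 `^ ell); first exact: powR_gt0.
  move=> j a [_ _ h]; rewrite -powRM//; last exact: ltW.
  apply: ge0_ler_powR; rewrite ?nnegrE.
  - exact: l0.
  - by apply: mulr_ge0 => //; exact: ltW.
  - exact: ltW (pos a).
  - exact: h.
exists (c2 `^ ell); first exact: powR_gt0.
move=> j a sh; rewrite -powRM//; last exact: ltW.
rewrite -(opprK ell) !(powRN _ (- ell)) lef_pV2 ?posrE; last 2 first.
- by rewrite powR_gt0// mulr_gt0// (lt_le_trans ltr01).
- by rewrite powR_gt0// (pos a).
apply: ge0_ler_powR; rewrite ?nnegrE ?oppr_ge0 ?(ltW l0)//; last exact: up.
- exact: ltW (pos a).
- by rewrite mulr_ge0// ltW.
Qed.

Lemma measurable_anorm (ell : R) : measurable_fun setT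
  (fun zt : d.-tuple R * d.-tuple R => ((1 + anorm (tup2 zt)) `^ ell)%:E).
Proof.
have me (f : d.-tuple R * d.-tuple R -> d.-tuple R) : measurable_fun setT f ->
    measurable_fun setT (fun zt => enorm (row_of_tuple (f zt))).
  move=> mf; rewrite /enorm; apply: (@measurableT_comp _ _ _ _ _ _ (@Num.sqrt R)).
    by apply: continuous_measurable_fun; exact: sqrt_continuous.
  apply: measurable_sum => i; under eq_fun do rewrite mxE.
  apply: measurable_funX; exact: (measurableT_comp (measurable_tnth i) mf).
apply/measurable_EFinP; apply: (measurableT_comp (measurable_powR ell)).
apply: measurable_funD => //; apply: measurable_funD; last exact: (me snd).
by apply: (measurableT_comp (measurable_powR _)); exact: (me fst).
Qed.

Lemma variance_bound (ell : R)
    (mup mum : {measure set (d.-tuple R * d.-tuple R)%type -> \bar R}) :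
  (\int[mup]_zt ((1 + anorm (tup2 zt)) `^ ell)%:E < +oo)%E ->
  exists2 C : R, 0 <= C & forall j z z',
    hinner mup mum (block_pair j 0 z z') (block_pair j 0 z z') <= C * (2 ^+ j) `^ (- ell) /\
    hinner mup mum (block_pair j (-1) z z') (block_pair j (-1) z z') <=
      C * (2 ^+ j) `^ (- ell) * (8 ^+ j * `|z - z'|) ^+ 2.
Proof.
move=> Ifin; have [K K0 hK] := lp_check_trig_unif.
have [c c0 hc] := shell_weight ell.
pose I := fine (\int[mup]_zt ((1 + anorm (tup2 zt)) `^ ell)%:E)%E.
have I0 : 0 <= I by apply: fine_ge0; apply: integral_ge0 => zt _; rewrite lee_fin powR_ge0.
have gen j f (M : R) : (forall a, in_shell j a -> forall th, `|trig th f a| <= M) ->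
    (forall a, (forall th, trig th (lp_check chi0 j) a = 0) -> forall th, trig th f a = 0) ->
    hinner mup mum f f <= 2 * M ^+ 2 / c * (2 ^+ j) `^ (- ell) * I.
  move=> hM h0; set k := 2 * M ^+ 2 / c * (2 ^+ j) `^ (- ell).
  have k0 : 0 <= k by rewrite mulr_ge0 ?powR_ge0// divr_ge0 ?(ltW c0)// mulr_ge0// sqr_ge0.
  have dens a : spectral_density f a <= k * (1 + anorm a) `^ ell.
    have [sh|z0] := trig_shell j a; last first.
      rewrite (@le_trans _ _ (2 * 0 ^+ 2))//.
        by apply: spectral_density_le => th; rewrite h0// normr0.
      by rewrite expr0n /= mulr0 mulr_ge0// powR_ge0.
    rewrite (le_trans (spectral_density_le (hM _ sh)))//.
    have := hc _ _ sh; have p0 : 0 < (2 ^+ j) `^ ell :> R by rewrite powR_gt0// exprn_gt0.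
    move=> h; rewrite /k powRN.
    set q := _ `^ ell in h p0 *; set W := _ `^ ell in h *.
    have -> : 2 * M ^+ 2 / c * q^-1 * W = 2 * M ^+ 2 * (W / (c * q)).
      by rewrite invfM; ring.
    apply: ler_peMr; first by rewrite mulr_ge0 ?sqr_ge0.
    by rewrite ler_pdivlMr ?mul1r// mulr_gt0.
  rewrite /hinner /mu_integral lerBlDr -[leLHS]addr0 lerD//; last first.
    by apply: fine_ge0; apply: integral_ge0 => zt _; rewrite lee_fin spectral_density_ge0.
  have le1 : (\int[mup]_zt (spectral_density f (tup2 zt))%:E <=
     k%:E * \int[mup]_zt ((1 + anorm (tup2 zt)) `^ ell)%:E)%E.
    rewrite -ge0_integralZl//; [|exact: measurable_anorm|by move=> zt _; rewrite lee_fin powR_ge0].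
    by apply: ge0_le_integral_all => zt; rewrite -?EFinM lee_fin ?spectral_density_ge0// dens.
  have Ifn : (\int[mup]_zt ((1 + anorm (tup2 zt)) `^ ell)%:E)%E \is a fin_num.
    by rewrite ge0_fin_numE// integral_ge0// => zt _; rewrite lee_fin powR_ge0.
  rewrite -lee_fin fineK; last first.
    rewrite ge0_fin_numE; last by apply: integral_ge0 => zt _; rewrite lee_fin spectral_density_ge0.
    by rewrite (le_lt_trans le1)// -(fineK Ifn) -EFinM ltry.
  by rewrite EFinM /I fineK.
(* [gen] with M = 2 K gives 2 M^2 = 8 K^2. An increment multiplies M by 16 d 8^j |z - z'|, where 16
   d = 8 (d + d). [C] covers both cases. *)
pose C := 8 * K ^+ 2 / c * I * (1 + (16 * d%:R) ^+ 2).
exists C.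
  by rewrite !mulr_ge0// ?sqr_ge0 ?invr_ge0 ?(ltW c0)// addr_ge0// sqr_ge0.
move=> j z z'.
have q0 : 0 <= (2 ^+ j) `^ (- ell) :> R by rewrite powR_ge0.
have B0 : 0 <= 8 * K ^+ 2 / c * I by rewrite !mulr_ge0// ?sqr_ge0 ?invr_ge0 ?(ltW c0).
split.
  rewrite (le_trans (gen j _ (2 * K) _ _))//.
  - move=> a _ th; rewrite trig_block_pair mul0r addr0.
    by apply: trig_phase_bound => //; exact: schwartz_lp_check.
  - by move=> a a0 th; rewrite trig_block_pair !a0 mulr0 addr0.
  - have -> : 2 * (2 * K) ^+ 2 / c * (2 ^+ j) `^ (- ell) * I =
      (8 * K ^+ 2 / c * I) * (2 ^+ j) `^ (- ell) by ring.
    by rewrite /C ler_wpM2r// ler_peMr// lerDl sqr_ge0.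
rewrite (le_trans (gen j _ (2 * K * ((d + d)%:R * `|z - z'| * (8 * 8 ^+ j))) _ _))//.
- move=> a [a1 a2 _] th; rewrite trig_block_pair mulN1r.
  have sf := schwartz_lp_check chi0_smooth chi0_zero j.
  apply: (le_trans (trig_phase_lipschitz th (pdot a z) (pdot a z') sf (fun t => hK j t a))).
  rewrite ler_wpM2l ?mulr_ge0// -pdotBr (le_trans (pdot_le _ _))//.
  rewrite mulrAC ler_wpM2l ?mulr_ge0//.
  have t1 : 1 <= 4 / 3 * 2 ^+ j :> R.
    have : 1 <= 2 ^+ j :> R by rewrite exprn_ege1// ler1n.
    by lra.
  (* The first component of a shell frequency scales like (2^j)^3 = 8^j and dominates the second;
     (4/3)^3 is rounded up to 8. *)
  have e8 : (4 / 3 * 2 ^+ j) ^+ 3 <= 8 * 8 ^+ j :> R.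
    rewrite exprMn -exprM mulnC exprM (_ : 2 ^+ 3 = 8 :> R); last by ring.
    by rewrite ler_wpM2r ?exprn_ge0//; lra.
  rewrite prod_normE ge_max (le_trans a1)//= (le_trans a2)// (le_trans _ e8)//.
  by rewrite ler_eXnr.
- by move=> a a0 th; rewrite trig_block_pair !a0 mulr0 addr0.
- have -> : 2 * (2 * K * ((d + d)%:R * `|z - z'| * (8 * 8 ^+ j))) ^+ 2 / c * (2 ^+ j) `^ (- ell) * I =
    8 * K ^+ 2 / c * I * ((16 * d%:R) ^+ 2) * (2 ^+ j) `^ (- ell) * (8 ^+ j * `|z - z'|) ^+ 2.
    by rewrite natrD; ring.
  by rewrite ler_wpM2r ?sqr_ge0// /C ler_wpM2r// ler_wpM2l// lerDr.
Qed.

End Variance.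

(** * Gaussian moments *)

Section Gaussian.
Variable R : realType.
Local Notation mu := (@lebesgue_measure R).

(** On simple functions the two integrals agree; a supremum over simple functions below [f] then
    gives the inequality for an arbitrary nonnegative [f]. *)
Lemma le_integral_density (nu : {measure set (measurableTypeR R) -> \bar R}) (p f : R -> R) :
  (forall x, 0 <= p x) -> measurable_fun setT p ->
  (forall A, measurable A -> nu A = (\int[mu]_(x in A) (p x)%:E)%E) ->
  (forall x, 0 <= f x) ->
  (\int[nu]_x (f x)%:E <= \int[mu]_x (f x * p x)%:E)%E.
Proof.
move=> p0 mp nuE f0; rewrite [leLHS]ge0_integralTE//.
apply: ge_ereal_sup => _ [h hf <-].
have -> : sintegral nu h = (\int[mu]_x (h x * p x)%:E)%E.
  rewrite sintegralE.
  transitivity (\sum_(r \in range h) \int[mu]_x (r * \1_(h @^-1` [set r]) x * p x)%:E)%E.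
    apply: eq_fsbigr => r _; have [r0|r0] := ltP r 0.
      rewrite preimage_nnfun0// measure0 mule0 integral0_eq// => x _.
      by rewrite indic0 mulr0 mul0r.
    rewrite nuE// integral_mkcond -ge0_integralZl//.
    - apply: eq_integral => x _; rewrite epatch_indic /= -!EFinM; congr EFin.
      by rewrite -mulrA [p x * _]mulrC.
    - apply: (measurable_restrictT _ _).1 => //.
      by apply/measurable_EFinP/measurable_funTS.
    - by move=> x _; rewrite patchE; case: ifPn => // _; rewrite lee_fin.
  rewrite -ge0_integral_fsum//.
  - apply: eq_integral => x _; rewrite fsumEFin// -mulr_fsuml -fimfunE//.
  - move=> r; apply/measurable_EFinP/measurable_funM => //.
    by apply: measurable_funM => //; exact: measurable_indic.
  - move=> r x _; rewrite EFinM mule_ge0 ?lee_fin//; exact: nnfun_muleindic_ge0.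
apply: ge0_le_integral_all => x; rewrite lee_fin ?mulr_ge0//.
by rewrite ler_wpM2r// -lee_fin.
Qed.

(** Write e^u as the m-th power of e^(u/m), and use e^t >= t. *)
Lemma expR_power_bound (m : nat) (u : R) : (0 < m)%N -> 0 <= u ->
  u ^+ m <= m%:R ^+ m * expR u.
Proof.
move=> m0 u0; have mp : 0 < m%:R :> R by rewrite ltr0n.
have -> : expR u = expR (u / m%:R) ^+ m.
  by rewrite -expRM_natl mulrCA divff ?mulr1// gt_eqF.
rewrite -exprMn lerXn2r ?nnegrE ?mulr_ge0 ?expR_ge0 ?(ltW mp)//.
rewrite [leRHS]mulrC -ler_pdivrMr//; apply: (le_trans _ (expR_ge1Dx _)).
by rewrite lerDr.
Qed.

(** Half of the Gaussian exponent absorbs the power of x; the other half is, up to the factor sqrt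
    2, the density of standard deviation sqrt 2 s, whose integral is 1. *)
Lemma normal_moment (m : nat) (s : R) : (0 < m)%N -> 0 < s ->
  (\int[mu]_x (x ^+ (m * 2) * normal_pdf 0 s x)%:E <=
   (m%:R ^+ m * 4 ^+ m * Num.sqrt 2 * (s ^+ 2) ^+ m)%:E)%E.
Proof.
move=> m0 s0; set K := m%:R ^+ m * 4 ^+ m * Num.sqrt 2 * (s ^+ 2) ^+ m.
have r2 : 0 < Num.sqrt 2 :> R by rewrite sqrtr_gt0.
have K0 : 0 <= K.
  by rewrite /K; apply: mulr_ge0; [rewrite mulr_ge0 ?sqrtr_ge0// mulr_ge0 ?exprn_ge0|rewrite exprn_ge0 ?sqr_ge0].
have t0 : 0 < Num.sqrt 2 * s by rewrite mulr_gt0.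
have s2 : 0 < s ^+ 2 by rewrite exprn_gt0.
rewrite -[leRHS]mule1 -(integral_normal_pdf 0 (Num.sqrt 2 * s)) -ge0_integralZl//; last 2 first.
- by apply/measurable_EFinP; exact: measurable_normal_pdf.
- by move=> x _; rewrite lee_fin normal_pdf_ge0.
apply: ge0_le_integral_all => x.
  by rewrite lee_fin mulr_ge0 ?normal_pdf_ge0// mulnC exprM exprn_ge0 ?sqr_ge0.
rewrite -EFinM lee_fin !normal_pdfE ?gt_eqF// /normal_peak /normal_fun !subr0.
have q2 : (Num.sqrt 2 * s) ^+ 2 = 2 * s ^+ 2 by rewrite exprMn sqr_sqrtr.
rewrite q2.
have -> : Num.sqrt (2 * s ^+ 2 * pi *+ 2) = Num.sqrt 2 * Num.sqrt (s ^+ 2 * pi *+ 2) :> R.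
  have aux (a p : R) : 2 * a * p *+ 2 = 2 * (a * p *+ 2) by ring.
  by rewrite -sqrtrM// aux.
have -> : K * ((Num.sqrt 2 * Num.sqrt (s ^+ 2 * pi *+ 2))^-1 * expR (- x ^+ 2 / (2 * s ^+ 2 *+ 2))) =
  (Num.sqrt (s ^+ 2 * pi *+ 2))^-1 * ((s ^+ 2 *+ 4) ^+ m * (m%:R ^+ m * expR (- x ^+ 2 / (s ^+ 2 *+ 4)))).
  have -> : 2 * s ^+ 2 *+ 2 = s ^+ 2 *+ 4 by rewrite -mulrnAr -[_ *+ 2]mulr_natr -[_ *+ 4]mulr_natr; ring.
  have aux (q f a b e A : R) : q != 0 -> e * b * q * A * (q^-1 * f * a) = f * (A * b * (e * a)).
    by move=> q0; rewrite -[RHS]mul1r -(divff q0); ring.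
  by rewrite invfM /K -[s ^+ 2 *+ 4]mulr_natr [(s ^+ 2 * 4) ^+ m]exprMn aux ?gt_eqF.
rewrite mulrCA ler_wpM2l ?invr_ge0 ?sqrtr_ge0//.
(* In terms of [u] the exponent is -2u: one factor e^-u beats u^m, the other is the wider
   density. *)
set u := x ^+ 2 / (s ^+ 2 *+ 4).
have p4 : 0 < s ^+ 2 *+ 4 by rewrite pmulrn_lgt0.
have u0 : 0 <= u by rewrite divr_ge0 ?sqr_ge0// ltW.
have -> : - x ^+ 2 / (s ^+ 2 *+ 2) = - u - u.
  by rewrite /u -[s ^+ 2 *+ 2]mulr_natr -[s ^+ 2 *+ 4]mulr_natr; field; rewrite gt_eqF.
have -> : x ^+ (m * 2) = (s ^+ 2 *+ 4) ^+ m * u ^+ m.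
  by rewrite -exprMn /u mulrC divfK ?gt_eqF// mulnC exprM.
rewrite -mulrA ler_wpM2l ?exprn_ge0 ?(ltW p4)//.
have -> : - x ^+ 2 / (s ^+ 2 *+ 4) = - u by rewrite mulNr.
rewrite expRD mulrA ler_wpM2r ?expR_ge0// expRN ler_pdivrMr ?expR_gt0//.
exact: expR_power_bound.
Qed.

Lemma gaussian_moment dT (T : measurableType dT) (P : probability T R) (X : T -> R)
    (v : R) (m : nat) : (0 < m)%N -> 0 <= v -> centered_gaussian P X v ->
  (\int[P]_w (X w ^+ (m * 2))%:E <= (m%:R ^+ m * 4 ^+ m * Num.sqrt 2 * v ^+ m)%:E)%E.
Proof.
move=> m0 v0 [mX lawX].
have mpow : measurable_fun setT (fun x : R => (x ^+ (m * 2))%:E).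
  by apply/measurable_EFinP; exact: measurable_funX.
have pow0 (x : R) : 0 <= x ^+ (m * 2) by rewrite mulnC exprM exprn_ge0 ?sqr_ge0.
pose X' : T -> measurableTypeR R := X.
have mX' : measurable_fun setT X' by exact: mX.
have mpow' : measurable_fun setT (fun x : measurableTypeR R => (x ^+ (m * 2))%:E) by exact: mpow.
pose nu : {measure set (measurableTypeR R) -> \bar R} :=
  measure_function_pushforward__canonical__measure_function_Measure P mX'.
have pushE : (\int[P]_w (X w ^+ (m * 2))%:E = \int[nu]_x (x ^+ (m * 2))%:E)%E.
  by rewrite (ge0_integral_pushforward mX')// => x _; rewrite lee_fin.
(* In the degenerate case the law is the Dirac mass at 0, and the moment vanishes because m > 0. *)
rewrite pushE; have [v00|vn0] := eqVneq v 0.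
  rewrite (eq_measure_integral (\d_(0 : measurableTypeR R))) => [|A mA _]; last first.
    by have := lawX A mA; rewrite v00 eqxx; exact.
  rewrite integral_dirac// v00 expr0n muln_eq0 /= (gtn_eqF m0) expr0n (gtn_eqF m0) /=.
  by rewrite mulr0 diracT mul1e.
have s0 : 0 < Num.sqrt v by rewrite sqrtr_gt0 lt_neqAle eq_sym vn0.
apply: (le_trans (le_integral_density (nu := nu) (p := normal_pdf 0 (Num.sqrt v)) _ _ _ _)).
- by move=> x; exact: normal_pdf_ge0.
- exact: measurable_normal_pdf.
- by move=> A mA; have := lawX A mA; rewrite (negbTE vn0); exact.
- exact: pow0.
- by have := normal_moment m0 s0; rewrite sqr_sqrtr.
Qed.

End Gaussian.

(** * Dyadic grids *)

Section Grid.
Variables (R : realType) (d : nat).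
Local Notation V := ('rV[R]_d * 'rV[R]_d)%type.
Local Notation N := (d + d)%N.
Implicit Types (z : V) (a : 'rV[int]_(d + d)) (s : R).

Definition gridpt s a : V :=
  vec d (fun k => s * (if insub k is Some i then (a ord0 i)%:~R else 0)).

Lemma crd_gridpt s a (i : 'I_(d + d)) : crd (gridpt s a) i = s * (a ord0 i)%:~R.
Proof. by rewrite /gridpt crd_vec// valK. Qed.

Definition parent a : 'rV[int]_(d + d) := \row_i (a ord0 i %/ 4)%Z.

Definition cell s z : 'rV[int]_(d + d) := \row_i Num.floor (crd z i / s).

Lemma divz4_spec (m : int) : exists (r : int),
  [/\ m%:~R = (m %/ 4)%Z%:~R * 4 + r%:~R :> R, 0 <= r%:~R :> R & r%:~R <= 3 :> R].
Proof.
have E := divz_eq m 4; have r0 : (0 <= m %% 4)%Z by rewrite modz_ge0.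
have r4 : ((m %% 4)%Z <= 3)%R by rewrite -ltzD1 ltz_pmod.
move: (m %% 4)%Z E r0 r4 => r E r0 r4; exists r; split.
- by rewrite {1}E intrD intrM.
- by rewrite ler0z.
- by rewrite (_ : 3 = 3%:~R :> R)// ler_int.
Qed.

(** Integer division rounds down for negative integers too, so cells of ratio 4 nest exactly: the
    parent of the fine cell of a point is its coarse cell. *)
Lemma floor_div4 (x : R) : Num.floor x = (Num.floor (4 * x) %/ 4)%Z.
Proof.
set m := Num.floor (4 * x); apply: Num.Theory.floor_def.
have /andP[m1 m2] := Num.Theory.floor_itv (4 * x); rewrite -/m in m1 m2.
have [r [E r0 r3]] := divz4_spec m.
rewrite intrD in m2 *; rewrite E in m1 m2; apply/andP; split; lra.
Qed.

Lemma parent_cell s z : 0 < s -> parent (cell (s / 4) z) = cell s z.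
Proof.
move=> s0; apply/rowP => i; rewrite !mxE [RHS]floor_div4.
by congr (Num.floor _ %/ _)%Z; field; rewrite gt_eqF.
Qed.

Lemma norm_sub_cell s z : 0 < s -> `|z - gridpt s (cell s z)| <= s.
Proof.
move=> s0; apply: norm_le_crd => [|k kN]; first exact: ltW.
have -> : k = Ordinal kN by [].
rewrite /crd pdotBl -![pdot _ _]/(crd _ _) crd_gridpt mxE.
have /andP[m1 m2] := Num.Theory.floor_itv (crd z (Ordinal kN) / s).
rewrite intrD in m2; set x := crd z _ in m1 m2 *; set m := (Num.floor _)%:~R in m1 m2 *.
have xs : x = s * (x / s) by rewrite mulrC divfK// gt_eqF.
rewrite {1}xs -mulrBr normrM gtr0_norm// ler_piMr// ?(ltW s0)// ger0_norm ?subr_ge0//.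
by rewrite lerBlDl ltW.
Qed.

Lemma norm_sub_parent s a : 0 <= s -> `|gridpt s a - gridpt (s * 4) (parent a)| <= s * 4.
Proof.
move=> s0; apply: norm_le_crd => [|k kN]; first by rewrite mulr_ge0.
have -> : k = Ordinal kN by [].
rewrite /crd pdotBl -![pdot _ _]/(crd _ _) !crd_gridpt mxE.
have [r [E r0 r3]] := divz4_spec (a ord0 (Ordinal kN)).
rewrite {1}E -mulrA -mulrBr normrM ger0_norm// ler_wpM2l//.
by rewrite [4 * _]mulrC [_ + r%:~R]addrC addrK ger0_norm// (le_trans r3)// ler_nat.
Qed.

Definition sup_int a : nat := \max_i `|a ord0 i|%N.

(** The grid point has norm at least s times its index radius and lies within s <= 1 of [z]. A
    weight at [z] can thus be traded for one depending on the index alone. *)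
Lemma grid_norm_le s z : 0 < s -> s <= 1 ->
  1 + s * (sup_int (cell s z))%:R <= 2 * (1 + `|z|).
Proof.
move=> s0 s1; set a := cell s z.
have le1 : s * (sup_int a)%:R <= `|gridpt s a|.
  have [N0|N0] := posnP (d + d).
    rewrite /sup_int big1 ?mulr0//; by case=> i iN; exfalso; rewrite N0 in iN.
  have [i ->] : exists i, sup_int a = `|a ord0 i|%N.
    have [|i ei] := @bigop.eq_bigmax _ (fun i => `|a ord0 i|%N); first by rewrite card_ord.
    by exists i.
  rewrite (le_trans _ (crd_le _ (ltn_ord i)))// crd_gridpt normrM gtr0_norm//.
  by rewrite natr_absz intr_norm.
have le2 := norm_sub_cell z s0.
have : `|gridpt s a| <= `|z| + `|z - gridpt s a|.
  by rewrite -{1}[gridpt s a](subKr z) ler_normB.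
by have := normr_ge0 z; lra.
Qed.

(** Finite functions enumerate the lattice box of radius r, so a sum over the lattice becomes a
    series in r of finite sums. Boxes overlap, which is harmless for upper bounds. *)
Definition box_pt (r : nat) (b : {ffun 'I_(d + d) -> 'I_(r.*2.+1)}) : 'rV[int]_(d + d) :=
  \row_i ((b i)%:Z - r%:Z).

Lemma box_pt_surj a : exists b : {ffun 'I_(d + d) -> 'I_((sup_int a).*2.+1)}, box_pt b = a.
Proof.
exists ([ffun i => inord (absz (a ord0 i + sup_int a)%R)] : {ffun 'I_(d + d) -> 'I_((sup_int a).*2.+1)}).
apply/rowP => i; rewrite !mxE ffunE inordK; last first.
  have := @bigop.leq_bigmax _ (fun i => `|a ord0 i|%N) i; rewrite -/(sup_int a).
  by move: (sup_int a) (a ord0 i); lia.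
have := @bigop.leq_bigmax _ (fun i => `|a ord0 i|%N) i; rewrite -/(sup_int a).
by move: (sup_int a) (a ord0 i); lia.
Qed.

Lemma card_box (r : nat) : #|{: {ffun 'I_(d + d) -> 'I_(r.*2.+1)}}| = (r.*2.+1 ^ (d + d))%N.
Proof. by rewrite card_ffun !card_ord. Qed.

Lemma powR_decr (x y c : R) : 0 < x -> x <= y -> 0 <= c -> y `^ (- c) <= x `^ (- c).
Proof.
move=> x0 xy c0; have y0 := lt_le_trans x0 xy.
rewrite !powRN lef_pV2 ?posrE ?powR_gt0//.
by apply: ge0_ler_powR; rewrite ?nnegrE// ltW.
Qed.

(** The base B of [rho] satisfies B^3 >= 1 + |x|^2 and B >= 1 + |v|^2, hence (1 + |z|)^2 <= 2 B^3.
    The cube coming from the x direction turns kappa into kappa/3. *)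
Lemma rho_decay (kappa : R) : 0 <= kappa ->
  exists2 C : R, 0 <= C & forall z, rho kappa z <= C * (1 + `|z|) `^ (- (kappa / 3)).
Proof.
move=> k0; exists (2^-1 `^ (- (kappa / 6))); first exact: powR_ge0.
move=> z; rewrite /rho; set A := (1 + _) `^ (3^-1); set B := A + 1 + _.
have A0 : 0 <= A by rewrite powR_ge0.
have A3 : A ^+ 3 = 1 + enorm z.1 ^+ 2 by rewrite cbrtK// addr_ge0 ?sqr_ge0.
have B1 : 1 <= B by rewrite /B -addrA addrCA lerDl addr_ge0 ?sqr_ge0.
have B0 : 0 < B := lt_le_trans ltr01 B1.
have BA : A <= B by rewrite /B -addrA lerDl addr_ge0 ?sqr_ge0.
have B3 : (1 + `|z|) ^+ 2 <= 2 * B ^+ 3.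
  have h (t : R) : 1 + t ^+ 2 <= B ^+ 3 -> (1 + t) ^+ 2 <= 2 * B ^+ 3.
    by have := sqr_ge0 (1 - t); nra.
  rewrite prod_normE; case: (leP `|z.1| `|z.2|) => _; apply: h.
    rewrite (@le_trans _ _ B)//; last by rewrite ler_eXnr.
    rewrite (@le_trans _ _ (1 + enorm z.2 ^+ 2))//.
      by rewrite lerD2l lerXn2r ?nnegrE ?enorm_ge0 ?norm_le_enorm.
    by rewrite /B -addrA lerDr.
  rewrite (@le_trans _ _ (A ^+ 3))//; last by rewrite lerXn2r ?nnegrE// ltW.
  by rewrite A3 lerD2l lerXn2r ?nnegrE ?enorm_ge0 ?norm_le_enorm.
have k6 : 0 <= kappa / 6 by rewrite divr_ge0.
have p0 : 0 < 1 + `|z| by rewrite ltr_pwDl.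
have -> : B `^ (- (kappa / 2)) = (B ^+ 3) `^ (- (kappa / 6)).
  rewrite -powR_mulrn ?(ltW B0)// -powRrM; by congr (_ `^ _); field.
have -> : (1 + `|z|) `^ (- (kappa / 3)) = ((1 + `|z|) ^+ 2) `^ (- (kappa / 6)).
  rewrite -powR_mulrn ?(ltW p0)// -powRrM; by congr (_ `^ _); field.
rewrite -powRM ?invr_ge0 ?sqr_ge0//; apply: powR_decr => //.
by rewrite ler_pdivrMl.
Qed.

Lemma nneseries_le_bound (u : nat -> \bar R) (B : \bar R) :
  (forall i, 0 <= u i)%E -> (forall n, \sum_(0 <= i < n) u i <= B)%E ->
  (\sum_(i <oo) u i <= B)%E.
Proof.
move=> u0 h; apply: lime_le; first by apply: is_cvg_nneseries => n _ _.
by apply: nearW => n; exact: h.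
Qed.

Lemma geometric_partial (n : nat) : \sum_(0 <= i < n) 2^-1 ^+ i <= 2 :> R.
Proof.
have -> : \sum_(0 <= i < n) 2^-1 ^+ i = 2 - 2 * 2^-1 ^+ n :> R.
  elim: n => [|n IH]; first by rewrite big_nil expr0 mulr1 subrr.
  by rewrite big_nat_recr//= IH exprS; field.
by rewrite lerBlDr lerDl mulr_ge0// exprn_ge0.
Qed.

Lemma inv_sqr_partial (n : nat) : \sum_(0 <= i < n) ((1 + i%:R) ^+ 2)^-1 <= 2 :> R.
Proof.
case: n => [|n]; first by rewrite big_nil.
(* Strengthened by the telescoping term 1/(n+1) so that the induction closes. *)
suff : \sum_(0 <= i < n.+1) ((1 + i%:R) ^+ 2)^-1 <= 2 - (n.+1%:R)^-1 :> R.
  by move=> /le_trans; apply; rewrite lerBlDr lerDl invr_ge0.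
elim: n => [|n IH]; first by rewrite big_nat1 addr0 expr1n !invr1; lra.
rewrite big_nat_recr//=; apply: (le_trans (lerD IH (lexx _))).
have n0 : 0 <= n%:R :> R by [].
rewrite -[n.+2%:R]natr1 -[n.+1%:R]natr1.
set x := n%:R in n0 *.
have x1 : 0 < x + 1 by lra.
have x2 : 0 < x + 1 + 1 by lra.
rewrite -subr_ge0.
have -> : 2 - (x + 1 + 1)^-1 - (2 - (x + 1)^-1 + ((1 + (x + 1)) ^+ 2)^-1) =
  ((x + 1) * (x + 1 + 1) ^+ 2)^-1.
  by field; rewrite !gt_eqF//; lra.
by rewrite invr_ge0 mulr_ge0 ?exprn_ge0// ltW.
Qed.

End Grid.

(** * Series of integrals *)

Section Series.
Context dT (T : measurableType dT) (R : realType) (mu : {measure set T -> \bar R}).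

Lemma integral_nneseries_le (f : nat -> T -> \bar R) (c : nat -> R) (B : R) :
  (forall i, measurable_fun setT (f i)) -> (forall i x, 0 <= f i x)%E ->
  (forall i, \int[mu]_x f i x <= (c i)%:E)%E ->
  (forall n, \sum_(0 <= i < n) c i <= B) ->
  (\int[mu]_x (\sum_(i <oo) f i x) <= B%:E)%E.
Proof.
move=> mf f0 fc cB; rewrite integral_nneseries//.
apply: nneseries_le_bound => [i|n]; first by apply: integral_ge0 => x _.
rewrite (@le_trans _ _ (\sum_(0 <= i < n) (c i)%:E)%E)//.
  by apply: lee_sum => i _.
by rewrite sumEFin lee_fin.
Qed.

Lemma le_nneseries_term (u : nat -> \bar R) (k : nat) : (forall i, 0 <= u i)%E ->
  (u k <= \sum_(i <oo) u i)%E.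
Proof.
move=> u0; rewrite (le_trans _ (nneseries_lim_ge k.+1 _))//.
by rewrite big_nat_recr//= leeDr// sume_ge0.
Qed.

(** Adding +oo to [h] on the exceptional null set gives a measurable majorant valid everywhere, with
    the same integral. *)
Lemma integral_le_of_ae_le (P : probability T R) (f h : T -> \bar R) :
  (forall x, 0 <= f x)%E -> measurable_fun setT h -> (forall x, 0 <= h x)%E ->
  {ae P, forall x, (f x <= h x)%E} -> (\int[P]_x f x <= \int[P]_x h x)%E.
Proof.
move=> f0 mh h0 [N [mN N0 sN]].
pose h' x := (((cst +oo%E : T -> \bar R) \_ N) x + h x)%E.
have c0 x : (0 <= ((cst +oo%E : T -> \bar R) \_ N) x)%E.
  by apply: erestrict_ge0 => // y _; exact: leey.
have mh' : measurable_fun setT h'.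
  apply: emeasurable_funD => //; apply: (measurable_restrictT _ _).1 => //.
have h'0 x : (0 <= h' x)%E by rewrite adde_ge0.
apply: (@le_trans _ _ (\int[P]_x h' x)%E).
  apply: ge0_le_integral_all => // x; have [xN|xN] := pselect (N x).
    by rewrite /h' patchE mem_set// addye ?leey// gt_eqF// (lt_le_trans _ (h0 x))// ltNy0.
  rewrite (@le_trans _ _ (h x))//; last by rewrite leeDr.
  by apply: contrapT => fh; apply: xN; exact: sN.
rewrite (ge0_ae_eq_integral _ mh' mh)//.
exists N; split=> // x /= xn; apply: contrapT => xN; apply: xn => _.
by rewrite /h' patchE memNset//= add0e.
Qed.

End Series.

(** * Exponent bookkeeping for the chaining sum *)

Section Numeric.
Variable R : realType.

(** Since s <= 1, 1 + s r >= s (1 + r), so M powers in r cost s^-M = 8^(jM) 4^(nM) ([e3]). The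
    regularity gap gives 2^-j 8^(-jM) ([e1]), and 4^(nm) 16^(-nm) = 4^(-nm) with M < m gives 2^-n
    4^(-nM) ([e2]). *)
Lemma weighted_moment_le (beta ell kappa s : R) (j n r m M : nat) :
  s = 8^-1 ^+ j * 4^-1 ^+ n ->
  (M < m)%N -> 3 * M%:R + 1 <= (m * 2)%:R * (ell / 2 - beta) ->
  M%:R <= (m * 2)%:R * (kappa / 3) ->
  (2 `^ (j%:R * beta) * 2 ^+ n * (1 + s * r%:R) `^ (- (kappa / 3))) ^+ (m * 2) *
    ((2 ^+ j) `^ (- ell) * 16^-1 ^+ n) ^+ m <=
  2^-1 ^+ j * 2^-1 ^+ n * ((1 + r%:R) ^+ M)^-1.
Proof.
move=> sE Mm Hd Hk.
have s0 : 0 < s by rewrite sE mulr_gt0 ?exprn_gt0.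
have s1 : s <= 1.
  by rewrite sE mulr_ile1 ?exprn_ge0// exprn_ile1//; lra.
have r0 : 0 <= r%:R :> R by [].
have b1 : 1 <= 1 + s * r%:R by rewrite lerDl mulr_ge0// ltW.
have pX (x y : R) (q : nat) : 0 <= x -> (x `^ y) ^+ q = x `^ (q%:R * y).
  by move=> x0; rewrite -powR_mulrn ?powR_ge0// -powRrM mulrC.
rewrite !exprMn !pX//; last exact: le_trans b1.
have e1 : 2 `^ ((m * 2)%:R * (j%:R * beta)) * (2 ^+ j) `^ (m%:R * - ell) <=
    2^-1 ^+ j * 8^-1 ^+ j ^+ M :> R.
  rewrite -powR_mulrn// -powRrM -powRD; last by apply/implyP.
  have -> : 2^-1 ^+ j * 8^-1 ^+ j ^+ M = 2 `^ (- (j%:R * (3 * M%:R + 1))) :> R.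
    rewrite (_ : j%:R * (3 * M%:R + 1) = (j * (3 * M + 1))%:R); last by rewrite natrM natrD natrM.
    rewrite powRN powR_mulrn// -exprM (_ : 8 = 2 ^+ 3 :> R); last by ring.
    by rewrite -!exprVn -exprM -exprD; congr (_ ^+ _); lia.
  rewrite ler_powR ?ler1n//.
  have -> : (m * 2)%:R * (j%:R * beta) + j%:R * (m%:R * - ell) =
     - (j%:R * ((m * 2)%:R * (ell / 2 - beta))) :> R by rewrite natrM; field.
  by rewrite lerN2 ler_wpM2l.
have e2 : 2 ^+ n ^+ (m * 2) * 16^-1 ^+ n ^+ m <= 2^-1 ^+ n * 4^-1 ^+ n ^+ M :> R.
  have -> : 2 ^+ n ^+ (m * 2) * 16^-1 ^+ n ^+ m = 4^-1 ^+ n ^+ m :> R.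
    rewrite mulnC exprM -exprMn; congr (_ ^+ m).
    by rewrite -exprM mulnC exprM -exprMn; congr (_ ^+ n); lra.
  have q0 : 0 < 4^-1 ^+ n :> R by rewrite exprn_gt0.
  have q1 : 4^-1 ^+ n <= 1 :> R by rewrite exprn_ile1//; lra.
  rewrite -(subnK Mm) addnS exprS exprD mulrCA.
  apply: (@le_trans _ _ (1 * (4^-1 ^+ n * 4^-1 ^+ n ^+ M))).
    by rewrite ler_wpM2r ?mulr_ge0 ?exprn_ge0 ?(ltW q0)// exprn_ile1// ltW.
  rewrite mul1r ler_wpM2r ?exprn_ge0 ?(ltW q0)// lerXn2r ?nnegrE//; lra.
have e3 : (1 + s * r%:R) `^ ((m * 2)%:R * - (kappa / 3)) <=
    (8^-1 ^+ j ^+ M)^-1 * (4^-1 ^+ n ^+ M)^-1 * ((1 + r%:R) ^+ M)^-1.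
  rewrite (@le_trans _ _ ((1 + s * r%:R) `^ (- M%:R)))//.
    by rewrite ler_powR// mulrN lerN2.
  have p0 : 0 < s * (1 + r%:R) by rewrite mulr_gt0// ltr_pwDl.
  rewrite powRN powR_mulrn ?(le_trans ler01 b1)// -!invfM -!exprMn -sE.
  rewrite lef_pV2 ?posrE ?exprn_gt0 ?(lt_le_trans ltr01 b1)//.
  rewrite lerXn2r ?nnegrE ?(ltW p0) ?(le_trans ler01 b1)//.
  by rewrite mulrDr mulr1 lerD2r.
move: e1 e2 e3.
have J0 : 0 < 8^-1 ^+ j ^+ M :> R by rewrite !exprn_gt0.
have Q0 : 0 < 4^-1 ^+ n ^+ M :> R by rewrite !exprn_gt0.
move: (8^-1 ^+ j ^+ M) (4^-1 ^+ n ^+ M) J0 Q0 (2^-1 ^+ j) (2^-1 ^+ n) ((1 + r%:R) ^+ M)^-1.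
have := powR_ge0 2 ((m * 2)%:R * (j%:R * beta)).
have := powR_ge0 (2 ^+ j) (m%:R * - ell).
have := powR_ge0 (1 + s * r%:R) ((m * 2)%:R * - (kappa / 3)).
have : 0 <= 2 ^+ n ^+ (m * 2) :> R by rewrite !exprn_ge0.
have : 0 <= 16^-1 ^+ n ^+ m :> R by rewrite !exprn_ge0.
move: (2 `^ _) ((2 ^+ j) `^ _) (_ `^ ((m * 2)%:R * - _)) (2 ^+ n ^+ _) (16^-1 ^+ n ^+ m).
move=> A1 B1 A3 A2 B2 b20 a20 a30 b10 a10 J Q J0 Q0 u v x e1 e2 e3.
have -> : A1 * A2 * A3 * (B1 * B2) = (A1 * B1) * (A2 * B2) * A3 by ring.
have -> : u * v * x = (u * J) * (v * Q) * (J^-1 * Q^-1 * x).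
  by field; rewrite !gt_eqF.
apply: ler_pM => //; first by rewrite !mulr_ge0.
by apply: ler_pM => //; rewrite mulr_ge0.
Qed.

End Numeric.

(** * Chaining *)

Section Chaining.
Variables (R : realType) (d : nat).
Local Notation V := ('rV[R]_d * 'rV[R]_d)%type.

Definition scale (j n : nat) : R := 8^-1 ^+ j * 4^-1 ^+ n.

Lemma scale_gt0 j n : 0 < scale j n.
Proof. by rewrite mulr_gt0 ?exprn_gt0. Qed.

Lemma scale_le j n : scale j n <= 4^-1 ^+ n.
Proof. by rewrite ler_piMl ?exprn_ge0// exprn_ile1//; lra. Qed.

Lemma scale_le1 j n : scale j n <= 1.
Proof. by rewrite (le_trans (scale_le _ _))// exprn_ile1//; lra. Qed.

Lemma scaleS j n : scale j n.+1 = scale j n / 4.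
Proof. by rewrite /scale exprSr mulrA. Qed.

Lemma scale_lt j (e : R) : 0 < e -> exists n, scale j n < e.
Proof.
move=> e0; pose n := Num.bound e^-1.
have en : e^-1 < n%:R by apply: Num.Theory.archi_boundP; rewrite invr_ge0 ltW.
exists n; rewrite (le_lt_trans (scale_le _ _))// exprVn invf_plt ?posrE ?exprn_gt0//.
by rewrite (lt_trans en)// -natrX ltr_nat ltn_expl.
Qed.

(** Level 0 has no coarser level: the zero coefficient makes its increment the value itself and
    neutralises the default [0.-1 = 0]. *)
Definition chain_coef (n : nat) : R := if n is 0 then 0 else -1.

(** The increments along the nested cells containing [z] telescope. The weights 2^n sum them
    geometrically (the factor 2), and moving the weight from grid index to [z] costs 2^c. *)
Lemma chaining (j : nat) (c tau : R) (y : V -> R) (D : nat -> 'rV[int]_(d + d) -> R) :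
  0 <= c -> 0 <= tau -> continuous y ->
  (forall n a, D n a = y (gridpt (scale j n) a) +
    chain_coef n * y (gridpt (scale j n.-1) (parent a))) ->
  (forall n a, (1 + scale j n * (sup_int a)%:R) `^ (- c) * 2 ^+ n * `|D n a| <= tau) ->
  forall z, (1 + `|z|) `^ (- c) * `|y z| <= 2 * 2 `^ c * tau.
Proof.
move=> c0 tau0 cy Dy Dtau z.
set W := (1 + `|z|) `^ (- c); have W0 : 0 <= W by rewrite powR_ge0.
have p0 : 0 < 1 + `|z| by rewrite ltr_pwDl.
pose a n := cell (scale j n) z.
have Da n : W * `|D n (a n)| <= 2^-1 ^+ n * (2 `^ c * tau).
  have := Dtau n (a n); set w := _ `^ (- c).
  have Ww : W <= 2 `^ c * w.
    have r0 : 0 < 1 + scale j n * (sup_int (a n))%:R.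
      by rewrite ltr_pwDl// mulr_ge0// ltW// scale_gt0.
    have := powR_decr r0 (grid_norm_le z (scale_gt0 j n) (scale_le1 j n)) c0.
    rewrite powRM//.
    rewrite -/W -/w powRN => h.
    by rewrite -ler_pdivrMl ?powR_gt0.
  have tp : 0 < 2 ^+ n :> R by rewrite exprn_gt0.
  move=> h; rewrite exprVn ler_pdivlMl// mulrA.
  apply: (@le_trans _ _ (2 ^+ n * (2 `^ c * w) * `|D n (a n)|)).
    by rewrite ler_wpM2r// ler_wpM2l// ltW.
  rewrite (_ : 2 ^+ n * (2 `^ c * w) * `|D n (a n)| = 2 `^ c * (w * 2 ^+ n * `|D n (a n)|)); last by ring.
  by rewrite ler_wpM2l ?powR_ge0.
have tele n : y (gridpt (scale j n) (a n)) = \sum_(0 <= k < n.+1) D k (a k).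
  elim: n => [|n IH]; first by rewrite big_nat1 Dy mul0r addr0.
  have pa : parent (a n.+1) = a n by rewrite /a scaleS parent_cell ?scale_gt0.
  by rewrite big_nat_recr//= -IH Dy /= pa mulN1r addrC subrK.
have bn n : W * `|y (gridpt (scale j n) (a n))| <= 2 * 2 `^ c * tau.
  rewrite tele (le_trans (ler_wpM2l W0 (ler_norm_sum _ _ _)))// mulr_sumr.
  rewrite (@le_trans _ _ (\sum_(0 <= k < n.+1) 2^-1 ^+ k * (2 `^ c * tau)))//.
    by apply: ler_sum => k _; exact: Da.
  by rewrite -mulr_suml -mulrA ler_wpM2r ?mulr_ge0 ?powR_ge0// geometric_partial.
(* The bound holds at grid points tending to [z], and continuity carries it over; dividing by W + 1
   keeps the weighted error below [e]. *)
apply/ler_addgt0Pr => e e0.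
have eW : 0 < e / (W + 1) by rewrite divr_gt0// ltr_wpDl.
have /(@cvgr_dist_lt _ _ _ _ _ _ _)/(_ _ eW) := cy z.
move=> /nbhs_ballP[dl /= dl0 hdl].
have [n hn] := scale_lt j dl0.
have := hdl (gridpt (scale j n) (a n)); rewrite -ball_normE /= => /(_ _)/ltW h.
have {}h : `|y z - y (gridpt (scale j n) (a n))| <= e / (W + 1).
  by apply: h; rewrite (le_lt_trans (norm_sub_cell _ (scale_gt0 j n))).
have : `|y z| <= `|y (gridpt (scale j n) (a n))| + e / (W + 1).
  rewrite -lerBlDl (le_trans _ h)// lerB_dist//.
move=> /(ler_wpM2l W0)/le_trans; apply; rewrite mulrDr lerD//.
by rewrite mulrCA ler_piMr ?(ltW e0)// ler_pdivrMr ?ltr_wpDl// mul1r lerDl.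
Qed.

End Chaining.

(** * Moments of the Besov norm *)

Section Noise.
Variables (R : realType) (d : nat).
Hypothesis d_gt0 : (0 < d)%N.
Local Notation V := ('rV[R]_d * 'rV[R]_d)%type.
Variable chi0 : V -> R.
Hypothesis chi0_smooth : smooth chi0.
Hypothesis chi0_one : forall xi, anorm xi <= 1 -> chi0 xi = 1.
Hypothesis chi0_zero : forall xi, 4 / 3 < anorm xi -> chi0 xi = 0.
Variable ell : R.
Variables mup mum : {measure set (d.-tuple R * d.-tuple R)%type -> \bar R}.
Hypothesis hA : condA ell mup mum.
Context (dT : measure_display) (T : measurableType dT) (P : probability T R).
Variable U : (V -> R) -> T -> R.
Hypothesis hU : gaussian_noise P mup mum U.

Definition chain_noise j n (a : 'rV[int]_(d + d)) : V -> R :=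
  block_pair chi0 j (chain_coef R n) (gridpt (scale R j n) a) (gridpt (scale R j n.-1) (parent a)).

Lemma schwartz_chain_noise j n a : schwartz (chain_noise j n a).
Proof. exact: schwartz_block_pair. Qed.

(** A grid point and its parent are at distance at most four times the mesh; 8^j cancels the factor
    8^-j, and the square of 4 * 4^-n is 16 * 16^-n. *)
Lemma chain_noise_variance : exists2 C : R, 0 <= C & forall j n a,
  0 <= hinner mup mum (chain_noise j n a) (chain_noise j n a) <= C * ((2 ^+ j) `^ (- ell) * 16^-1 ^+ n).
Proof.
have [_ [_ [I1 [_ pos]]]] := hA.
have [C C0 hC] := variance_bound d_gt0 chi0_smooth chi0_one chi0_zero mum I1.
exists (16 * C); first by rewrite mulr_ge0.
move=> j n a; rewrite pos /=; last exact: schwartz_chain_noise.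
have q0 : 0 <= (2 ^+ j) `^ (- ell) :> R by rewrite powR_ge0.
case: n => [|n].
  have [+ _] := hC j (gridpt (scale R j 0) a) (gridpt (scale R j 0.-1) (parent a)).
  move=> /le_trans; apply; rewrite expr0 mulr1 ler_wpM2r// ler_peMl//.
  by rewrite ler1n.
have [_ +] := hC j (gridpt (scale R j n.+1) a) (gridpt (scale R j n) (parent a)).
move=> /le_trans; apply.
have -> : 16 * C * ((2 ^+ j) `^ (- ell) * 16^-1 ^+ n.+1) =
   C * (2 ^+ j) `^ (- ell) * (16 * 16^-1 ^+ n.+1) by ring.
rewrite ler_wpM2l ?mulr_ge0//.
have -> : 16 * 16^-1 ^+ n.+1 = (4 * 4^-1 ^+ n.+1) ^+ 2 :> R.
  by rewrite exprMn -exprM mulnC exprM; congr (_ * _ ^+ _); lra.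
rewrite lerXn2r ?nnegrE ?mulr_ge0 ?exprn_ge0//.
have e4 : scale R j n = scale R j n.+1 * 4 by rewrite scaleS divfK.
have := norm_sub_parent a (ltW (scale_gt0 R j n.+1)); rewrite -e4 => h.
rewrite (@le_trans _ _ (8 ^+ j * (scale R j n.+1 * 4)))//.
  by rewrite ler_wpM2l ?exprn_ge0// -e4.
by rewrite /scale !mulrA -exprMn divff// expr1n mul1r mulrC.
Qed.

Lemma chain_noise_moment (m : nat) : (0 < m)%N -> exists2 C : R, 0 <= C & forall j n a,
  (\int[P]_w (U (chain_noise j n a) w ^+ (m * 2))%:E <=
   (C * ((2 ^+ j) `^ (- ell) * 16^-1 ^+ n) ^+ m)%:E)%E.
Proof.
move=> m0; have [C C0 hC] := chain_noise_variance.
pose K : R := m%:R ^+ m * 4 ^+ m * Num.sqrt 2.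
have K0 : 0 <= K by rewrite !mulr_ge0 ?exprn_ge0 ?sqrtr_ge0.
exists (K * C ^+ m); first by rewrite mulr_ge0// exprn_ge0.
move=> j n a; have /andP[v0 vC] := hC j n a.
have [_ [gU _]] := hU.
apply: (le_trans (gaussian_moment m0 v0 (gU _ (schwartz_chain_noise j n a)))).
rewrite lee_fin -/K -mulrA ler_wpM2l// -exprMn lerXn2r ?nnegrE//.
exact: le_trans vC.
Qed.

Lemma measurable_noise f : schwartz f -> measurable_fun setT (U f).
Proof. by have [_ [gU _]] := hU => /gU[]. Qed.

Variables beta kappa : R.

Definition chain_weight j n r : R :=
  2 `^ (j%:R * beta) * 2 ^+ n * (1 + scale R j n * r%:R) `^ (- (kappa / 3)).

Lemma chain_weight_ge0 j n r : 0 <= chain_weight j n r.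
Proof. by rewrite !mulr_ge0 ?powR_ge0 ?exprn_ge0. Qed.

Definition chain_term (m j n r : nat) (b : {ffun 'I_(d + d) -> 'I_(r.*2.+1)}) (w : T) : \bar R :=
  ((chain_weight j n r * U (chain_noise j n (box_pt b)) w) ^+ (m * 2))%:E.

Lemma pow_even_ge0 (x : R) (m : nat) : 0 <= x ^+ (m * 2).
Proof. by rewrite mulnC exprM exprn_ge0 ?sqr_ge0. Qed.

Lemma chain_term_ge0 m j n r b w : (0 <= @chain_term m j n r b w)%E.
Proof. by rewrite lee_fin pow_even_ge0. Qed.

Lemma measurable_chain_term m j n r b : measurable_fun setT (@chain_term m j n r b).
Proof.
apply/measurable_EFinP; apply: measurable_funX; apply: measurable_funM => //.
by apply: measurable_noise; exact: schwartz_chain_noise.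
Qed.

(** The weight depends on the box radius [r]; an increment gets its own weight in the box of radius
    equal to its index norm. Summing over all boxes, levels and blocks makes [chain_total] a single
    measurable variable above every increment. *)
Definition chain_box m j n r w := (\sum_(b : {ffun 'I_(d + d) -> 'I_(r.*2.+1)}) chain_term m j n b w)%E.
Definition chain_level m j n w := (\sum_(r <oo) chain_box m j n r w)%E.
Definition chain_block m j w := (\sum_(n <oo) chain_level m j n w)%E.
Definition chain_total m w := (\sum_(j <oo) chain_block m j w)%E.

Lemma chain_box_ge0 m j n r w : (0 <= chain_box m j n r w)%E.
Proof. by apply: sume_ge0 => b _; exact: chain_term_ge0. Qed.
Lemma chain_level_ge0 m j n w : (0 <= chain_level m j n w)%E.
Proof. by apply: nneseries_ge0 => r _ _; exact: chain_box_ge0. Qed.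
Lemma chain_block_ge0 m j w : (0 <= chain_block m j w)%E.
Proof. by apply: nneseries_ge0 => r _ _; exact: chain_level_ge0. Qed.
Lemma chain_total_ge0 m w : (0 <= chain_total m w)%E.
Proof. by apply: nneseries_ge0 => r _ _; exact: chain_block_ge0. Qed.

Lemma measurable_chain_box m j n r : measurable_fun setT (chain_box m j n r).
Proof. by apply: emeasurable_sum => b; exact: measurable_chain_term. Qed.
Lemma measurable_chain_level m j n : measurable_fun setT (chain_level m j n).
Proof.
by apply: (@ge0_emeasurable_sum _ _ _ _ _ xpredT) => [k x _ _|k _];
  [exact: chain_box_ge0|exact: measurable_chain_box].
Qed.
Lemma measurable_chain_block m j : measurable_fun setT (chain_block m j).
Proof.
by apply: (@ge0_emeasurable_sum _ _ _ _ _ xpredT) => [k x _ _|k _];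
  [exact: chain_level_ge0|exact: measurable_chain_level].
Qed.
Lemma measurable_chain_total m : measurable_fun setT (chain_total m).
Proof.
by apply: (@ge0_emeasurable_sum _ _ _ _ _ xpredT) => [k x _ _|k _];
  [exact: chain_block_ge0|exact: measurable_chain_block].
Qed.

Lemma chain_term_le_total m j n r b w : (@chain_term m j n r b w <= chain_total m w)%E.
Proof.
apply: (@le_trans _ _ (chain_box m j n r w)).
  by rewrite /chain_box (bigD1 b)//= leeDl// sume_ge0// => i _; exact: chain_term_ge0.
apply: (@le_trans _ _ (chain_level m j n w)).
  by apply: (le_nneseries_term r (u := fun r => chain_box m j n r w)) => i; exact: chain_box_ge0.
apply: (@le_trans _ _ (chain_block m j w)).
  by apply: (le_nneseries_term n (u := fun n => chain_level m j n w)) => i; exact: chain_level_ge0.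
by apply: (le_nneseries_term j (u := fun j => chain_block m j w)) => i; exact: chain_block_ge0.
Qed.

Lemma integral_chain_total m : (d + d + 2 < m)%N ->
  3 * (d + d + 2)%:R + 1 <= (m * 2)%:R * (ell / 2 - beta) ->
  (d + d + 2)%:R <= (m * 2)%:R * (kappa / 3) ->
  (\int[P]_w chain_total m w < +oo)%E.
Proof.
move=> hm h1 h2; have m0 : (0 < m)%N by rewrite (leq_ltn_trans _ hm).
have [C C0 hC] := chain_noise_moment m0.
have iZ j n r b : (\int[P]_w @chain_term m j n r b w <=
    (C * (2^-1 ^+ j * 2^-1 ^+ n * ((1 + r%:R) ^+ (d + d + 2))^-1))%:E)%E.
  under eq_integral do rewrite /chain_term exprMn EFinM.
  rewrite ge0_integralZl//; last 3 first.
  - apply/measurable_EFinP; apply: measurable_funX.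
    by apply: measurable_noise; exact: schwartz_chain_noise.
  - by move=> w _; rewrite lee_fin pow_even_ge0.
  - by rewrite lee_fin pow_even_ge0.
  apply: (le_trans (lee_wpmul2l _ (hC j n (box_pt b)))); first by rewrite lee_fin pow_even_ge0.
  rewrite -EFinM lee_fin mulrCA ler_wpM2l//.
  exact: (weighted_moment_le r (erefl (scale R j n)) hm h1 h2).
(* A box has (2r+1)^(2d) <= 2^(2d) (1+r)^(2d) points, which uses 2d of the 2d + 2 available powers
   and leaves the summable (1+r)^-2. *)
pose C2 := C * 2 ^+ (d + d).
have C20 : 0 <= C2 by rewrite mulr_ge0// exprn_ge0.
have iB j n r : (\int[P]_w chain_box m j n r w <=
    (C2 * (2^-1 ^+ j * 2^-1 ^+ n) * ((1 + r%:R) ^+ 2)^-1)%:E)%E.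
  rewrite ge0_integral_sum//; last 2 first.
  - by move=> b; exact: measurable_chain_term.
  - by move=> b w _; exact: chain_term_ge0.
  apply: (le_trans (lee_sum _ (fun b _ => iZ j n r b))).
  rewrite sumEFin lee_fin sumr_const card_box -[_ *+ _]mulr_natl.
  have r1 : 0 < 1 + r%:R :> R by rewrite ltr_pwDl.
  have -> : C2 * (2^-1 ^+ j * 2^-1 ^+ n) * ((1 + r%:R) ^+ 2)^-1 =
     (2 * (1 + r%:R)) ^+ (d + d) * (C * (2^-1 ^+ j * 2^-1 ^+ n * ((1 + r%:R) ^+ (d + d + 2))^-1)).
    rewrite /C2 exprMn (exprD _ (d + d) 2) (invfM ((1 + r%:R) ^+ (d + d))).
    have x0 : (1 + r%:R) ^+ (d + d) != 0 :> R by rewrite expf_neq0// gt_eqF.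
    have aux (c a b x y z : R) : x != 0 -> c * z * (a * b) * y = z * x * (c * (a * b * (x^-1 * y))).
      by move=> xn0; field.
    exact: aux.
  rewrite ler_wpM2r ?mulr_ge0 ?exprn_ge0 ?invr_ge0 ?exprn_ge0 ?(ltW r1)//.
  rewrite natrX lerXn2r ?nnegrE ?mulr_ge0 ?(ltW r1)//.
  by rewrite -addn1 -mul2n natrD natrM; lra.
have iL j n : (\int[P]_w chain_level m j n w <= (C2 * 2 * 2^-1 ^+ j * 2^-1 ^+ n)%:E)%E.
  apply: (integral_nneseries_le (c := fun r => C2 * (2^-1 ^+ j * 2^-1 ^+ n) * ((1 + r%:R) ^+ 2)^-1)).
  - by move=> r; exact: measurable_chain_box.
  - by move=> r w; exact: chain_box_ge0.
  - by move=> r; exact: iB.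
  - move=> k; rewrite -mulr_sumr (_ : C2 * 2 * 2^-1 ^+ j * 2^-1 ^+ n = C2 * (2^-1 ^+ j * 2^-1 ^+ n) * 2); last by ring.
    by rewrite ler_wpM2l ?mulr_ge0 ?exprn_ge0// inv_sqr_partial.
have iK j : (\int[P]_w chain_block m j w <= (C2 * 4 * 2^-1 ^+ j)%:E)%E.
  apply: (integral_nneseries_le (c := fun n => C2 * 2 * 2^-1 ^+ j * 2^-1 ^+ n)).
  - by move=> r; exact: measurable_chain_level.
  - by move=> r w; exact: chain_level_ge0.
  - by move=> r; exact: iL.
  - move=> k; rewrite -mulr_sumr (_ : C2 * 4 * 2^-1 ^+ j = C2 * 2 * 2^-1 ^+ j * 2); last by ring.
    by rewrite ler_wpM2l ?mulr_ge0 ?exprn_ge0// geometric_partial.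
apply: (@le_lt_trans _ _ (C2 * 8)%:E); last exact: ltry.
apply: (integral_nneseries_le (c := fun j => C2 * 4 * 2^-1 ^+ j)).
- by move=> r; exact: measurable_chain_block.
- by move=> r w; exact: chain_block_ge0.
- exact: iK.
- move=> k; rewrite -mulr_sumr (_ : C2 * 8 = C2 * 4 * 2); last by ring.
  by rewrite ler_wpM2l ?mulr_ge0// geometric_partial.
Qed.

Variable Y : nat -> V -> T -> R.
Hypothesis hYver : forall j z, {ae P, forall w, Y j z w = U (transl z (lp_check chi0 j)) w}.
Hypothesis hYcont : forall j w, continuous (fun z => Y j z w).

(** Each identity fails on its own null set; the triples (j, n, a) are countable, so enumerating
    them by their codes gives one null set for all. *)
Lemma chain_noise_ae : {ae P, forall w, forall j n a,
  U (chain_noise j n a) w = Y j (gridpt (scale R j n) a) w +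
    chain_coef R n * Y j (gridpt (scale R j n.-1) (parent a)) w}.
Proof.
pose Q (i : nat * nat * 'rV[int]_(d + d)) w :=
  U (chain_noise i.1.1 i.1.2 i.2) w = Y i.1.1 (gridpt (scale R i.1.1 i.1.2) i.2) w +
    chain_coef R i.1.2 * Y i.1.1 (gridpt (scale R i.1.1 i.1.2.-1) (parent i.2)) w.
have aeQ i : \forall w \ae P, Q i w.
  case: i => [[j n] a].
  have sf z : schwartz (transl z (lp_check chi0 j)).
    by apply: schwartz_transl; exact: schwartz_lp_check.
  have [linU _] := hU.
  have := linU _ _ 1 (chain_coef R n) (sf (gridpt (scale R j n) a)) (sf (gridpt (scale R j n.-1) (parent a))).
  have := hYver j (gridpt (scale R j n) a).
  have := hYver j (gridpt (scale R j n.-1) (parent a)).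
  by apply: filterS3 => w e1 e2 e3; rewrite /Q /= [LHS]e3 mul1r e1 e2.
have : \forall w \ae P, forall k : nat, forall i, unpickle k = Some i -> Q i w.
  apply: ae_foralln => k; case: (unpickle k) => [i|]; last by apply: aeW => w i.
  by move: (aeQ i); apply: filterS => w qi i' [<-].
by apply: filterS => w h j n a; exact: (h (pickle (j, n, a)) (j, n, a) (pickleK _)).
Qed.

(** Each increment is bounded by the 2m-th root of [chain_total], so chaining bounds the norm by a
    constant times that root; then x^p <= 1 + x^(2m) for p <= 2m. *)
Lemma besov_norm_le (m : nat) (p : R) : (0 < m)%N -> 1 <= p -> p <= (m * 2)%:R -> 0 <= kappa ->
  exists2 K : R, 0 <= K & {ae P, forall w,
    (poweR (besov_norm beta kappa (fun j z => Y j z w)) p <= 1 + K%:E * chain_total m w)%E}.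
Proof.
move=> m0 p1 pm k0; have [C C0 hC] := rho_decay d k0.
pose G : R := C * (2 * 2 `^ (kappa / 3)).
have G0 : 0 <= G by rewrite !mulr_ge0 ?powR_ge0.
have p0 : 0 < p := lt_le_trans ltr01 p1.
have M0 : (0 < m * 2)%N by rewrite muln_gt0 m0.
(* The extra 1 makes the constant positive, so an infinite [chain_total] gives an infinite
   right-hand side. *)
exists (G ^+ (m * 2) + 1); first by rewrite addr_ge0 ?exprn_ge0.
move: chain_noise_ae; apply: filterS => w hw.
have [Zoo|Zfin] := eqVneq (chain_total m w) +oo%E.
  by rewrite Zoo gt0_muley ?lte_fin ?ltr_wpDl ?exprn_ge0// addey// leey.
have Zf : chain_total m w \is a fin_num by rewrite ge0_fin_numE ?chain_total_ge0// lt_neqAle Zfin leey.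
pose sg := fine (chain_total m w); have sg0 : 0 <= sg by rewrite fine_ge0 ?chain_total_ge0.
pose tau := sg `^ ((m * 2)%:R^-1); have tau0 : 0 <= tau by rewrite powR_ge0.
have mn0 : (m * 2)%:R != 0 :> R by rewrite pnatr_eq0 -lt0n.
have tauE : tau ^+ (m * 2) = sg by rewrite -powR_mulrn// -powRrM mulVf// powRr1.
have term j n a : chain_weight j n (sup_int a) * `|U (chain_noise j n a) w| <= tau.
  have [b ba] := box_pt_surj a.
  have := chain_term_le_total m j n b w; rewrite /chain_term ba -(fineK Zf) lee_fin -/sg -tauE => h.
  have c0 := chain_weight_ge0 j n (sup_int a).
  rewrite -(@ler_pXn2r _ (m * 2)) ?nnegrE//; last exact: mulr_ge0.
  rewrite (le_trans _ h)// [leLHS]exprMn [leRHS]exprMn.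
  apply: ler_wpM2l; first by rewrite exprn_ge0.
  by rewrite -normrX ger0_norm// pow_even_ge0.
have bj j z : 2 `^ (j%:R * beta) * (rho kappa z * `|Y j z w|) <= G * tau.
  have B0 : 0 < 2 `^ (j%:R * beta) :> R by rewrite powR_gt0.
  have := @chaining R d j (kappa / 3) (tau / 2 `^ (j%:R * beta)) (fun z => Y j z w)
    (fun n a => U (chain_noise j n a) w).
  rewrite !divr_ge0 ?(ltW B0)// => /(_ isT isT (@hYcont j w) (hw j)) h.
  have {h} := h _ z => h.
  rewrite mulrC -ler_pdivlMr//.
  apply: (@le_trans _ _ (C * ((1 + `|z|) `^ (- (kappa / 3)) * `|Y j z w|))).
    by rewrite mulrA ler_wpM2r.
  rewrite /G -!mulrA ler_wpM2l//.
  apply: (le_trans (h _)); last by rewrite !mulrA.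
  move=> n a; rewrite ler_pdivlMr//.
  apply: le_trans (term j n a); rewrite le_eqVlt; apply/orP; left; apply/eqP.
  by rewrite /chain_weight; ring.
have bes : (0 <= besov_norm beta kappa (fun j z => Y j z w) <= (G * tau)%:E)%E.
  apply/andP; split.
    apply: (@le_trans _ _ (2 `^ (0%:R * beta) * (rho kappa (0 : V) * `|Y 0%N 0 w|))%:E).
      by rewrite lee_fin !mulr_ge0// powR_ge0.
    by apply: ereal_sup_ubound; exists 0%N => //; exists 0.
  apply: ge_ereal_sup => _ [j _ [z _ <-]]; rewrite lee_fin; exact: bj.
move: bes; case: (besov_norm _ _ _) => [x| |]//; rewrite ?leye_eq// ?andbF// !lee_fin => /andP[x0 xG].
rewrite poweR_EFin -(fineK Zf) -/sg -EFinM -EFinD lee_fin.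
have x1 : x `^ p <= 1 + x ^+ (m * 2).
  have [x_le1|x_gt1] := leP x 1.
    rewrite (@le_trans _ _ 1)//; last by rewrite lerDl exprn_ge0.
    rewrite (@le_trans _ _ (1 `^ p))//; last by rewrite powR1.
    by rewrite ge0_ler_powR ?nnegrE// ltW.
  rewrite -[x ^+ _]powR_mulrn// (@le_trans _ _ (x `^ (m * 2)%:R))//; last by rewrite lerDr.
  by rewrite ler_powR// ltW.
rewrite (le_trans x1)// lerD2l (@le_trans _ _ ((G * tau) ^+ (m * 2)))//.
  by rewrite lerXn2r ?nnegrE ?mulr_ge0.
by rewrite exprMn tauE ler_wpM2r// lerDl.
Qed.

End Noise.

Unset Implicit Arguments.

Theorem mainTheorem16 (R : realType) (d : nat) (hd : (2 <= d)%N)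
  (chi0 : 'rV[R]_d * 'rV[R]_d -> R)
  (chi0_smooth : smooth chi0)
  (chi0_sym : forall xi, chi0 (- xi) = chi0 xi)
  (chi0_one : forall xi, anorm xi <= 1 -> chi0 xi = 1)
  (chi0_zero : forall xi, 4 / 3 < anorm xi -> chi0 xi = 0)
  (ell : R)
  (mup mum : {measure set (d.-tuple R * d.-tuple R)%type -> \bar R})
  (hA : condA ell mup mum)
  (dT : measure_display) (T : measurableType dT) (P : probability T R)
  (U : ('rV[R]_d * 'rV[R]_d -> R) -> T -> R)
  (hU : gaussian_noise P mup mum U)
  (* smooth (in particular continuous) version of z |-> U(tau_z check-phi_j) *)
  (Y : nat -> 'rV[R]_d * 'rV[R]_d -> T -> R)
  (hYver : forall j z, {ae P, forall w, Y j z w = U (transl z (lp_check chi0 j)) w})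
  (hYcont : forall j w, continuous (fun z => Y j z w))
  (p kappa beta : R) (hp : 1 <= p)
  (hkappa : (d%:R * 3) / p < kappa)
  (hbeta : beta < ell / 2 - (d%:R * 4) / p) :
  (\int[P]_w poweR (besov_norm beta kappa (fun j z => Y j z w)) p < +oo)%E.
Proof.
have d0 : (0 < d)%N by exact: ltnW hd.
have p0 : 0 < p := lt_le_trans ltr01 hp.
have k0 : 0 < kappa by apply: le_lt_trans hkappa; rewrite divr_ge0 ?mulr_ge0// ltW.
have dl0 : 0 < ell / 2 - beta.
  by rewrite subr_gt0 (lt_le_trans hbeta)// gerBl divr_ge0 ?mulr_ge0// ltW.
pose M : nat := (d + d + 2)%N.
(* All lower bounds required of the moment exponent are nonnegative and are simply added up, so that
   a single integer above [x] meets them together. *)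
pose x := p + M%:R + (3 * M%:R + 1) / (ell / 2 - beta) + M%:R / (kappa / 3).
have M0 : 0 <= M%:R :> R by [].
have a1 : 0 <= (3 * M%:R + 1) / (ell / 2 - beta).
  by rewrite divr_ge0 ?(ltW dl0)// addr_ge0// mulr_ge0.
have a2 : 0 <= M%:R / (kappa / 3) by rewrite divr_ge0// divr_ge0// ltW.
have x0 : 0 <= x by rewrite !addr_ge0// ltW.
pose m := Num.bound x; have xm : x < m%:R := Num.Theory.archi_boundP x0.
have m2 : (m * 2)%:R = m%:R * 2 :> R by rewrite natrM.
have xm2 : x <= (m * 2)%:R by rewrite m2; lra.
have hM : (M < m)%N by rewrite -(ltr_nat R) (le_lt_trans _ xm)// /x; lra.
have h1 : 3 * M%:R + 1 <= (m * 2)%:R * (ell / 2 - beta).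
  by rewrite -ler_pdivrMr// (le_trans _ xm2)// /x; lra.
have h2 : M%:R <= (m * 2)%:R * (kappa / 3).
  by rewrite -ler_pdivrMr ?divr_gt0// (le_trans _ xm2)// /x; lra.
have hpm : p <= (m * 2)%:R by rewrite (le_trans _ xm2)// /x; lra.
have m0 : (0 < m)%N by rewrite (leq_ltn_trans _ hM).
have Zoo := integral_chain_total d0 chi0_smooth chi0_one chi0_zero hA hU hM h1 h2.
have [K K0 hK] := besov_norm_le chi0_smooth chi0_zero hU beta hYver hYcont m0 hp hpm (ltW k0).
have mZ := measurable_chain_total chi0_smooth chi0_zero hU beta kappa m.
have Z0 w := chain_total_ge0 chi0 U beta kappa m w.
have KZ0 w : (0 <= K%:E * chain_total chi0 U beta kappa m w)%E by rewrite mule_ge0// lee_fin.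
have mKZ : measurable_fun setT (fun w => K%:E * chain_total chi0 U beta kappa m w)%E.
  exact: emeasurable_funM.
apply: (@le_lt_trans _ _ (\int[P]_w (1 + K%:E * chain_total chi0 U beta kappa m w))%E).
  apply: integral_le_of_ae_le => //.
  - by move=> w; exact: poweR_ge0.
  - exact: emeasurable_funD.
  - by move=> w; rewrite adde_ge0.
have e1 : (\int[P]_w (1 : \bar R) = 1)%E.
  by rewrite integral_cst// mul1e; exact: probability_setT.
rewrite ge0_integralD// [X in (X + _)%E]e1 ge0_integralZl//.
have ZE : (\int[P]_w chain_total chi0 U beta kappa m w)%E \is a fin_num.
  by rewrite ge0_fin_numE// integral_ge0.
by rewrite -(fineK ZE) -EFinM -EFinD ltry.
Qed.
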